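(* For each $n\geq 2$ let $\mathcal C'_n$ be the set of all cacti $u:\{1,\dots,2n-2\}\to\{1,\dots,n\}$ in $\mathcal C(n)_{n-2}$ that contain no (not necessarily contiguous) subsequence of the form $(i,j,i)$ with $j=i+1$ or $j<i$. Then there exist signs $(-1)^{p(u)}\in\{1,-1\}$, for $u\in\mathcal C'_n$, $n\geq 3$, such that there is a morphism of differential graded operads $$\psi:\mathcal A_\infty\longrightarrow\mathcal C$$ given on generators by $$\psi(m_2)=(2,1)+(1,2),\qquad\qquad \psi(m_n)=\sum_{u\in\mathcal C'_n}(-1)^{p(u)}\,u\quad(n\geq 3).$$
   Context: Let $\Bbbk$ be a commutative ring. A (dg-)operad (here always non-symmetric) $\mathcal O$ is a sequence of differential graded $\Bbbk$-modules $\mathcal O(n)$ with degree $0$ chain maps $\circ_i:\mathcal O(m)\otimes\mathcal O(n)\to\mathcal O(n+m-1)$, $1\leq i\leq m$ (the differential lowers degree by one and satisfies $d(a\circ_i b)=da\circ_i b+(-1)^{|a|}a\circ_i db$), a two-sided unit $1\in\mathcal O(1)$, and relations: (1) $(a\circ_i b)\circ_j c=(-1)^{|b||c|}(a\circ_j c)\circ_{i+n-1}b$ if $1\leq j<i$ and $c\in\mathcal O(n)$; (2) $(a\circ_i b)\circ_j c=a\circ_i(b\circ_{j-i+1}c)$ if $b\in\mathcal O(m)$ and $i\leq j<m+i$. **Surjection operad $\mathcal X$.** For $n\geq1$, $\mathcal X(n)_k$ is the free $\Bbbk$-module spanned by the non-degenerate surjections $u:\{1,\dots,n+k\}\to\{1,\dots,n\}$,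 i.e. surjective maps with $u(i)\neq u(i+1)$ for all $i$, written as sequences $u=(u(1),\dots,u(n+k))$; put $\mathcal X(0)=0$. Degenerate sequences are read as $0$. The relative degree of $(u(a),\dots,u(b))$ in $u$ is $|\{a\leq i\leq b-1: u(i)=u(i')\text{ for some } i<i'\leq n+k\}|$. Composition: for $v\in\mathcal X(m)_l$, $u\in\mathcal X(n)_k$, $1\leq t\leq m$, let $r=|v^{-1}\{t\}|$ and write $v=(v_0,t,v_1,t,\dots,v_{r-1},t,v_r)$ where the subsequences $v_q$ do not contain $t$. Then $$v\circ_t u=\sum_{1=j_0\leq j_1\leq\dots\leq j_r=n+k}\pm(\beta v_0,\alpha u_1,\beta v_1,\dots,\alpha u_r,\beta v_r),$$ where $u_p=(u(i))_{j_{p-1}\leq i\leq j_p}$, $\alpha(s)=s+t-1$, and $\beta(s)=s$ if $s<t$, $\beta(s)=s+n-1$ if $s>t$. The sign is the Koszul sign of the permutation $v_1,\dots,v_r,u_1,\dots,u_r\mapsto u_1,v_1,\dots,u_r,v_r$, where $v_q$ has degree the relative degree of $(t,v_q,t)$ in $v$ for $1\leq q<r$, $v_r$ has degree the relative degree of $(t,v_r)$ in $v$, and $u_p$ has degree its relative degree in $u$. Differential: $\delta(u)=\sum_{i}(-1)^{r_i}\delta_i(u)$, where $\delta_i(u)$ is obtained from $u$ by deleting the $i$th entry; the term is omitted if $u(i)$ is the only occurrence in $u$ of its value. Otherwise $r_i$ is the relative degree of $(u(1),\dots,u(i))$ in $u$ if $u(i)$ is not the last occurrence of its value, and is the relative degree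 of $(u(1),\dots,u(j+1))$ in $u$ if $u(i)$ is the last occurrence and $u(j)$ the penultimate occurrence of that value. **Cacti operad $\mathcal C$.** $\mathcal C=F_2\mathcal X\subset\mathcal X$ is the suboperad spanned by the cacti, i.e. the non-degenerate surjections $u$ having no (not necessarily contiguous) subsequence of the form $(i,j,i,j)$ with $i\neq j$. **$\mathcal A_\infty$.** $\mathcal A_\infty$ is the free graded (non-symmetric) operad on generators $m_n$ of arity $n$ and degree $n-2$, $n\geq2$, with differential determined by $$\partial(m_n)=\sum_{\substack{p,q\geq2,\;p+q-1=n\\ 1\leq i\leq p}}(-1)^{(i-1)+q(p-i)}\,m_p\circ_i m_q .$$ *)

(* Defs.v *)
From HB Require Import structures.
From mathcomp Require Import all_boot all_order all_algebra.
From mathcomp Require Import finmap monalg.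

Set Implicit Arguments.
Unset Strict Implicit.
Unset Printing Implicit Defensive.

Import GRing.Theory.
Local Open Scope ring_scope.

(* {malg R[B]} is used only as the free R-module on B; here B = {x : T | P x}. *)

Section FreeModule.
Variables (R : comNzRingType) (T : choiceType).

(* The basis element x, read as 0 if x does not satisfy P. *)
Definition gen (P : pred T) (x : T) : {malg R[{y : T | P y}]} :=
  if insub x is Some y then << y >> else 0.

(* A formal sum of signed terms; (e, x) stands for (-1)^e x. *)
Definition signed_sum (P : pred T) (s : seq (nat * T)) :
    {malg R[{y : T | P y}]} :=
  \sum_(x <- s) (-1) ^+ x.1 *: gen P x.2.

Definition lin_ext (P Q : pred T) (f : T -> seq (nat * T))
    (a : {malg R[{y : T | P y}]}) : {malg R[{y : T | Q y}]} :=
  \sum_(x <- msupp a) a@_x *: signed_sum Q (f (val x)).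

Definition bilin_ext (P1 P2 Q : pred T) (f : T -> T -> seq (nat * T))
    (a : {malg R[{y : T | P1 y}]}) (b : {malg R[{y : T | P2 y}]}) :
    {malg R[{y : T | Q y}]} :=
  \sum_(x <- msupp a) \sum_(y <- msupp b)
    (a@_x * b@_y) *: signed_sum Q (f (val x) (val y)).

End FreeModule.

(* The operations of a non-symmetric dg-operad: O n k is the component of     *)
(* arity n and degree k. The composition ocomp i is only meaningful for       *)
(* 1 <= i <= m.                                                               *)
Record dgOperadData (R : comNzRingType) := DGOperadData {
  ocar :> nat -> int -> lmodType R;
  ounit : ocar 1 0;
  ocomp : forall (m n : nat) (p q : int),
    nat -> ocar m p -> ocar n q -> ocar (n + m - 1)%N (p + q);
  odiff : forall (n : nat) (k : int), ocar n k -> ocar n (k - 1)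
}.

Record is_dgOperad_morphism (R : comNzRingType) (O P : dgOperadData R)
    (f : forall n k, {linear O n k -> P n k}) : Prop := {
  morph_unit : f 1%N 0 (ounit O) = ounit P;
  morph_comp : forall (m n : nat) (p q : int) (i : nat) (a : O m p) (b : O n q),
    (1 <= i <= m)%N -> f _ _ (ocomp i a b) = ocomp i (f m p a) (f n q b);
  morph_diff : forall (n : nat) (k : int) (a : O n k),
    f _ _ (odiff a) = odiff (f n k a)
}.

Section Surjections.
Local Open Scope nat_scope.
Implicit Types u v : seq nat.

(* Maps {1, ..., L} -> {1, 2, ...} are words u : seq nat of size L. Values    *)
(* are 1-based as usual, but positions are 0-based: nth 0 u i is u(i+1).      *)

Definition is_surj (n : nat) (k : int) u : bool :=
  [&& 0 < n,
      ((size u)%:Z == n%:Z + k)%R,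
      all (fun x => 0 < x <= n) u,
      all (fun x => x \in u) (iota 1 n)
    & [forall i : 'I_(size u).-1, nth 0 u i != nth 0 u i.+1]].

(* Relative degree in u of the segment occupying positions a, ..., b. *)
Definition reldeg u (a b : nat) : nat :=
  count (fun i => nth 0 u i \in drop i.+1 u) (index_iota a b).

(* The segment of u occupying positions a, ..., b - 1. *)
Definition slice u (a b : nat) : seq nat := take (b - a) (drop a u).

(* Position of the (q+1)-st occurrence of t in v, and size v if there is no   *)
(* such occurrence.                                                           *)
Definition occ (t : nat) v (q : nat) : nat :=
  nth (size v) [seq i <- iota 0 (size v) | nth 0 v i == t] q.

(* The word of a map {1, ..., L} -> {1, ..., n}. *)
Definition word_of (L n : nat) (u : L.-tuple 'I_n) : seq nat :=
  [seq (val x).+1 | x <- u].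

Definition words (L N : nat) : seq (seq nat) :=
  iter L (fun ws => [seq x :: w | x <- iota 0 N, w <- ws]) [:: [::]].

(* All 0 = j_0 <= j_1 <= ... <= j_r = L - 1. *)
Definition cuts (r L : nat) : seq (seq nat) :=
  [seq j <- words r.+1 L |
    [&& sorted leq j, nth 0 j 0 == 0 & nth 0 j r == L.-1]].

(* The terms of v o_t u, for u of arity n. The exponent runs over the pairs   *)
(* u_(p+1), v_(q+1) with p <= q, which are those that the shuffle             *)
(* v_1 ... v_r u_1 ... u_r -> u_1 v_1 ... u_r v_r interchanges.               *)
Definition surj_comp (n t : nat) v u : seq (nat * seq nat) :=
  let r := count_mem t v in
  let alpha s := s + t - 1 in
  let beta s := if s < t then s else s + n - 1 in
  let degv q := if q.+1 < r then reldeg v (occ t v q) (occ t v q.+1)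
                else reldeg v (occ t v q) (size v).-1 in
  let degu j p := reldeg u (nth 0 j p) (nth 0 j p.+1) in
  let word j :=
    map beta (slice v 0 (occ t v 0)) ++
    flatten [seq map alpha (slice u (nth 0 j q) (nth 0 j q.+1).+1) ++
                 map beta (slice v (occ t v q).+1 (occ t v q.+1))
            | q <- iota 0 r] in
  let exponent j := sumn [seq degu j p * degv q | q <- iota 0 r, p <- iota 0 q.+1] in
  [seq (exponent j, word j) | j <- cuts r (size u)].

(* Last position before i carrying the same value as position i. *)
Definition prev_occ u (i : nat) : nat :=
  last 0 [seq j <- iota 0 i | nth 0 u j == nth 0 u i].

Definition surj_diff u : seq (nat * seq nat) :=
  [seq (if nth 0 u i \in drop i.+1 u then reldeg u 0 i
        else reldeg u 0 (prev_occ u i).+1,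
        take i u ++ drop i.+1 u)
  | i <- iota 0 (size u) & 1 < count_mem (nth 0 u i) u].

Definition is_cactus u : bool :=
  all (fun i => all (fun j => (i != j) ==> ~~ subseq [:: i; j; i; j] u) u) u.

(* Membership in C'_n. *)
Definition is_cactus' (n : nat) u : bool :=
  [&& is_surj n (n%:Z - 2)%R u,
      is_cactus u
    & all (fun i => all (fun j => ((j == i.+1) || (j < i)) ==>
        ~~ subseq [:: i; j; i] u) u) u].

End Surjections.

Section SurjectionOperad.
Variable R : comNzRingType.

Definition surjection_operad : dgOperadData R :=
  @DGOperadData R (fun n k => {malg R[{u : seq nat | is_surj n k u}]})
    (gen R (is_surj 1 0) [:: 1%N])
    (fun m n p q t => bilin_ext (is_surj (n + m - 1) (p + q)) (surj_comp n t))
    (fun n k => lin_ext (is_surj n (k - 1)) surj_diff).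

Definition surj (n : nat) (k : int) (u : seq nat) : surjection_operad n k :=
  gen R (is_surj n k) u.

(* Membership in the suboperad C of the surjection operad. *)
Definition in_cacti (n : nat) (k : int) (x : surjection_operad n k) : Prop :=
  forall u : {u : seq nat | is_surj n k u}, x@_u != 0 -> is_cactus (val u).

End SurjectionOperad.

Section Trees.
Local Open Scope nat_scope.

(* The free operad on the m_n has as basis the planar trees whose vertices    *)
(* have at least two inputs; a vertex Node n f with n inputs f carries m_n,   *)
(* and leaves are numbered from left to right, starting from 1. A tree        *)
(* denotes the iterated composite of its vertex labels taken in preorder:     *)
(*   Node n [:: t_1; ...; t_n] = (...((m_n o_n t_n) o_(n-1) t_(n-1)) ...)     *)
(*                               o_1 t_1                                      *)
(* up to the Koszul sign that reorders the factors as m_n, t_1, ..., t_n.     *)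
Notation tree := (GenTree.tree unit).
Notation leaf := (GenTree.Leaf tt).

Fixpoint leaves (t : tree) : nat :=
  if t is GenTree.Node _ f then sumn (map leaves f) else 1.

Fixpoint tdeg (t : tree) : nat :=
  if t is GenTree.Node n f then n - 2 + sumn (map tdeg f) else 0.

Fixpoint wf_tree (t : tree) : bool :=
  if t is GenTree.Node n f then [&& 1 < n, size f == n & all wf_tree f]
  else true.

Definition is_tree (n : nat) (k : int) (t : tree) : bool :=
  [&& wf_tree t, leaves t == n & ((tdeg t)%:Z == k)%R].

Definition corolla (n : nat) : tree := GenTree.Node n (nseq n leaf).

(* Replace the i-th leaf of t by s. *)
Fixpoint graft (s t : tree) (i : nat) : tree :=
  if t is GenTree.Node n f then
    GenTree.Node n
      ((fix graft_forest (f : seq tree) (i : nat) : seq tree :=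
          if f is c :: f' then
            if i <= leaves c then graft s c i :: f'
            else c :: graft_forest f' (i - leaves c)
          else [::]) f i)
  else s.

(* Total degree of the vertices of t that follow its i-th leaf in preorder. *)
Fixpoint tdeg_after (t : tree) (i : nat) : nat :=
  if t is GenTree.Node _ f then
    (fix after_forest (f : seq tree) (i : nat) : nat :=
       if f is c :: f' then
         if i <= leaves c then tdeg_after c i + sumn (map tdeg f')
         else after_forest f' (i - leaves c)
       else 0) f i
  else 0.

Definition tree_comp (i : nat) (t s : tree) : seq (nat * tree) :=
  [:: (tdeg s * tdeg_after t i, graft s t i)].

(* d(m_n) at the root of Node n f: the label m_n becomes                      *)
(*   (-1)^((i-1) + q(p-i)) m_p o_i m_q,                                       *)
(* and (-1)^((q-2) (|c_1| + ... + |c_(i-1)|)) is the sign for moving m_q past *)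
(* the first i - 1 subtrees, as required by preorder.                         *)
Definition root_diff (n : nat) (f : seq tree) : seq (nat * tree) :=
  flatten
    [seq let q := n + 1 - p in
      [seq ((i - 1) + q * (p - i) + (q - 2) * sumn (map tdeg (take (i - 1) f)),
            GenTree.Node p
              (take (i - 1) f ++
               GenTree.Node q (take q (drop (i - 1) f)) ::
               drop (i - 1 + q) f))
      | i <- iota 1 p]
    | p <- index_iota 2 n].

(* The derivation extending the differential of the generators. *)
Fixpoint tree_diff (t : tree) : seq (nat * tree) :=
  if t is GenTree.Node n f then
    root_diff n f ++
    (fix forest_diff (l r : seq tree) : seq (nat * tree) :=
       if r is c :: r' then
         [seq (n - 2 + sumn (map tdeg l) + x.1,
               GenTree.Node n (l ++ x.2 :: r')) | x <- tree_diff c]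
         ++ forest_diff (rcons l c) r'
       else [::]) [::] f
  else [::].

End Trees.

Section Ainfinity.
Variable R : comNzRingType.

Definition Ainf : dgOperadData R :=
  @DGOperadData R (fun n k => {malg R[{t : GenTree.tree unit | is_tree n k t}]})
    (gen R (is_tree 1 0) (GenTree.Leaf tt))
    (fun m n p q i => bilin_ext (is_tree (n + m - 1) (p + q)) (tree_comp i))
    (fun n k => lin_ext (is_tree n (k - 1)) tree_diff).

Definition Ainf_m (n : nat) : Ainf n (n%:Z - 2) :=
  gen R (is_tree n (n%:Z - 2)) (corolla n).

End Ainfinity.

(* Main.v *)
Require Import Defs.
From HB Require Import structures.
From mathcomp Require Import all_boot all_order all_algebra.
From mathcomp Require Import finmap monalg zify ring.

Set Implicit Arguments.
Unset Strict Implicit.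
Unset Printing Implicit Defensive.

Import GRing.Theory.
Local Open Scope ring_scope.

(** The generators go to elements M n of the cacti operad that are built by a
    contracting operator, and the relation for their differentials follows by
    induction on n.

    Words are processed letter by letter. The composition of the surjection
    operad is a reader of two words: it copies v until it meets the slot, then letters
    of u, and after each of these it may return to v, in which case that letter
    is written again at the next slot (fill). The differential is a reader as
    well (del). All signs come from caesuras, i.e. occurrences of a letter that
    recurs further right. In this form the axioms of an operad (fill_nested,
    fill_parallel), the Leibniz rule (del_fill) and the closure of cacti under
    composition (fill_sorted, fill_noncrossing) are inductions on words. That the
    readers compute the given sums over cuts and positions is ev_surj_comp and
    ev_surj_diff.

    Let I be the operator on words with letters 1, ..., n that sums, up to sign,
    over all ways to replace an occurrence of a letter x, other than the top
    letter n, by x z x with z = n + 1. Put M 2 = 21 + 12 and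
    M (n+1) = (-1)^n I (M n).

    - The words in M n are exactly those of C'_n, each with coefficient 1 or -1.
      In such a word the top letter occurs once and stands between two equal
      letters: otherwise its removal would give a word longer than cprime_bound
      allows. So it can be removed in exactly one way (cprime_ins, cprime_unins,
      cprime_list_uniq).

    - In the differential of I u, the terms in which one of the two x around z is
      deleted telescope. This leaves
      d I + I d = (M 2 o_1 _) - (_ o_n M 2) on arity n (del_ins, dif_insert_top).
      Moreover I (a o_i b) is (I a) o_i b for i < p, and for i = p there is in
      addition a summand with a o_p (I b), where p is the arity of a (insert_top_circ,
      insert_top_circ_top). Applied to the terms of d (M n) this gives the terms of
      d (M (n+1)), with the required signs (dif_M).

    The free operad is spanned by trees. A tree is sent to the composite of the
    elements M n of its vertices (tmap). This respects grafting by the axioms of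
    an operad (tmap_graft), and it respects the differential by the Leibniz rule
    and the relation for d (M n) (tmap_dif). *)

(** * Signed sums of words *)

Section Ev.
Variables (R : comNzRingType) (V : lmodType R).

(** Two signed sums of words are compared through all maps phi from words to a
    module. An induction that strips a common first letter x then only has to
    replace phi by its composite with cons x. *)
Definition ev (T : Type) (phi : T -> V) (s : seq (nat * T)) : V :=
  \sum_(x <- s) (-1) ^+ x.1 *: phi x.2.

Lemma ev_nil (T : Type) (phi : T -> V) : ev phi [::] = 0.
Proof. exact: big_nil. Qed.

Lemma ev_seq1 (T : Type) (phi : T -> V) e x : ev phi [:: (e, x)] = (-1) ^+ e *: phi x.
Proof. exact: big_seq1. Qed.

Lemma ev_cat (T : Type) (phi : T -> V) s1 s2 : ev phi (s1 ++ s2) = ev phi s1 + ev phi s2.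
Proof. exact: big_cat. Qed.

Lemma eq_ev (T : Type) (phi psi : T -> V) s : phi =1 psi -> ev phi s = ev psi s.
Proof. by move=> eq; apply: eq_bigr => x _; rewrite eq. Qed.

Lemma eq_in_ev (T : eqType) (phi psi : T -> V) s :
  {in [seq x.2 | x <- s], phi =1 psi} -> ev phi s = ev psi s.
Proof.
by move=> eq; apply: eq_big_seq => x xs; rewrite eq ?map_f.
Qed.

Lemma evD (T : Type) (phi psi : T -> V) s :
  ev (fun x => phi x + psi x) s = ev phi s + ev psi s.
Proof. by rewrite -big_split; apply: eq_bigr => x _; rewrite scalerDr. Qed.

Lemma evZ (T : Type) a (phi : T -> V) s :
  ev (fun x => a *: phi x) s = a *: ev phi s.
Proof.
by rewrite /ev scaler_sumr; apply: eq_bigr => x _; rewrite !scalerA mulrC.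
Qed.

Lemma ev0 (T : Type) s : ev (fun _ : T => 0) s = 0.
Proof. by rewrite /ev big1 // => x _; rewrite scaler0. Qed.

Lemma evN (T : Type) (phi : T -> V) s :
  ev (fun x => - phi x) s = - ev phi s.
Proof. by rewrite -sumrN; apply: eq_bigr => x _; rewrite scalerN. Qed.

Lemma ev_map (T U : Type) (f : T -> U) (phi : U -> V) s :
  ev phi [seq (x.1, f x.2) | x <- s] = ev (phi \o f) s.
Proof. exact: big_map. Qed.

End Ev.

Lemma subset_tail (T : eqType) (S : {pred T}) x (v : seq T) :
  {subset x :: v <= S} -> {subset v <= S}.
Proof. by move=> vS z zv; rewrite vS // inE zv orbT. Qed.

(** * Substitution of a word into the slots of another *)

Section Fill.
Variable T : eqType.
Implicit Types (t x y : T) (u v w : seq T).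

(** An occurrence of a letter is a caesura if the letter recurs further right;
    deg counts the caesuras. It is the degree of a surjection, and all signs
    below are Koszul signs of caesuras that move past each other. *)
Fixpoint deg w : nat := if w is x :: w' then (x \in w') + deg w' else 0.

Definition econs (e : nat) x (s : seq (nat * seq T)) :=
  [seq ((e + p.1)%N, x :: p.2) | p <- s].

(** The terms of the composite of v and u in slot t, for words without common
    letters, are written from left to right. At an occurrence of t a letter y of
    u is copied, and there is a choice. Either the present piece of u ends at y;
    then the reading of v is resumed, and y :: u is kept for the next slot, as
    that piece starts with y again. Or the piece goes on with the next letter of
    u; if y is a caesura, it has then moved past the deg (t :: v) caesuras of v
    that are still to be written. The last slot receives all that is left. *)
Fixpoint fill t v : seq T -> seq (nat * seq T) :=
  if v is x :: v' then
    if x == t then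
      fix slot u :=
        if u is y :: u' then
          (if t \in v' then econs 0 y (fill t v' u) else [::])
          ++ econs ((y \in u') * deg v) y (slot u')
        else if t \in v' then [::] else [:: (0%N, v')]
    else fun u => econs 0 x (fill t v' u)
  else fun=> [:: (0%N, [::])].

Lemma fill_notin t v u : t \notin v -> fill t v u = [:: (0%N, v)].
Proof.
elim: v => //= x v IH; rewrite inE negb_or eq_sym => /andP[/negbTE-> tv].
by rewrite IH.
Qed.

Lemma fill_neq t x v u : x != t -> fill t (x :: v) u = econs 0 x (fill t v u).
Proof. by move=> /= /negbTE->. Qed.

Lemma fill_slot_nil t v :
  fill t (t :: v) [::] = if t \in v then [::] else [:: (0%N, v)].
Proof. by rewrite /= eqxx. Qed.

Lemma fill_slot t v y u :
  fill t (t :: v) (y :: u) =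
    (if t \in v then econs 0 y (fill t v (y :: u)) else [::])
    ++ econs ((y \in u) * deg (t :: v)) y (fill t (t :: v) u).
Proof. by rewrite [LHS]/= [in RHS]/= eqxx. Qed.

(** The nested recursion of fill as an induction principle; the words without
    t, which fill does not change, form a single case. *)
Lemma fill_ind t (P : seq T -> seq T -> Prop) :
  (forall v u, t \notin v -> P v u) ->
  (forall x v u, x != t -> t \in v -> P v u -> P (x :: v) u) ->
  (forall v, P (t :: v) [::]) ->
  (forall v y u, (t \in v -> P v (y :: u)) -> P (t :: v) u -> P (t :: v) (y :: u)) ->
  forall v u, P v u.
Proof.
move=> P0 Px Pn Ps; elim=> [|x v IH] u; first exact: P0.
have [->|xt] := eqVneq x t; first by elim: u => // y u IHu; apply: Ps.
by have [tv|tv] := boolP (t \in v); [exact: Px | apply: P0; rewrite inE negb_or eq_sym xt].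
Qed.

Section EvFill.
Variables (R : comNzRingType) (V : lmodType R).
Implicit Types phi : seq T -> V.

Lemma ev_econs e x s phi :
  ev phi (econs e x s) = (-1) ^+ e *: ev (fun w => phi (x :: w)) s.
Proof.
rewrite /ev big_map scaler_sumr; apply: eq_bigr => p _ /=.
by rewrite scalerA exprD.
Qed.

Lemma ev_fill_neq t x v u phi : x != t ->
  ev phi (fill t (x :: v) u) = ev (fun w => phi (x :: w)) (fill t v u).
Proof. by move=> xt; rewrite fill_neq // ev_econs scale1r. Qed.

Lemma ev_fill_notin t v u phi : t \notin v -> ev phi (fill t v u) = phi v.
Proof. by move=> tv; rewrite fill_notin // ev_seq1 scale1r. Qed.

Lemma ev_fill_slot t v y u phi :
  ev phi (fill t (t :: v) (y :: u)) =
    (if t \in v then ev (fun w => phi (y :: w)) (fill t v (y :: u)) else 0)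
    + (-1) ^+ ((y \in u) * deg (t :: v)) *:
        ev (fun w => phi (y :: w)) (fill t (t :: v) u).
Proof.
rewrite fill_slot ev_cat ev_econs; congr (_ + _).
by case: ifP; rewrite ?ev_nil // ev_econs scale1r.
Qed.

Lemma ev_fill_slot_nil t v phi :
  ev phi (fill t (t :: v) [::]) = if t \in v then 0 else phi v.
Proof.
by rewrite fill_slot_nil; case: ifP; rewrite ?ev_nil // ev_seq1 scale1r.
Qed.

End EvFill.

Definition outs (s : seq (nat * seq T)) := [seq p.2 | p <- s].

Lemma outs_econs e x s : outs (econs e x s) = [seq x :: w | w <- outs s].
Proof. by rewrite /outs /econs -!map_comp. Qed.

Lemma outs_cat s1 s2 : outs (s1 ++ s2) = outs s1 ++ outs s2.
Proof. exact: map_cat. Qed.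

Lemma fill_mem t v u w : t \in v -> t \notin u -> w \in outs (fill t v u) ->
  w =i [predU [predD1 v & t] & u].
Proof.
move=> tv tu; move: v u tv tu w; apply: (@fill_ind t).
- by move=> v u /negPf->.
- move=> x v u xt tv IH _ tu w; rewrite fill_neq // outs_econs => /mapP[w' w'o -> z].
  have := IH tv tu _ w'o z; rewrite !inE => ->.
  by have [->|] := eqVneq z x; rewrite ?xt.
- move=> v _ _ w; rewrite fill_slot_nil; case: ifP => // tv.
  rewrite inE => /eqP -> z; rewrite !inE orbF.
  by have [->|] := eqVneq z t; rewrite ?tv.
- move=> v y u IHv IHu _; rewrite inE negb_or => /andP[ty tu] w.
  rewrite fill_slot outs_cat mem_cat => /orP[|].
    case: ifP => // tv; rewrite outs_econs => /mapP[w' w'o -> z].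
    have tu' : t \notin y :: u by rewrite inE negb_or ty.
    have := IHv tv tv tu' w' w'o z; rewrite !inE => ->.
    by case: (z == y); case: (z == t); rewrite /= ?orbT ?orbF.
  rewrite outs_econs => /mapP[w' w'o -> z].
  have := IHu (mem_head _ _) tu _ w'o z; rewrite !inE => ->.
  by case: (z == y); case: (z == t); rewrite /= ?orbT ?orbF.
Qed.

Lemma deg_fill t v u w : t \in v -> t \notin u ->
  {in u, forall x, x \notin v} -> w \in outs (fill t v u) ->
  deg w = (deg v + deg u)%N.
Proof.
move=> tv tu; move: v u tv tu w; apply: (@fill_ind t).
- by move=> v u /negPf->.
- move=> x v u xt tv IH _ tu w dis; rewrite fill_neq // outs_econs => /mapP[w' w'o ->] /=.
  rewrite (IH tv tu w') // => [|z /dis]; last by rewrite inE negb_or => /andP[].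
  rewrite (fill_mem tv tu w'o) !inE xt /= addnA; congr (nat_of_bool _ + _ + _)%N.
  case: (boolP (x \in u)) => [xu|]; rewrite ?orbF //.
  by have := dis x xu; rewrite mem_head.
- move=> v _ _ w _; rewrite fill_slot_nil; case: ifP => // tv.
  by rewrite inE => /eqP -> /=; rewrite tv addn0.
- move=> v y u IHv IHu _; rewrite inE negb_or => /andP[ty tu] w dis.
  rewrite fill_slot outs_cat mem_cat => /orP[|].
    case: ifP => // tv; rewrite outs_econs => /mapP[w' w'o ->] /=.
    have tu' : t \notin y :: u by rewrite inE negb_or ty.
    rewrite (IHv tv tv tu' w') // => [|z /dis]; last by rewrite inE negb_or => /andP[].
    by rewrite (fill_mem tv tu' w'o) !inE eqxx orbT /= tv addnA.
  rewrite outs_econs => /mapP[w' w'o ->] /=.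
  rewrite (IHu (mem_head _ _) tu w') // => [|z zu]; last by apply: dis; rewrite inE zu orbT.
  rewrite (fill_mem (mem_head _ _) tu w'o) /= !inE.
  have -> : (y \in v) = false.
    by have := dis y (mem_head _ _); rewrite inE negb_or => /andP[_ /negbTE].
  by rewrite eq_sym (negbTE ty) /=; lia.
Qed.
End Fill.
Arguments fill : simpl never.

(** * Associativity of substitution *)

Section Assoc.
Variables (R : comNzRingType) (V : lmodType R) (T : eqType).
Implicit Types (t s x y : T) (u v w : seq T) (phi : seq T -> V).

Lemma dis_cons x u v : {in u, forall z, z \notin x :: v} -> {in u, forall z, z \notin v}.
Proof. by move=> h z /h; rewrite inE negb_or => /andP[]. Qed.

Lemma dis_tail x u v : {in x :: u, forall z, z \notin v} -> {in u, forall z, z \notin v}.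
Proof. by move=> h z zu; apply: h; rewrite inE zu orbT. Qed.

Lemma ev_if (U : eqType) (b : bool) (s : seq (nat * U)) (f g : U -> V) :
  ev (fun o => if b then f o else g o) s = if b then ev f s else ev g s.
Proof. by case: b. Qed.

(** This is the sequential axiom of an operad. Both sides read v up to its first slot, then u up
    to its first slot, and there write the same letter z of w. The three choices
    that follow (to stay in w, to resume u, to resume v) also agree, and so do
    the signs: a caesura z that stays in w passes the caesuras of t :: v and
    those of s :: u. *)
Lemma fill_nested t s v u w phi : t != s -> t \in v -> s \notin v ->
  t \notin u -> t \notin w -> s \notin w ->
  {in u, forall z, z \notin v} -> {in w, forall z, z \notin v} ->
  {in w, forall z, z \notin u} ->
  ev (fun o => ev phi (fill s o w)) (fill t v u)
  = ev (fun o => ev phi (fill t v o)) (fill s u w).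
Proof.
move=> ts; move: v u w phi; apply: (@fill_ind _ t).
- by move=> v u /negPf->.
- move=> x v u xt tv IH w phi _; rewrite inE negb_or => /andP[sx sv] tu tw sw uv wv wu.
  rewrite ev_fill_neq //.
  under eq_ev do rewrite ev_fill_neq 1?eq_sym //.
  rewrite IH //; try by [exact: dis_cons uv | exact: dis_cons wv].
  by apply: eq_ev => o; rewrite ev_fill_neq.
- move=> v w phi _ sv _ tw sw _ wv _.
  rewrite (ev_fill_notin (t := s) (v := [::])) //.
  rewrite !ev_fill_slot_nil ev_fill_notin //.
  by case/norP: sv.
move=> v y u IHv IHu w phi _ sv tu tw sw uv wv wu.
have tu' : t \notin u by case/norP: tu.
have uv' := dis_tail uv; have wu' := dis_cons wu.
have sv' : s \notin v by case/norP: sv.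
have [ys|ys] := eqVneq y s; last first.
  rewrite ev_fill_slot.
  have inner o : ev phi (fill s (y :: o) w) = ev (fun o => phi (y :: o)) (fill s o w).
    by rewrite ev_fill_neq.
  rewrite !(eq_ev _ inner).
  rewrite IHu ?mem_head // ev_fill_neq //.
  under [RHS]eq_in_ev => o oin.
    rewrite ev_fill_slot.
    have -> : (y \in o) = (y \in u).
      have [su|su] := boolP (s \in u); last by move: oin; rewrite fill_notin //= inE => /eqP->.
      rewrite (fill_mem su sw oin) !inE ys /=.
      case: (boolP (y \in w)); rewrite ?orbF // => /wu.
      by rewrite inE eqxx.
    over.
  rewrite evD evZ ev_if ev0; congr (_ + _).
  case: ifP => // tv; rewrite (IHv tv) //; first by rewrite ev_fill_neq.
  - exact: dis_cons uv.
  - exact: dis_cons wv.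
subst y; move: w phi tw sw wv wu wu'; elim=> [|z w IHw] phi tw sw wv wu wu'.
  rewrite ev_fill_slot_nil ev_fill_slot.
  under [X in (if _ then X else _) + _]eq_ev do rewrite ev_fill_slot_nil.
  under [X in _ + _ *: X]eq_ev do rewrite ev_fill_slot_nil.
  rewrite (_ : (if t \in v then _ else 0) = 0) ?add0r; last first.
    case: ifP => // tv; rewrite -[RHS](ev0 (T := seq T) V (fill t v (s :: u))).
    apply: eq_in_ev => o oin.
    by rewrite (fill_mem tv tu oin) !inE eqxx orbT.
  under eq_in_ev => o oin.
    rewrite (_ : s \in o = (s \in u)); last first.
      rewrite (fill_mem _ tu' oin) ?mem_head // !inE (negbTE sv') orbF.
      by rewrite eq_sym andNb.
    over.
  by rewrite ev_if ev0; case: (s \in u); rewrite ?scaler0 // scale1r.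
have tz : t != z by case/norP: tw.
have tw' : t \notin w by case/norP: tw.
have zs : z != s by rewrite eq_sym; case/norP: sw.
have sw' : s \notin w by case/norP: sw.
have zu : z \notin u by apply: wu'; rewrite mem_head.
have suv o : t \in v -> o \in outs (fill t v (s :: u)) ->
    (s \in o) /\ deg (s :: o) = (deg (t :: v) + deg (s :: u))%N.
  move=> tv oin; have so : s \in o by rewrite (fill_mem tv tu oin) !inE eqxx orbT.
  split=> //=; rewrite so tv (deg_fill tv tu _ oin) ?addnA //=; exact: dis_cons uv.
have su o : o \in outs (fill t (t :: v) u) ->
    (s \in o) = (s \in u) /\ deg (s :: o) = (deg (t :: v) + deg (s :: u))%N.
  move=> oin; have so : (s \in o) = (s \in u).
    by rewrite (fill_mem _ tu' oin) ?mem_head // !inE (negbTE sv') orbF eq_sym andNb.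
  by split=> //=; rewrite so (deg_fill _ tu' _ oin) ?mem_head // addnCA.
pose phi' o := phi (z :: o).
pose F o := ev phi' (fill s o (z :: w)); pose G o := ev phi' (fill s (s :: o) w).
pose D := (deg (t :: v) + deg (s :: u))%N.
have GE : ev (fun o => ev phi' (fill t (t :: v) o)) (fill s (s :: u) w) =
    (if t \in v then ev G (fill t v (s :: u)) else 0)
    + (-1) ^+ ((s \in u) * deg (t :: v)) *: ev G (fill t (t :: v) u).
  rewrite -IHw //; first by rewrite ev_fill_slot.
  - exact: dis_tail wv.
  - exact: dis_tail wu.
  - exact: dis_tail wu'.
transitivity ((if t \in v then ev F (fill t v (s :: u)) else 0)
    + (if s \in u then (-1) ^+ deg (t :: v) *: ev F (fill t (t :: v) u) else 0)
    + (-1) ^+ ((z \in w) * D) *: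
        ev (fun o => ev phi' (fill t (t :: v) o)) (fill s (s :: u) w)).
  rewrite GE ev_fill_slot scalerDr addrACA; congr (_ + _).
    case: ifP => tv; last by rewrite scaler0 addr0.
    rewrite -evZ -evD; apply: eq_in_ev => o /(suv o tv)[so so'].
    by rewrite ev_fill_slot so so'.
  rewrite [X in _ = _ + X]scalerA mulrC -scalerA -[X in _ = _ + _ *: X]evZ.
  rewrite (_ : (if s \in u then _ else 0) = (-1) ^+ ((s \in u) * deg (t :: v)) *:
      ev (fun o => if s \in u then F o else 0) (fill t (t :: v) u)); last first.
    by rewrite ev_if ev0; case: ifP => _; rewrite ?mul1n // scaler0.
  rewrite -scalerDr -evD; congr (_ *: _); apply: eq_in_ev => o /su[so so'].
  by rewrite ev_fill_slot so so'.
rewrite [RHS]ev_fill_slot.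
have zo1 o : s \in u -> o \in outs (fill s u (z :: w)) -> z \in o.
  by move=> su' /(fill_mem su' sw) ->; rewrite !inE eqxx orbT.
have zo2 o : o \in outs (fill s (s :: u) w) -> (z \in o) = (z \in w).
  by move=> /(fill_mem (mem_head _ _) sw') ->; rewrite !inE (negbTE zu) (negbTE zs).
have -> : (if t \in v then ev F (fill t v (s :: u)) else 0) =
    (if t \in v then
      (if s \in u then ev (fun o => ev phi' (fill t v (z :: o))) (fill s u (z :: w)) else 0)
      + (-1) ^+ ((z \in w) * deg (s :: u)) *:
         ev (fun o => ev phi' (fill t v (z :: o))) (fill s (s :: u) w) else 0).
  case: ifP => // tv; rewrite (IHv tv) //; first by rewrite ev_fill_slot.
  - exact: dis_cons uv.
  - exact: dis_cons wv.
have -> : ev F (fill t (t :: v) u) =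
    ev (fun o => ev phi' (fill t (t :: v) o)) (fill s u (z :: w)).
  rewrite IHu ?mem_head //; exact: dis_tail uv.
rewrite [X in _ = _ + _ *: X](eq_in_ev (psi := fun o =>
   (if t \in v then ev phi' (fill t v (z :: o)) else 0)
   + (-1) ^+ ((z \in w) * deg (t :: v)) *: ev phi' (fill t (t :: v) o))); last first.
  by move=> o oin; rewrite ev_fill_slot (zo2 _ oin).
rewrite (_ : (if s \in u then ev (fun o => ev phi _) _ else 0) =
  (if s \in u then (if t \in v then ev (fun o => ev phi' (fill t v (z :: o)))
     (fill s u (z :: w)) else 0) +
   (-1) ^+ deg (t :: v) *: ev (fun o => ev phi' (fill t (t :: v) o))
     (fill s u (z :: w)) else 0)); last first.
  case: ifP => // su'; rewrite -evZ.
  transitivity (ev (fun o => (if t \in v then ev phi' (fill t v (z :: o)) else 0)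
     + (-1) ^+ deg (t :: v) *: ev phi' (fill t (t :: v) o)) (fill s u (z :: w))).
    by apply: eq_in_ev => o oin; rewrite ev_fill_slot (zo1 o) // mul1n.
  by rewrite evD ev_if ev0.
rewrite evD ev_if ev0 evZ scalerDr scalerA -exprD -mulnDr addrA -/D (addnC (deg (s :: u))).
congr (_ + _); case: ifP => tv; case: ifP => // su'; rewrite ?scaler0 ?add0r ?addr0 //.
by rewrite addrAC.
Qed.

(** The induction step at a slot. It is separate because it serves for both slots,
    with t and s exchanged. *)
Lemma fill_parallel_slot t s v : t != s ->
  (forall u w phi, t \notin u -> t \notin w -> s \notin u -> s \notin w ->
    {in u, forall z, z \notin v} -> {in w, forall z, z \notin v} ->
    {in w, forall z, z \notin u} ->
    ev (fun o => ev phi (fill s o w)) (fill t v u)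
    = (-1) ^+ ((t \in v) * (s \in v) * (deg u * deg w)) *:
      ev (fun o => ev phi (fill t o u)) (fill s v w)) ->
  forall u w phi, t \notin u -> t \notin w -> s \notin u -> s \notin w ->
    {in u, forall z, z \notin t :: v} -> {in w, forall z, z \notin t :: v} ->
    {in w, forall z, z \notin u} ->
    ev (fun o => ev phi (fill s o w)) (fill t (t :: v) u)
    = (-1) ^+ ((t \in t :: v) * (s \in t :: v) * (deg u * deg w)) *:
      ev (fun o => ev phi (fill t o u)) (fill s (t :: v) w).
Proof.
move=> ts IH; elim=> [|y u IHu] w phi tu tw su sw uv wv wu.
  all: rewrite [in RHS]ev_fill_neq // inE eqxx mul1n inE eq_sym (negbTE ts) /=.
  all: have wv' := dis_cons wv.
  all: have oE o : o \in outs (fill s v w) -> (t \in o) = (t \in v) /\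
         deg o = (deg v + (s \in v) * deg w)%N.
    1,3: have [sv|sv] := boolP (s \in v); last first.
    1,3: by rewrite fill_notin // inE => /eqP->; rewrite addn0.
    1,2: move=> oin; rewrite (deg_fill sv sw) // (fill_mem sv sw oin).
    1,2: by rewrite !inE ts (negbTE tw) orbF mul1n.
  rewrite ev_fill_slot_nil mul0n muln0 scale1r.
  under [RHS]eq_in_ev => o /oE[to _].
    rewrite ev_fill_slot_nil to.
    over.
  by rewrite ev_if ev0.
rewrite ev_fill_slot.
have ys : y != s by move: su; rewrite inE negb_or eq_sym => /andP[].
have inner o : ev phi (fill s (y :: o) w) = ev (fun o' => phi (y :: o')) (fill s o w).
  by rewrite ev_fill_neq.
rewrite !(eq_ev _ inner).
under [in RHS]eq_in_ev => o /oE[to dego].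
  rewrite ev_fill_slot /= to dego addnA.
  over.
rewrite evD ev_if ev0 evZ scalerDr; congr (_ + _).
  case: ifP => tv; last by rewrite scaler0.
  by rewrite IH // ?tv ?mul1n //; exact: dis_cons uv.
move: tu su; rewrite !inE !negb_or => /andP[_ tu] /andP[_ su].
rewrite IHu //; last 2 first.
- exact: dis_tail uv.
- exact: dis_cons wu.
rewrite [X in _ *: (_ *: X)]ev_fill_neq // inE eqxx inE eq_sym (negbTE ts) /=.
rewrite !scalerA -!exprD; congr (_ *: _).
rewrite -signr_odd -[RHS]signr_odd; congr (_ ^+ nat_of_bool _).
by rewrite /= !(oddD, oddM); case: (y \in u); case: (s \in v); case: (odd (deg u)); case: (odd (deg w)); case: (odd (deg v)); case: (t \in v).
Qed.

(** This is the parallel axiom of an operad. Consider a caesura of u and one of w. If u is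
    substituted first, then w is inserted into a word that contains u, and the
    caesura of w passes the one of u when the latter is further right; in the
    other order the caesura of u passes the one of w when the latter is further
    right. Exactly one of the two happens, whence the sign. *)
Lemma fill_parallel t s v u w phi : t != s ->
  t \notin u -> t \notin w -> s \notin u -> s \notin w ->
  {in u, forall z, z \notin v} -> {in w, forall z, z \notin v} ->
  {in w, forall z, z \notin u} ->
  ev (fun o => ev phi (fill s o w)) (fill t v u)
  = (-1) ^+ ((t \in v) * (s \in v) * (deg u * deg w)) *:
    ev (fun o => ev phi (fill t o u)) (fill s v w).
Proof.
move=> ts; elim: v u w phi => [|x v IH] u w phi tu tw su sw uv wv wu.
  by rewrite !ev_fill_notin // scale1r.
have [xt|xt] := eqVneq x t; first by subst x; apply: fill_parallel_slot.
have [xs|xs] := eqVneq x s.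
  subst x; rewrite fill_parallel_slot 1?eq_sym //; last 2 first.
  - move=> u' w' phi' ? ? ? ? ? ? dis; rewrite IH //; last first.
      by move=> z zu; apply/negP => zw; have := dis _ zw; rewrite zu.
    rewrite scalerA -exprD -signr_odd oddD.
    by rewrite [X in odd X (+) _](_ : _ = (t \in v) * (s \in v) * (deg w' * deg u'))%N ?addbb ?scale1r //; lia.
  - by move=> z zu; apply/negP => zw; have := wu _ zw; rewrite zu.
  rewrite scalerA -exprD -signr_odd oddD.
  by rewrite [X in odd X (+) _](_ : _ = (s \in s :: v) * (t \in s :: v) * (deg w * deg u))%N ?addbb ?scale1r //; lia.
rewrite !ev_fill_neq //.
under eq_ev do rewrite ev_fill_neq //.
under [in RHS]eq_ev do rewrite ev_fill_neq //.
rewrite !inE ![_ == x]eq_sym (negbTE xt) (negbTE xs) /= IH //.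
- exact: dis_cons uv.
- exact: dis_cons wv.
Qed.
End Assoc.

(** * The differential and its Leibniz rule *)

Section Del.
Variables (R : comNzRingType) (V : lmodType R) (T : eqType).
Implicit Types (t s x y z : T) (u v w o : seq T) (phi psi : seq T -> V) (c : T -> R).

Definition upd c x a : T -> R := fun z => if z == x then a else c z.

(** For c = 0 this is the differential, read from left to right. The value c x is
    the coefficient with which the last occurrence of x is to be deleted. It is
    0 as long as x has not been read, because a letter that occurs only once is
    not deleted. Passing a caesura x changes the sign of all later deletions.
    This global sign is kept outside of c, so that the other values of c have to
    be negated, and c x becomes 1: the sign of the last occurrence is the one
    valid just after the penultimate occurrence. General c are needed for the
    induction. *)
Fixpoint del c v phi : V :=
  if v is x :: v' then
    if x \in v' then
      phi v' - del (upd (fun z => - c z) x 1) v' (fun w => phi (x :: w))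
    else c x *: phi v' + del c v' (fun w => phi (x :: w))
  else 0.

Lemma eq_in_del c c' v phi psi : {in v, c =1 c'} ->
  (forall w, {subset w <= v} -> phi w = psi w) -> del c v phi = del c' v psi.
Proof.
elim: v c c' phi psi => //= x v IH c c' phi psi cc pp.
have sub : {subset v <= x :: v} by move=> z zv; rewrite inE zv orbT.
have step d d' : {in v, d =1 d'} ->
    del d v (fun w => phi (x :: w)) = del d' v (fun w => psi (x :: w)).
  move=> dd; apply: IH => // w wv; apply: pp => z; rewrite !inE.
  by case/orP => [->//|/wv->]; rewrite orbT.
rewrite (pp v sub) (cc x) ?mem_head //; case: ifP => xv; last first.
  by rewrite (step c c') // => z zv; rewrite cc // sub.
by congr (_ - _); apply: step => z zv; rewrite /upd cc // sub.
Qed.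

Lemma eq_del c c' v phi psi : c =1 c' -> phi =1 psi -> del c v phi = del c' v psi.
Proof. by move=> cc pp; apply: eq_in_del. Qed.

Lemma delD c v phi psi :
  del c v (fun w => phi w + psi w) = del c v phi + del c v psi.
Proof.
elim: v c phi psi => [|x v IH] c phi psi /=; first by rewrite addr0.
by rewrite !IH; case: ifP; rewrite ?opprD ?scalerDr addrACA.
Qed.

Lemma delZ c v a phi : del c v (fun w => a *: phi w) = a *: del c v phi.
Proof.
elim: v c phi => [|x v IH] c phi /=; first by rewrite scaler0.
by rewrite !IH; case: ifP; rewrite ?scalerBr ?scalerDr // !scalerA mulrC.
Qed.

Lemma del0 c v : del c v (fun=> 0) = 0.
Proof.
by rewrite -[RHS](scale0r (del c v (fun=> 0))) -delZ; apply: eq_del => // w; rewrite scaler0.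
Qed.

(** The only deletion after which y is missing is that of its only occurrence,
    and this term carries the coefficient c y. A weight that depends on the
    presence of y can therefore be absorbed into c y. *)
Lemma del_mem c v y a a' b phi : y \in v -> a * a' = b ->
  del c v (fun w => (if y \in w then a else b) *: phi w) =
  a *: del (upd c y (a' * c y)) v phi.
Proof.
move=> yv <-; elim: v yv c phi => //= x v IH yv c phi.
have [->|xy] := eqVneq x y.
  have tail d e : {in v, d =1 e} ->
      del d v (fun w => (if y \in y :: w then a else a * a') *: phi (y :: w)) =
      a *: del e v (fun w => phi (y :: w)).
    move=> de; rewrite -delZ; apply: eq_in_del => // w _.
    by rewrite mem_head.
  case: ifP => yv'.
    rewrite scalerBr yv' (tail _ (upd (fun z => - upd c y (a' * c y) z) y 1)) //.
    by move=> z _; rewrite /upd; case: ifP => // ->.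
  rewrite yv' /upd eqxx scalerDr !scalerA; congr (_ *: _ + _).
    by ring.
  by apply: tail => z zv; rewrite /upd; case: eqP => // zy; rewrite -zy zv in yv'.
have yv' : y \in v by move: yv; rewrite inE eq_sym (negbTE xy).
have tail d e : (upd d y (a' * d y)) =1 e ->
   del d v (fun w => (if y \in x :: w then a else a * a') *: phi (x :: w)) =
      a *: del e v (fun w => phi (x :: w)).
  move=> de; rewrite -(eq_del _ de (fun=> erefl)) -IH //.
  by apply: eq_del => // w; rewrite inE eq_sym (negbTE xy).
rewrite yv'; case: ifP => xv.
  rewrite scalerBr (tail _ (upd (fun z => - upd c y (a' * c y) z) x 1)) //.
  move=> z; rewrite /upd [y == x]eq_sym (negbTE xy).
  case: (eqVneq z y) => [->|] //; rewrite [y == x]eq_sym (negbTE xy).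
  by rewrite mulrN.
rewrite /upd (negbTE xy) scalerDr !scalerA mulrC; congr (_ + _).
by apply: tail.
Qed.

Lemma del_sign_mem c v y d phi : y \in v ->
  del c v (fun w => (-1) ^+ ((y \in w) * d) *: phi w) =
  (-1) ^+ d *: del (upd c y ((-1) ^+ d * c y)) v phi.
Proof.
move=> yv; rewrite -(@del_mem _ _ _ _ _ 1) //; last by rewrite -exprD addnn -signr_odd odd_double.
by apply: eq_del => // w; case: ifP; rewrite ?mul1n.
Qed.

Lemma del_if_mem c v y phi : y \in v ->
  del c v (fun w => if y \in w then phi w else 0) = del (upd c y 0) v phi.
Proof.
move=> yv; rewrite -[RHS]scale1r -(mul0r (c y)) -(@del_mem _ _ _ _ _ 0) ?mulr0 //.
by apply: eq_del => // w; case: ifP; rewrite ?scale1r ?scale0r.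
Qed.

(** A deletion lowers deg by one, except for that of the only occurrence of a
    letter, which leaves deg unchanged. These exceptional terms are the ones
    that involve c. *)
Lemma del_sign_deg c v phi :
  del c v (fun w => (-1) ^+ deg w *: phi w) =
  - ((-1) ^+ deg v *: del (fun z => - c z) v phi).
Proof.
elim: v c phi => [|x v IH] c phi /=; first by rewrite scaler0 oppr0.
case: ifP => xv.
  have -> : del (upd (fun z => - c z) x 1) v
      (fun w => (-1) ^+ ((x \in w) + deg w) *: phi (x :: w)) =
     del (upd (fun z => - c z) x 1) v
      (fun w => (-1) ^+ ((x \in w) * 1) *: ((-1) ^+ deg w *: phi (x :: w))).
    by apply: eq_del => // w; rewrite scalerA -exprD muln1.
  rewrite del_sign_mem // expr1 IH exprS !mulN1r scaleN1r opprK scaleNr opprK scalerBr.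
  congr (_ - _ *: _); apply: eq_del => // z; rewrite /upd eqxx.
  by case: eqP; rewrite ?opprK ?mulr1.
rewrite add0n [X in _ + X](eq_in_del (c' := c)
  (psi := fun w => (-1) ^+ deg w *: phi (x :: w))) //; last first.
  move=> w wv; rewrite (_ : x \in w = false) //.
  by apply/negP => /wv; rewrite xv.
by rewrite IH scalerDr opprD !scalerA mulrN scaleNr opprK mulrC.
Qed.

Lemma updE c x a z : upd c x a z = if z == x then a else c z.
Proof. by []. Qed.

Lemma del_cons_in c x v phi : x \in v ->
  del c (x :: v) phi = phi v - del (upd (fun z => - c z) x 1) v (fun w => phi (x :: w)).
Proof. by move=> /= ->. Qed.

Lemma del_cons_notin c x v phi : x \notin v ->
  del c (x :: v) phi = c x *: phi v + del c v (fun w => phi (x :: w)).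
Proof. by move=> /= /negbTE->. Qed.

(** A deletion that removes t altogether does the same as filling the slots t with
    the empty word: either is possible only if t occurs once. *)
Lemma del_only c t v phi : t \in v ->
  del c v (fun w => if t \in w then 0 else phi w) = c t *: ev phi (fill t v [::]).
Proof.
elim: v c phi => // x v IH c phi.
have [->|xt] := eqVneq x t => tv.
  have E d : del d v (fun w => if t \in t :: w then 0 else phi (t :: w)) = 0.
    by rewrite -[RHS](del0 d v); apply: eq_del => // w; rewrite mem_head.
  rewrite ev_fill_slot_nil; case: ifP => tv'.
    by rewrite del_cons_in // tv' E subrr scaler0.
  by rewrite del_cons_notin ?tv' // E addr0.
have tv' : t \in v by move: tv; rewrite inE eq_sym (negbTE xt).
rewrite ev_fill_neq //.
have E d : del d v (fun w => if t \in x :: w then 0 else phi (x :: w)) =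
     d t *: ev (fun w => phi (x :: w)) (fill t v [::]).
  by rewrite -IH //; apply: eq_del => // w; rewrite inE eq_sym (negbTE xt).
have [xv|xv] := boolP (x \in v).
  by rewrite del_cons_in // tv' E updE eq_sym (negbTE xt) sub0r scaleNr opprK.
by rewrite del_cons_notin // tv' E scaler0 add0r.
Qed.

Lemma del_fill_slot_nil t v c phi :
  ev (fun o => del c o phi) (fill t (t :: v) [::]) =
  del (upd c t 0) (t :: v) (fun w => ev phi (fill t w [::])).
Proof.
rewrite ev_fill_slot_nil; have [tv|tv] := boolP (t \in v); last first.
  rewrite del_cons_notin // updE eqxx scale0r add0r.
  apply: eq_in_del => [z zv|w wv].
    by rewrite updE; case: eqP => // zt; rewrite -zt zv in tv.
  by rewrite ev_fill_slot_nil; case: ifP => // /wv; rewrite (negbTE tv).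
rewrite del_cons_in //; apply/esym/eqP; rewrite subr_eq0 eq_sym; apply/eqP.
pose d := upd (fun z => - upd c t 0 z) t 1.
transitivity (del d v (fun w => if t \in w then 0 else phi w)).
  by apply: eq_del => // w; rewrite ev_fill_slot_nil.
by rewrite del_only // /d updE eqxx scale1r.
Qed.

(** A deletion in a composite hits a letter of v or a letter of u. If a piece of u
    ends with x y and the next piece starts with y, then deleting the first y
    gives the same word as cutting u at x and deleting the second x; such terms
    cancel. What is left are the deletions in v, without the slot t as a single
    letter, and those in u, which have moved past the caesuras of v. *)
Lemma del_fill t v u c phi : t \in v -> t \notin u -> {in u, forall z, z \notin v} ->
  ev (fun o => del c o phi) (fill t v u) =
  del (upd c t 0) v (fun w => ev phi (fill t w u))
  + (-1) ^+ deg v *: del (fun z => (-1) ^+ deg v * c z) u (fun w => ev phi (fill t v w)).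
Proof.
move: v u c phi; apply: (@fill_ind _ t).
- by move=> v u /negPf->.
- move=> x v u xt tv IH c phi _ tu uv.
  have uv' := dis_cons uv.
  have xu : x \notin u by apply/negP => /uv; rewrite mem_head.
  have oE o : o \in outs (fill t v u) -> (x \in o) = (x \in v).
    by move=> oin; rewrite (fill_mem tv tu oin) !inE xt (negbTE xu) orbF.
  rewrite ev_fill_neq //.
  have [xv|xv] := boolP (x \in v).
    rewrite (eq_in_ev (psi := fun o => phi o - del (upd (fun z => - c z) x 1) o
      (fun w => phi (x :: w)))); last first.
      by move=> o /oE xo; rewrite del_cons_in // xo.
    rewrite evD evN IH // del_cons_in // opprD addrA; congr (_ - _ + _).
      apply: eq_del => [z|w]; last by rewrite ev_fill_neq.
      rewrite !updE; case: eqP => [->|//]; case: eqP => [zx|]; rewrite ?oppr0 //.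
      by rewrite zx eqxx in xt.
    rewrite /= xv exprS mulN1r scaleNr; congr (- (_ *: _)).
    apply: eq_in_del => [z zu|w _]; last by rewrite ev_fill_neq.
    rewrite updE; case: eqP => [zx|]; first by rewrite -zx zu in xu.
    by rewrite mulrN mulNr.
  rewrite (eq_in_ev (psi := fun o => c x *: phi o + del c o
      (fun w => phi (x :: w)))); last first.
    by move=> o /oE xo; rewrite del_cons_notin // xo.
  rewrite evD evZ IH // del_cons_notin // updE (negbTE xt) addrA /= (negbTE xv).
  congr (_ + _ + _ *: _).
    by apply: eq_del => // w; rewrite ev_fill_neq.
  by apply: eq_del => // w; rewrite ev_fill_neq.
- by move=> v c phi _ _ _; rewrite del_fill_slot_nil /= scaler0 addr0.
move=> v y u IHv IHu c phi _ tu uv.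
have ty : t != y by case/norP: tu.
have tu' : t \notin u by case/norP: tu.
have uv' := dis_tail uv.
have yv : y \notin v by have := uv y (mem_head _ _); rewrite inE negb_or => /andP[].
pose phi' w := phi (y :: w).
have oE o : o \in outs (fill t (t :: v) u) -> (y \in o) = (y \in u).
  by move=> /(fill_mem (mem_head _ _) tu')->; rewrite !inE (negbTE yv) eq_sym (negbTE ty).
have [tv|tv] := boolP (t \in v).
  have uvn : {in y :: u, forall z, z \notin v} := dis_cons uv.
  pose d := deg (t :: v); pose s : R := (-1) ^+ d.
  have sv : (-1) ^+ deg v = - s by rewrite /s /d /= tv exprS mulN1r opprK.
  pose cy := upd (fun z => - c z) y 1.
  pose Phi := ev phi (fill t (t :: v) u).
  pose A := ev phi (fill t v (y :: u)).
  pose B := del (upd cy t 0) v (fun w => ev phi' (fill t w (y :: u))).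
  pose K := ev phi' (fill t v u).
  have nvy z : z \in v -> (z == y) = false.
    by move=> zv; apply/eqP => zy; rewrite zy (negbTE yv) in zv.
  (* The terms whose first piece is y alone *)
  have D0 : ev (fun o => del c (y :: o) phi) (fill t v (y :: u)) =
      A - B + s *: del (fun z => - s * cy z) (y :: u) (fun w => ev phi' (fill t v w)).
    rewrite (eq_in_ev (psi := fun o => phi o - del cy o phi')); last first.
      move=> o oin; rewrite del_cons_in //.
      by rewrite (fill_mem tv tu oin) !inE eqxx orbT.
    by rewrite evD evN IHv // sv opprD addrA scaleNr opprK.
  have Dc e a : {in v, upd (fun z => - c z) t 0 =1 upd e t a} ->
      del e v (fun w => if t \in w then ev phi' (fill t w (y :: u)) else 0) = B.
    move=> ce; rewrite del_if_mem //; apply: eq_in_del => // z zv.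
    have := ce z zv; rewrite /cy !updE (nvy z zv); case: (z == t) => // <-.
  rewrite ev_fill_slot tv D0 -/d -/s.
  have [yu|yu] := boolP (y \in u).
    pose C := del (upd c t 1) v (fun w => ev phi' (fill t (t :: w) u)).
    pose E := del (upd (fun z => s * cy z) y 1) u (fun w => ev phi' (fill t v (y :: w))).
    pose G := del (fun z => s * cy z) u (fun w => ev phi' (fill t (t :: v) w)).
    have -> : s *: del (fun z => - s * cy z) (y :: u) (fun w => ev phi' (fill t v w)) =
        s *: (K - E).
      rewrite del_cons_in //; congr (_ *: (_ - _)); apply: eq_del => // z.
      by rewrite !updE mulNr opprK.
    have -> : ev (fun o => del c (y :: o) phi) (fill t (t :: v) u) =
        Phi - (K - C + s *: G).
      rewrite (eq_in_ev (psi := fun o => phi o - del cy o phi')); last first.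
        by move=> o /oE yo; rewrite del_cons_in // yo.
      rewrite evD evN IHu ?mem_head // del_cons_in //.
      congr (_ - (_ - _ + _)); apply: eq_in_del => // z zv.
      by rewrite /cy !updE (nvy z zv); case: (z == t); rewrite ?opprK.
    rewrite mul1n -/d -/s del_cons_in //.
    have -> : del (upd (fun z => - upd c t 0 z) t 1) v
        (fun w => ev phi (fill t (t :: w) (y :: u))) = B - s *: C.
      pose e z := - upd c t 0 z.
      transitivity (del (upd e t 1) v (fun w =>
         (if t \in w then ev phi' (fill t w (y :: u)) else 0)
         + (-1) ^+ deg (t :: w) *: ev phi' (fill t (t :: w) u))).
        by apply: eq_del => // w; rewrite ev_fill_slot yu mul1n.
      rewrite delD (Dc _ 0); last by move=> z _; rewrite /e !updE; case: (z == t).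
      congr (_ + _).
      have := del_sign_deg (upd c t 0) (t :: v) (fun w => ev phi' (fill t w u)).
      rewrite !del_cons_in // sv -/d -/s scalerBr scaleNr opprB [RHS]addrC.
      move/addrI/(congr1 -%R); rewrite opprK => ->; congr (- (_ *: _)).
      by apply: eq_del => // z; rewrite !updE opprK; case: (z == t).
    rewrite [del _ (y :: u) _]del_cons_in //.
    have -> : del (upd (fun z => - (s * c z)) y 1) u
        (fun w => ev phi (fill t (t :: v) (y :: w))) = E + s *: G.
      transitivity (del (upd (fun z => - (s * c z)) y 1) u (fun w =>
          ev phi' (fill t v (y :: w))
          + (-1) ^+ ((y \in w) * d) *: ev phi' (fill t (t :: v) w))).
        by apply: eq_del => // w; rewrite ev_fill_slot tv.
      rewrite delD del_sign_mem // -/s; congr (_ + _ *: _); apply: eq_del => // z.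
        by rewrite /cy !updE; case: (z == y); rewrite ?mulrN.
      by rewrite /cy !updE eqxx; case: (z == y); rewrite // mulrN.
    rewrite -/Phi -/A opprB -!addrA; congr (_ + _).
    rewrite [RHS]addrCA; congr (_ + _); rewrite -!scalerDr; congr (_ *: _).
    by rewrite !opprD opprK !addrA (ACl (5*3*2*6*(1*4))) /= subrr addr0.
  rewrite mul0n scale1r -/d -/s.
  pose e z := - upd c t 0 z.
  pose C := del (upd e t 1) v (fun w => ev phi' (fill t (t :: w) u)).
  pose E := del (fun z => s * c z) u (fun w => ev phi' (fill t v (y :: w))).
  pose G := del (fun z => s * c z) u (fun w => ev phi' (fill t (t :: v) w)).
  have -> : s *: del (fun z => - s * cy z) (y :: u) (fun w => ev phi' (fill t v w)) =
      s *: E - K.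
    rewrite del_cons_notin // /cy updE eqxx mulr1 scalerDr scalerA addrC.
    rewrite mulrN -expr2 sqrr_sign scaleN1r; congr (_ *: _ - _).
    apply: eq_in_del => // z zu; rewrite updE.
    by case: eqP => [zy|_]; [rewrite -zy zu in yu | rewrite mulrNN].
  have -> : ev (fun o => del c (y :: o) phi) (fill t (t :: v) u) =
      c y *: Phi + (K - C + s *: G).
    rewrite (eq_in_ev (psi := fun o => c y *: phi o + del c o phi')); last first.
      by move=> o /oE yo; rewrite del_cons_notin // yo.
    by rewrite evD evZ IHu ?mem_head // del_cons_in.
  rewrite del_cons_in // -/e.
  have -> : del (upd e t 1) v
      (fun w => ev phi (fill t (t :: w) (y :: u))) = B + C.
    transitivity (del (upd e t 1) v (fun w =>
       (if t \in w then ev phi' (fill t w (y :: u)) else 0)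
       + ev phi' (fill t (t :: w) u))).
      by apply: eq_del => // w; rewrite ev_fill_slot (negbTE yu) mul0n scale1r.
    rewrite delD (Dc _ 0); last by move=> z _; rewrite /e !updE; case: (z == t).
    by [].
  rewrite [del _ (y :: u) _]del_cons_notin //.
  have -> : del (fun z => s * c z) u
        (fun w => ev phi (fill t (t :: v) (y :: w))) = E + G.
    rewrite -delD; apply: eq_in_del => // w wu.
    rewrite ev_fill_slot tv (_ : y \in w = false) ?mul0n ?scale1r //.
    by apply/negP => /wu; rewrite (negbTE yu).
  rewrite scalerDr scalerA mulrA -expr2 sqrr_sign mul1r -/Phi -/A scalerDr opprD.
  rewrite -!addrA; congr (_ + (_ + _)); rewrite !addrA.
  by rewrite (ACl (5*3*1*6*(4*2))) /= subrr addr0.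
pose d := deg (t :: v); pose s : R := (-1) ^+ d.
pose cy := upd (fun z => - c z) y 1.
pose Phi := ev phi (fill t (t :: v) u).
have dE : d = deg v by rewrite /d /= (negbTE tv).
have wt w : {subset w <= v} -> t \notin w by move=> wv; apply/negP => /wv; rewrite (negbTE tv).
have notv e a phi1 phi2 : (forall w, {subset w <= v} -> phi1 w = phi2 w) ->
    del (upd e t a) v phi1 = del e v phi2.
  move=> pp; apply: eq_in_del => // z zv; rewrite updE.
  by case: eqP => // zt; rewrite -zt zv in tv.
rewrite ev_fill_slot (negbTE tv) add0r -/d -/s del_cons_notin // updE eqxx scale0r add0r.
have [yu|yu] := boolP (y \in u).
  pose C := del (fun z => - c z) v (fun w => ev phi' (fill t (t :: w) u)).
  pose G := del (fun z => s * cy z) u (fun w => ev phi' (fill t (t :: v) w)).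
  have -> : ev (fun o => del c (y :: o) phi) (fill t (t :: v) u) =
      Phi - (C + s *: G).
    rewrite (eq_in_ev (psi := fun o => phi o - del cy o phi')); last first.
      by move=> o /oE yo; rewrite del_cons_in // yo.
    rewrite evD evN IHu ?mem_head // del_cons_notin // updE eqxx scale0r add0r.
    congr (_ - (_ + _)); rewrite (notv _ _ _ _ (fun _ _ => erefl)).
    apply: eq_in_del => // z zv; rewrite /cy updE.
    by case: eqP => // zy; rewrite -zy zv in yv.
  have -> : del (upd c t 0) v (fun w => ev phi (fill t (t :: w) (y :: u))) = - (s *: C).
    rewrite /s dE -del_sign_deg; apply: notv => w /wt tw.
    by rewrite ev_fill_slot (negbTE tw) add0r yu mul1n /= (negbTE tw).
  rewrite del_cons_in // mul1n.
  have -> : del (upd (fun z => - (s * c z)) y 1) u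
        (fun w => ev phi (fill t (t :: v) (y :: w))) = s *: G.
    transitivity (del (upd (fun z => - (s * c z)) y 1) u (fun w =>
          (-1) ^+ ((y \in w) * d) *: ev phi' (fill t (t :: v) w))).
      by apply: eq_del => // w; rewrite ev_fill_slot (negbTE tv) add0r.
    rewrite del_sign_mem //; congr (_ *: _); apply: eq_del => // z.
    by rewrite /cy !updE eqxx; case: (z == y); rewrite // mulrN.
  by rewrite -/Phi -/s scalerBr scalerDr opprD addrCA -scalerBr.
pose C := del c v (fun w => ev phi' (fill t (t :: w) u)).
pose G := del (fun z => s * c z) u (fun w => ev phi' (fill t (t :: v) w)).
have -> : ev (fun o => del c (y :: o) phi) (fill t (t :: v) u) =
    c y *: Phi + (C + s *: G).
  rewrite (eq_in_ev (psi := fun o => c y *: phi o + del c o phi')); last first.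
    by move=> o /oE yo; rewrite del_cons_notin // yo.
  rewrite evD evZ IHu ?mem_head // del_cons_notin // updE eqxx scale0r add0r.
  by rewrite (notv _ _ _ _ (fun _ _ => erefl)).
have -> : del (upd c t 0) v (fun w => ev phi (fill t (t :: w) (y :: u))) = C.
  apply: notv => w /wt tw.
  by rewrite ev_fill_slot (negbTE tw) add0r (negbTE yu) mul0n scale1r.
rewrite del_cons_notin // mul0n scale1r -/s.
have -> : del (fun z => s * c z) u (fun w => ev phi (fill t (t :: v) (y :: w))) = G.
  apply: eq_in_del => // w wu.
  rewrite ev_fill_slot (negbTE tv) add0r (_ : y \in w = false) ?mul0n ?scale1r //.
  by apply/negP => /wu; rewrite (negbTE yu).
rewrite scalerDr scalerA mulrA -expr2 sqrr_sign mul1r -/Phi.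
by rewrite addrCA.
Qed.

End Del.

(** * Change of letters *)

Section Relabel.
Variables (T U : eqType) (f : T -> U) (S : {pred T}).
Hypothesis inj_f : {in S &, injective f}.

Lemma mem_map_in x (w : seq T) : x \in S -> {subset w <= S} ->
  (f x \in map f w) = (x \in w).
Proof.
move=> xS wS; apply/mapP/idP => [[y yw /inj_f->]//|xw]; [exact: wS | by exists x].
Qed.

Lemma deg_map (w : seq T) : {subset w <= S} -> deg (map f w) = deg w.
Proof.
elim: w => //= x w IH wS.
have wS' : {subset w <= S} := subset_tail wS.
by rewrite IH // mem_map_in // wS ?mem_head.
Qed.

Lemma fill_map t (v u : seq T) : t \in S -> {subset v <= S} -> {subset u <= S} ->
  fill (f t) (map f v) (map f u) = [seq (p.1, map f p.2) | p <- fill t v u].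
Proof.
have econs_map e x s : econs e (f x) [seq (p.1, map f p.2) | p <- s] =
    [seq (p.1, map f p.2) | p <- econs e x s].
  by rewrite /econs -!map_comp.
move=> tS; move: v u; apply: (@fill_ind _ t).
- move=> v u tv vS uS; rewrite !fill_notin ?mem_map_in //.
- move=> x v u xt tv IH vS uS.
  have vS' : {subset v <= S} := subset_tail vS.
  rewrite /= !fill_neq ?IH //.
  apply: contraNneq xt => /inj_f -> //; exact/vS/mem_head.
- move=> v vS _ /=; rewrite !fill_slot_nil mem_map_in //; first by case: ifP.
  by move=> z zw; rewrite vS // inE zw orbT.
move=> v y u IHv IHu vS uS.
have vS' : {subset v <= S} := subset_tail vS.
have uS' : {subset u <= S} := subset_tail uS.
have yS : y \in S by rewrite uS ?mem_head.
move: (IHu vS uS') => /= E.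
rewrite /= !fill_slot E !mem_map_in // map_cat econs_map -(deg_map vS) /=; congr (_ ++ _).
by case: ifP => // tv; move: (IHv tv vS' uS) => /= ->.
Qed.

End Relabel.

Section DelRelabel.
Variables (R : comNzRingType) (V : lmodType R) (T U : eqType) (f : T -> U).

Lemma del_map (v : seq T) (c : U -> R) (phi : seq U -> V) : {in v &, injective f} ->
  del c (map f v) phi = del (c \o f) v (phi \o map f).
Proof.
elim: v c phi => //= x v IH c phi inj_f.
have inj_f' : {in v &, injective f}.
  by move=> y z yv zv; apply: inj_f; rewrite inE ?yv ?zv orbT.
rewrite (mem_map_in inj_f) ?mem_head //; last by move=> z zv; rewrite inE zv orbT.
rewrite !IH //; case: ifP => xv //; congr (_ - _); apply: eq_in_del => // z zv.
rewrite /upd /=; case: (eqVneq z x) => [->|zx]; first by rewrite eqxx.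
by case: eqP => // /inj_f zx'; rewrite zx' ?eqxx ?mem_head // ?inE ?zv ?orbT in zx.
Qed.
End DelRelabel.

(** * The surjection operad through substitution and deletion *)

Section WordComp.
Local Open Scope nat_scope.
Implicit Types (n t : nat) (u v w j : seq nat).

Lemma reldeg_cons x u a b : reldeg (x :: u) a.+1 b.+1 = reldeg u a b.
Proof.
rewrite /reldeg /index_iota subSS -[a.+1]addn1 addnC iotaDl count_map.
by apply: eq_count => i /=.
Qed.

Lemma reldeg_cons0 x u b : reldeg (x :: u) 0 b.+1 = (x \in u) + reldeg u 0 b.
Proof.
rewrite /reldeg /index_iota !subn0 /= drop0; congr (_ + _).
rewrite -[1]addn0 iotaDl count_map.
by apply: eq_count => i /=.
Qed.

Lemma reldeg_cat u a b c : a <= b <= c -> reldeg u a b + reldeg u b c = reldeg u a c.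
Proof.
case/andP=> ab bc; rewrite /reldeg -count_cat /index_iota.
by rewrite -[X in iota X (c - b)](subnKC ab) -iotaD addnC addnBA // subnK.
Qed.

Lemma reldeg_drop u a b : a <= b -> reldeg u a b = reldeg (drop a u) 0 (b - a).
Proof.
elim: a u b => [|a IH] [|x u] [|b] //= ab; rewrite ?drop0 ?subn0 //.
  by rewrite /reldeg /index_iota; rewrite [LHS](@eq_count _ _ pred0) ?[RHS](@eq_count _ _ pred0) ?count_pred0 // => i; rewrite in_nil.
by rewrite reldeg_cons IH.
Qed.

Lemma reldeg_size u : reldeg u 0 (size u) = deg u.
Proof. by elim: u => // x u IH; rewrite /= reldeg_cons0 IH. Qed.

Lemma reldeg_last u : reldeg u 0 (size u).-1 = deg u.
Proof.
case/lastP: u => // u x; rewrite -reldeg_size size_rcons /= -[RHS](@reldeg_cat _ 0 (size u)) ?leqnSn //.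
suff -> : reldeg (rcons u x) (size u) (size u).+1 = 0 by rewrite addn0.
by rewrite /reldeg /index_iota subSnn /= drop_oversize ?size_rcons.
Qed.

Section CutTerms.
Variables (al be : nat -> nat) (t : nat) (u : seq nat).

(** The word and the exponent of the term with cuts j, by recursion on v. The
    recursion collects the pairs (u_p, v_q) with p <= q by p: the piece in the
    first slot meets all later v_q, whose degrees add up to deg v. *)
Fixpoint cut_word v j :=
  if v is x :: v' then
    if x == t then map al (slice u (nth 0 j 0) (nth 0 j 1).+1) ++ cut_word v' (behead j)
    else be x :: cut_word v' j
  else [::].

Fixpoint cut_exp v j :=
  if v is x :: v' then
    if x == t then reldeg u (nth 0 j 0) (nth 0 j 1) * deg v + cut_exp v' (behead j)
    else cut_exp v' j
  else 0.

Let nth_shift v q : nth (size v).+1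
    [seq i.+1 | i <- [seq i <- iota 0 (size v) | nth 0 v i == t]] q = (occ t v q).+1.
Proof.
have [lt|le] := ltnP q (size [seq i <- iota 0 (size v) | nth 0 v i == t]).
  by rewrite (nth_map (size v)).
by rewrite /occ !nth_default // size_map.
Qed.

Lemma occ_cons x v q : x != t -> occ t (x :: v) q = (occ t v q).+1.
Proof.
by move=> xt; rewrite {1}/occ /= (negbTE xt) -[1]addn0 iotaDl filter_map nth_shift.
Qed.

Lemma occ_cons0 v : occ t (t :: v) 0 = 0.
Proof. by rewrite /occ /= eqxx. Qed.

Lemma occ_consS v q : occ t (t :: v) q.+1 = (occ t v q).+1.
Proof. by rewrite {1}/occ /= eqxx /= -[1]addn0 iotaDl filter_map nth_shift. Qed.

Lemma occ_notin v q : t \notin v -> occ t v q = size v.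
Proof.
elim: v q => [|x v IH] q; first by rewrite /occ /= nth_nil.
by rewrite inE negb_or eq_sym => /andP[xt tv]; rewrite occ_cons // IH.
Qed.

Lemma occ_le v q : occ t v q <= size v.
Proof.
elim: v q => [|x v IH] q; first by rewrite /occ /= nth_nil.
have [->|xt] := eqVneq x t; last by rewrite occ_cons //= ltnS.
by case: q => [|q]; rewrite ?occ_cons0 // occ_consS /= ltnS.
Qed.

Lemma slice_cons x v a b : slice (x :: v) a.+1 b.+1 = slice v a b.
Proof. by rewrite /slice subSS. Qed.

Lemma slice_cons0 x v b : slice (x :: v) 0 b.+1 = x :: slice v 0 b.
Proof. by rewrite /slice !subn0 drop0 /= drop0. Qed.

Lemma slice00 v : slice v 0 0 = [::].
Proof. by rewrite /slice take0. Qed.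

Lemma cut_wordE v j :
  map be (slice v 0 (occ t v 0)) ++
    flatten [seq map al (slice u (nth 0 j q) (nth 0 j q.+1).+1) ++
                 map be (slice v (occ t v q).+1 (occ t v q.+1))
            | q <- iota 0 (count_mem t v)] = cut_word v j.
Proof.
elim: v j => [|x v IH] j //=; have [->|xt] := eqVneq x t; last first.
  rewrite occ_cons // slice_cons0 /= add0n -IH; congr (_ :: (_ ++ flatten _)).
  by apply: eq_map => q; rewrite !occ_cons // slice_cons.
rewrite occ_cons0 slice00 /= occ_cons0 occ_consS slice_cons -IH catA.
congr (_ ++ flatten _); rewrite -[1]addn0 iotaDl -map_comp; apply: eq_map => q /=.
by rewrite !occ_consS slice_cons !nth_behead.
Qed.

Definition occ_deg v q :=
  if q.+1 < count_mem t v then reldeg v (occ t v q) (occ t v q.+1)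
  else reldeg v (occ t v q) (size v).-1.

Lemma occ_deg_cons x v q : x != t -> q < count_mem t v ->
  occ_deg (x :: v) q = occ_deg v q.
Proof.
move=> xt qt; rewrite /occ_deg /= (negbTE xt) add0n !occ_cons // reldeg_cons.
by case: ifP => // _; case: v qt => // y v _; rewrite /= reldeg_cons.
Qed.

Lemma occ_deg_consS v q : q < count_mem t v ->
  occ_deg (t :: v) q.+1 = occ_deg v q.
Proof.
move=> qt; rewrite /occ_deg /= eqxx add1n ltnS !occ_consS // reldeg_cons.
by case: ifP => // _; case: v qt => // y v _; rewrite /= reldeg_cons.
Qed.

Lemma sum_occ_deg v :
  sumn [seq occ_deg v q | q <- iota 0 (count_mem t v)] = deg (drop (occ t v 0) v).
Proof.
elim: v => // x v IH; have [->|xt] := eqVneq x t.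
  rewrite /= eqxx occ_cons0 add1n /= -[1]addn0 iotaDl -map_comp.
  rewrite (_ : [seq _ | q <- _] = [seq occ_deg v q | q <- iota 0 (count_mem t v)]); last first.
    by apply/eq_in_map => q; rewrite mem_iota => /andP[_ qt]; rewrite /= occ_deg_consS.
  rewrite IH /occ_deg /= eqxx add1n ltnS occ_cons0 occ_consS.
  have [tv|tv] := boolP (t \in v).
    rewrite -has_count has_pred1 tv reldeg_cons0 tv -addnA; congr (_ + _).
    rewrite -[in RHS]reldeg_size -[RHS](@reldeg_cat _ 0 (occ t v 0)) ?occ_le //; congr (_ + _).
    by rewrite -reldeg_size size_drop -reldeg_drop ?occ_le.
  rewrite (count_memPn tv) occ_notin // drop_size addn0.
  by have := reldeg_last (t :: v); rewrite /= (negbTE tv).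
rewrite /= (negbTE xt) add0n occ_cons //= -IH; congr (sumn _).
apply/eq_in_map => q; rewrite mem_iota => /andP[_ qt]; exact: occ_deg_cons.
Qed.

Lemma cut_expE v j :
  sumn [seq reldeg u (nth 0 j p) (nth 0 j p.+1) * occ_deg v q
       | q <- iota 0 (count_mem t v), p <- iota 0 q.+1] = cut_exp v j.
Proof.
have innerE v' j' : sumn [seq reldeg u (nth 0 j' p) (nth 0 j' p.+1) * occ_deg v' q
       | q <- iota 0 (count_mem t v'), p <- iota 0 q.+1] =
   \sum_(0 <= q < count_mem t v') \sum_(0 <= p < q.+1)
       reldeg u (nth 0 j' p) (nth 0 j' p.+1) * occ_deg v' q.
  by rewrite sumnE big_allpairs_dep /index_iota subn0; apply: eq_bigr => q _; rewrite subn0.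
rewrite innerE; elim: v j => [|x v IH] j; first by rewrite big_geq.
have [->|xt] := eqVneq x t; last first.
  rewrite /= (negbTE xt) add0n -IH; apply: eq_big_nat => q /andP[_ qt].
  by apply: eq_bigr => p _; rewrite occ_deg_cons.
have := sum_occ_deg (t :: v); rewrite occ_cons0 drop0 => degE.
rewrite [cut_exp _ _]/= eqxx -[(_ + deg v)%N]/(deg (t :: v)) -degE -IH.
rewrite sumnE big_map big_distrr /= eqxx add1n.
rewrite -[iota _ _]/(iota 0 (count_mem t v).+1) -[X in iota 0 X]subn0 -/(index_iota 0 _).
under eq_bigr do rewrite big_nat_recl //.
rewrite big_split /=; congr (_ + _).
rewrite big_nat_recl // big_geq // add0n; apply: eq_big_nat => q /andP[_ qt].
by apply: eq_bigr => p _; rewrite occ_deg_consS // !nth_behead.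
Qed.

Lemma surj_comp_cut n v :
  al = (fun s => s + t - 1) -> be = (fun s => if s < t then s else s + n - 1) ->
  surj_comp n t v u =
  [seq (cut_exp v j, cut_word v j) | j <- cuts (count_mem t v) (size u)].
Proof.
move=> al_ be_; apply: eq_map => j; congr (_, _).
  by rewrite -cut_expE.
by rewrite -cut_wordE al_ be_.
Qed.

End CutTerms.

Lemma wordsS r N : words r.+1 N = [seq x :: w | x <- iota 0 N, w <- words r N].
Proof. by []. Qed.

Definition is_cut a r L j := [&& sorted leq j, nth 0 j 0 == a & nth 0 j r == L.-1].

Section SumCuts.
Local Open Scope ring_scope.
Variables (V : nmodType).

Lemma sum_words_pred1 (L a r : nat) (C : pred (seq nat)) (F : seq nat -> V) : (a < L)%N ->
  \sum_(j <- words r.+1 L | (nth 0%N j 0 == a) && C (behead j)) F j =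
  \sum_(j <- words r L | C j) F (a :: j).
Proof.
move=> aL; rewrite wordsS big_mkcond big_allpairs_dep /=.
transitivity (\sum_(x <- iota 0 L | x == a) \sum_(j <- words r L | C j) F (x :: j)).
  rewrite [RHS]big_mkcond; apply: eq_bigr => x _.
  case: ifP => xa; first by rewrite [RHS]big_mkcond.
  by rewrite big1.
rewrite -[LHS]big_filter.
have -> : [seq x <- iota 0 L | x == a] = [:: a].
  by apply: filter_pred1_uniq; rewrite ?iota_uniq ?mem_iota.
by rewrite big_seq1.
Qed.

Lemma sum_cuts0 (a L : nat) (F : seq nat -> V) : (a < L)%N ->
  \sum_(j <- words 1 L | is_cut a 0 L j) F j = if a == L.-1 then F [:: a] else 0.
Proof.
move=> aL; pose C (w : seq nat) := nilp w && (a == L.-1).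
transitivity (\sum_(j <- words 1 L | (nth 0%N j 0 == a) && C (behead j)) F j).
  rewrite big_seq_cond [RHS]big_seq_cond; apply: eq_bigl => j.
  rewrite wordsS; case: allpairsP => //= -[[x [|y w]]] /= [_]; rewrite ?inE // => _ ->.
  by rewrite /is_cut /=; case: eqP => // ->.
by rewrite sum_words_pred1 // big_mkcond big_seq1.
Qed.

Lemma sum_cutsS (a r L : nat) (F : seq nat -> V) : (a < L)%N ->
  \sum_(j <- words r.+2 L | is_cut a r.+1 L j) F j =
  \sum_(a <= b < L) \sum_(j <- words r.+1 L | is_cut b r L j) F (a :: j).
Proof.
move=> aL; pose C w := path leq a w && (nth 0%N w r == L.-1).
transitivity (\sum_(j <- words r.+2 L | (nth 0%N j 0 == a) && C (behead j)) F j).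
  apply: eq_bigl => -[|x j]; first by rewrite /is_cut /C /= nth_nil.
  by rewrite /is_cut /C /=; case: eqP => [->|] //; rewrite andbF.
rewrite sum_words_pred1 // [in LHS]wordsS big_mkcond big_allpairs_dep.
rewrite -[L in iota 0 L]subn0 -/(index_iota 0 L).
rewrite (@big_cat_nat _ _ _ a) //=; last exact: ltnW.
rewrite big_nat_cond big1 ?add0r; last first.
  move=> b /andP[/andP[_ ba] _]; rewrite big1 // => w _.
  by rewrite /C /= leqNgt ba.
apply: eq_big_nat => b /andP[ab bL]; rewrite -big_mkcond /=.
pose D w := path leq b w && (nth 0%N (b :: w) r == L.-1).
transitivity (\sum_(j <- words r.+1 L | (nth 0%N j 0 == b) && D (behead j)) F (a :: j)).
  by rewrite sum_words_pred1 //; apply: eq_bigl => w; rewrite /C /D /= ab.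
apply: eq_bigl => -[|x j]; first by rewrite /is_cut /D /=; case: eqP => // <-; case: (r) => //= r'; rewrite nth_nil.
by rewrite /is_cut /D /=; case: eqP => [->|] //; rewrite andbF.
Qed.
End SumCuts.

Section CutFill.
Local Open Scope ring_scope.
Variables (R : comNzRingType) (V : lmodType R).

(** The choices made in the first slot amount to the choice of the position b at
    which the first piece ends. *)
Lemma ev_fill_slot_cuts t v u (phi : seq nat -> V) a : (a < size u)%N ->
  ev phi (fill t (t :: v) (drop a u)) =
  if t \in v then
    \sum_(a <= b < size u) (-1) ^+ (reldeg u a b * deg (t :: v)) *:
      ev (fun w => phi (slice u a b.+1 ++ w)) (fill t v (drop b u))
  else (-1) ^+ (reldeg u a (size u).-1 * deg (t :: v)) *: phi (drop a u ++ v).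
Proof.
have [n] := ubnP (size u - a); elim: n a phi => // n IH a phi nu au.
have reldegS b : (a < b)%N -> reldeg u a b =
    ((nth 0%N u a \in drop a.+1 u) + reldeg u a.+1 b)%N.
  move=> ab; rewrite -(@reldeg_cat _ a a.+1) ?leqnSn //; congr (_ + _)%N.
  by rewrite /reldeg /index_iota subSnn /= addn0.
rewrite (drop_nth 0%N au) ev_fill_slot.
have [aL|aL] := ltnP a.+1 (size u); last first.
  have aE : (size u).-1 = a by move: au aL; lia.
  rewrite drop_oversize // ev_fill_slot_nil /= mul0n scale1r aE.
  have -> : reldeg u a a = 0%N by rewrite /reldeg /index_iota subnn.
  case: ifP => tv; last by rewrite add0r mul0n scale1r.
  rewrite (_ : size u = a.+1) ?big_nat1; last by move: au aL; lia.
  rewrite /reldeg /index_iota subnn /= scale1r addr0 (drop_nth 0%N au) drop_oversize //.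
  apply: eq_ev => w; rewrite /slice subSnn (drop_nth 0%N au) /=.
  by rewrite take0.
rewrite IH //; last by move: nu au; lia.
case: ifP => tv; last first.
  rewrite add0r scalerA -exprD -mulnDl reldegS //.
  by move: aL; case: (size u) => //.
rewrite [in RHS]big_ltn //; congr (_ + _).
  rewrite /reldeg /index_iota subnn /= scale1r (drop_nth 0%N au).
  apply: eq_ev => w; rewrite /slice subSnn (drop_nth 0%N au) /=.
  by rewrite take0.
rewrite scaler_sumr; apply: eq_big_nat => b /andP[ab bL].
rewrite scalerA -exprD -mulnDl -reldegS //; congr (_ *: _); apply: eq_ev => w.
rewrite /slice (drop_nth 0%N au).
by have -> : (b.+1 - a = (b.+1 - a.+1).+1)%N by move: ab; lia.
Qed.

Lemma sum_cut_fill t v u (phi : seq nat -> V) a : t \in v -> (a < size u)%N ->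
  \sum_(j <- words (count_mem t v).+1 (size u) | is_cut a (count_mem t v) (size u) j)
     (-1) ^+ cut_exp t u v j *: phi (cut_word id id t u v j) =
  ev phi (fill t v (drop a u)).
Proof.
elim: v a phi => // x v IH a phi; have [->|xt] := eqVneq x t => tv au; last first.
  have tv' : t \in v by move: tv; rewrite inE eq_sym (negbTE xt).
  by rewrite /= (negbTE xt) add0n ev_fill_neq // -IH.
rewrite /= eqxx add1n sum_cutsS // ev_fill_slot_cuts //.
have [tv'|tv'] := boolP (t \in v).
  apply: eq_big_nat => b /andP[ab bL]; rewrite -IH // scaler_sumr.
  apply: eq_bigr => j /and3P[_ /eqP j0 _].
  by rewrite /= j0 tv' exprD -scalerA map_id.
rewrite (count_memPn tv').
rewrite (eq_big_nat _ _ (F2 := fun b => if b == (size u).-1 then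
  (-1) ^+ (reldeg u a (size u).-1 * deg (t :: v)) *: phi (drop a u ++ v) else 0)); last first.
  move=> b /andP[ab bL]; rewrite sum_cuts0 //; case: eqP => // -> /=.
  have cwE : forall (w : seq nat) j, t \notin w -> cut_word id id t u w j = w.
    by elim=> //= z w IHw j; rewrite inE negb_or eq_sym => /andP[/negbTE-> /IHw->].
  have ceE : forall (w : seq nat) j, t \notin w -> cut_exp t u w j = 0%N.
    by elim=> //= z w IHw j; rewrite inE negb_or eq_sym => /andP[/negbTE-> /IHw->].
  rewrite cwE // ceE // addn0 map_id /slice prednK ?(leq_ltn_trans _ au) //.
  by rewrite -size_drop take_size (negbTE tv').
have L0 : (a <= (size u).-1 < size u)%N by move: au; lia.
rewrite (bigD1_seq (size u).-1) ?mem_index_iota ?iota_uniq //= eqxx.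
by rewrite big1 ?addr0 // => b /negbTE->.
Qed.
End CutFill.

Definition shift t s := s + t - 1.
Definition widen n t s := if s < t then s else s + n - 1.
Definition open_slot z n t s := if s == t then z else widen n t s.

(** The letters of words are positive, so that 0 is free to mark the slot. The
    renaming makes the letters of the two words disjoint. *)
Definition wcomp n t v u := fill 0 (map (open_slot 0 n t) v) (map (shift t) u).

Definition posn := [pred s | 0 < s].
Definition positive v := all posn v.

Lemma shift_inj t : 0 < t -> injective (shift t).
Proof. by rewrite /shift => t0 x y; lia. Qed.

Lemma open_slot_inj n t : 0 < n -> 0 < t -> {in posn &, injective (open_slot 0 n t)}.
Proof.
rewrite /open_slot /widen => n0 t0 x y; rewrite !inE => x0 y0.
case: (eqVneq x t); case: (eqVneq y t); case: (ltnP x t); case: (ltnP y t); lia.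
Qed.

Lemma open_slot_eq0 n t s : 0 < n -> 0 < t -> 0 < s -> (open_slot 0 n t s == 0) = (s == t).
Proof.
rewrite /open_slot /widen => n0 t0 s0.
by case: (eqVneq s t); case: (ltnP s t); lia.
Qed.

Lemma ev_surj_comp (R : comNzRingType) (V : lmodType R) (phi : seq nat -> V) n t v u :
  0 < n -> 0 < t -> positive v -> t \in v -> 0 < size u ->
  ev phi (surj_comp n t v u) = ev phi (wcomp n t v u).
Proof.
move=> n0 t0 v0 tv u0; rewrite (surj_comp_cut u v erefl erefl).
rewrite /ev big_map big_filter -/(ev _ _).
have inj_f := open_slot_inj n0 t0; have inj_s := shift_inj t0.
set V' := map (open_slot 0 n t) v; set U := map (shift t) u.
have tV : 0 \in V'.
  by apply/mapP; exists t => //; rewrite /open_slot eqxx.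
have sE a b : reldeg U a b = reldeg u a b.
  apply: eq_count => i; rewrite -map_drop.
  have [iu|iu] := ltnP i (size u); first by rewrite (nth_map 0) // mem_map.
  by rewrite !drop_oversize ?size_map //; lia.
have E w : positive w -> (count_mem 0 (map (open_slot 0 n t) w) = count_mem t w)
   /\ forall j, (cut_exp 0 U (map (open_slot 0 n t) w) j = cut_exp t u w j)
   /\ cut_word id id 0 U (map (open_slot 0 n t) w) j = cut_word (shift t) (widen n t) t u w j.
  elim: w => // x w IH /andP[x0 w0]; have [IHc IHj] := IH w0.
  rewrite /= IHc open_slot_eq0 //; split=> // j.
  rewrite -[(_ \in _) + _]/(deg (map (open_slot 0 n t) (x :: w))).
  rewrite (deg_map (S := posn)) //; last first.
    by move=> z; apply: (@allP _ posn (x :: w)); apply/andP.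
  case: eqP => xt; last by have [-> ->] := IHj j; rewrite /open_slot; case: eqP.
  have [-> ->] := IHj (behead j).
  by rewrite sE map_id /U /slice -map_drop -map_take.
have [Ec Ej] := E v v0.
rewrite /wcomp -/V' -/U -[U]drop0 -sum_cut_fill ?size_map // Ec.
by apply: eq_bigr => j _; have [-> ->] := Ej j.
Qed.

Lemma prev_occ_cons x v i : nth 0 v i \in take i v ->
  prev_occ (x :: v) i.+1 = (prev_occ v i).+1.
Proof.
move=> yi; rewrite /prev_occ /= -[1]addn0 iotaDl filter_map /=.
set s := [seq j <- iota 0 i | nth 0 v j == nth 0 v i].
have : s != [::].
  rewrite -has_filter; apply/hasP.
  case/(nthP 0): yi => k; rewrite size_take_min leq_min => /andP[ki kv].
  rewrite nth_take // => kE; exists k; rewrite ?mem_iota //=; exact/eqP.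
by case: s => // a s _; case: ifP => _ /=; rewrite last_map.
Qed.

Lemma prev_occ_cons0 x v i : nth 0 v i \notin take i v -> i < size v ->
  nth 0 v i = x -> prev_occ (x :: v) i.+1 = 0.
Proof.
move=> yi iv yx; rewrite /prev_occ /= -[1]addn0 iotaDl filter_map /=.
rewrite (@eq_in_filter _ _ pred0) => [|j]; first by rewrite filter_pred0; case: ifP.
rewrite mem_iota add0n => /andP[_ ji] /=; apply: contraNF yi => /eqP <-.
by apply/(nthP 0); exists j; rewrite ?nth_take // size_take_min leq_min ji (ltn_trans ji).
Qed.

(** Solves the recursion of del: for c = 0 the exponents are the r_i that define
    the differential. *)
Definition del_coef (R : comNzRingType) (c : nat -> R) v i : R :=
  let y := nth 0 v i in
  if y \in drop i.+1 v then (-1) ^+ reldeg v 0 i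
  else if y \in take i v then (-1) ^+ reldeg v 0 (prev_occ v i).+1
  else c y.

Lemma del_sum (R : comNzRingType) (V : lmodType R) (phi : seq nat -> V) v c :
  del c v phi =
  (\sum_(i <- iota 0 (size v)) del_coef c v i *: phi (take i v ++ drop i.+1 v))%R.
Proof.
elim: v c phi => [|x v IH] c phi; first by rewrite big_nil.
have step d (e : bool) : (forall y, y \in v -> y != x -> (-1) ^+ e * d y = c y)%R ->
    (x \in v -> (-1) ^+ e * d x = -1 :> R)%R -> e = (x \in v) ->
  ((-1) ^+ e *: del d v (fun w => phi (x :: w)) =
  \sum_(i <- iota 1 (size v)) del_coef c (x :: v) i *:
     phi (take i (x :: v) ++ drop i.+1 (x :: v)))%R.
  move=> dc dx eE; rewrite IH -[1]addn0 iotaDl big_map scaler_sumr.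
  rewrite !big_seq; apply: eq_bigr => i; rewrite mem_iota add0n => /andP[_ iv].
  rewrite scalerA; congr (_ *: _)%R; rewrite /del_coef /= !reldeg_cons0 -eE.
  have yv : nth 0 v i \in v by rewrite mem_nth.
  case: ifP => y1; first by rewrite exprD.
  rewrite inE; have [y2|y2] := boolP (_ \in take i v).
    by rewrite orbT prev_occ_cons // -exprD.
  rewrite orbF; case: eqP => yx; last by rewrite dc //; apply/eqP.
  rewrite prev_occ_cons0 // /reldeg /index_iota /= addn0.
  by rewrite yx dx -?yx // eE -yx yv expr1.
rewrite [iota _ _]/= big_cons {1}/del_coef [nth _ _ _]/= [drop _ _]/= [take _ _]/= drop0.
rewrite in_nil /= /reldeg /index_iota /=; case: ifP => xv.
  rewrite scale1r -scaleN1r -[X in (X *: del _ _ _)%R](expr1 (-1)%R) (step _ true) // => [y yv yx|_].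
    by rewrite /upd (negbTE yx) expr1 mulN1r opprK.
  by rewrite /upd eqxx expr1 mulr1.
rewrite -[X in (_ + X = _)%R]scale1r -[X in (X *: del _ _ _)%R](expr0 (-1)%R) (step _ false) // => [y _ _|].
  by rewrite expr0 mul1r.
by rewrite xv.
Qed.

Lemma ev_surj_diff (R : comNzRingType) (V : lmodType R) (phi : seq nat -> V) v :
  ev phi (surj_diff v) = del (fun=> 0%R) v phi.
Proof.
rewrite del_sum /ev big_map big_filter big_mkcond !big_seq; apply: eq_bigr => i.
rewrite mem_iota add0n => /andP[_ iv]; rewrite /del_coef.
have -> : (1 < count_mem (nth 0 v i) v) =
   (nth 0 v i \in drop i.+1 v) || (nth 0 v i \in take i v).
  rewrite -{2}(cat_take_drop i v) count_cat (drop_nth 0 iv) /= eqxx.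
  by rewrite addnCA ltnS addn_gt0 -!has_count !has_pred1 orbC.
rewrite /=; case: (_ \in drop _ _) => //=; case: (_ \in take _ _) => //.
by rewrite scale0r.
Qed.

End WordComp.

(** * The operad relations for words *)

Definition letters n (w : seq nat) := all (fun x => 0 < x <= n)%N w.

(* Hypotheses on words make linear arithmetic very slow. *)
Ltac clear_words := repeat match goal with
  | H : is_true (all _ _) |- _ => clear H
  | H : is_true (letters _ _) |- _ => clear H
  | H : is_true (positive _) |- _ => clear H
  | H : is_true (_ \in _) |- _ => clear H
  | H : injective _ |- _ => clear H
  | H : forall _, _ |- _ => clear H
  | x := _ |- _ => clear x
  end.

Ltac case_ifs := rewrite /open_slot /widen /shift /=; clear_words;
  repeat match goal with |- context [if ?b then _ else _] =>
    lazymatch b with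
    | context [if _ then _ else _] => fail
    | _ => let E := fresh "E" in destruct b eqn:E
    end end;
  try by []; try lia; try (by congr Some; lia); try (by exfalso; lia).

Section WordOperad.
Variables (R : comNzRingType) (V : lmodType R).
Implicit Types (n t i j l : nat) (u v w : seq nat) (phi F : seq nat -> V).

Lemma letters_positive n w : letters n w -> positive w.
Proof. by apply: sub_all => x /andP[]. Qed.

Lemma positive0 w : positive w -> 0%N \notin w.
Proof. by move=> /allP pw; apply/negP => /pw. Qed.

Lemma ev_fill_relabel (T : eqType) (f : nat -> T) phi (psi : seq T -> V) t v u :
  injective f -> phi =1 psi \o map f ->
  ev phi (fill t v u) = ev psi (fill (f t) (map f v) (map f u)).
Proof.
move=> inj_f pE; rewrite (@fill_map _ _ f predT) //; last by move=> x y _ _ /inj_f.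
by rewrite ev_map; apply: eq_ev.
Qed.

Lemma fill_positive t v u o : positive u -> (forall x, x \in v -> x != t -> 0 < x)%N ->
  o \in outs (fill t v u) -> t = 0%N -> positive o.
Proof.
move=> pu pv oin t0; apply/allP => x xo /=.
have [tv|tv] := boolP (t \in v).
  have tu : t \notin u by rewrite t0 positive0.
  move: xo; rewrite (fill_mem tv tu oin) !inE => /orP[/andP[xt xv]|xu].
    exact: pv.
  exact: (allP pu).
move: oin; rewrite fill_notin // inE => /eqP oE; rewrite oE in xo.
by apply: pv => //; apply: contraNneq tv => <-.
Qed.

Lemma ev_wcomp_relabel (T : eqType) (f : nat -> T) F (F' : seq T -> V) n t v u :
  (0 < t)%N -> positive u -> injective f -> (forall o, positive o -> F o = F' (map f o)) ->
  ev F (wcomp n t v u) =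
  ev F' (fill (f 0%N) (map (f \o open_slot 0 n t) v) (map (f \o shift t) u)).
Proof.
move=> t0 pu inj_f FE.
rewrite (map_comp f (open_slot 0 n t)) (map_comp f (shift t)).
rewrite -(@ev_fill_relabel T f (F' \o map f)) //.
apply: eq_in_ev => o oin; apply: FE; apply: fill_positive oin _ => //.
  rewrite /positive all_map; apply: sub_all pu => x /=; rewrite /shift; lia.
by move=> x _; rewrite lt0n.
Qed.

(** Both relations open two slots at once. Renaming the letters into option nat
    makes room for the two marks None and Some 0. *)
Let unopt : seq (option nat) -> seq nat := map (odflt 0%N).

Let slotNone (x : nat) := if x == 0%N then None else Some x.

Let slotNone_inj : injective slotNone.
Proof. by move=> [|x] [|y] //= []->. Qed.

Let slots l j (x : nat) := if x == 0%N then None else Some (open_slot 0 l j x).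

Let slots_inj l j : (0 < l)%N -> (0 < j)%N -> injective (slots l j).
Proof.
move=> l0 j0 [|x] [|y] // /Some_inj xy.
by apply: (open_slot_inj l0 j0 _ _ xy); rewrite inE.
Qed.

Let unopt_Some w : unopt (map Some w) = w.
Proof. by rewrite /unopt -map_comp map_id. Qed.

Let unopt_slotNone w : unopt (map slotNone w) = w.
Proof.
rewrite /unopt -map_comp -[RHS]map_id; apply: eq_map => x /=.
by rewrite /slotNone; case: eqP.
Qed.

Lemma wcomp_nested m n l i j v u w phi :
  (0 < i <= m)%N -> (0 < j <= n)%N -> (0 < l)%N -> i \in v ->
  letters m v -> letters n u -> letters l w ->
  ev (fun o => ev phi (wcomp l (i + j - 1) o w)) (wcomp n i v u) =
  ev (fun o => ev phi (wcomp (n + l - 1) i v o)) (wcomp l j u w).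
Proof.
move=> /andP[i0 im] /andP[j0 jn] l0 iv lv lu lw.
have pv := letters_positive lv; have pu := letters_positive lu.
have pw := letters_positive lw; have n0 : (0 < n)%N by apply: leq_trans jn.
pose psi (o : seq (option nat)) := phi (unopt o).
pose f := slots l (i + j - 1).
pose h (x : nat) : option nat := Some (if x == 0%N then 0%N else x + i - 1)%N.
pose W := map (fun x => Some (x + i + j - 2)%N) w.
pose U := map (h \o open_slot 0 l j) u.
pose X := map (slotNone \o open_slot 0 (n + l - 1) i) v.
have f_inj : injective f by apply: slots_inj => //; lia.
have h_inj : injective h.
  by move=> [|x] [|y] // /Some_inj; lia.
transitivity (ev (fun o => ev psi (fill (Some 0%N) o W)) (fill None X U)).
  rewrite (ev_wcomp_relabel (f := f) (F' := fun o => ev psi (fill (Some 0%N) o W))) //.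
    have -> : f 0%N = None by [].
    have -> : map (f \o open_slot 0 n i) v = X.
      apply/eq_in_map => x /(allP pv) /= x0; rewrite /f /slots /slotNone; case_ifs.
    have -> : map (f \o shift i) u = U.
      apply/eq_in_map => x /(allP lu) /= x0; rewrite /f /slots /h; case_ifs.
    by [].
  move=> o po; rewrite /wcomp (ev_fill_relabel (psi := psi) _ _ _ (@Some_inj _)); last first.
    by move=> ?; rewrite /= /psi unopt_Some.
  congr (ev _ (fill _ _ _)).
    rewrite -map_comp; apply/eq_in_map => x /(allP po) /= x0.
    by rewrite /f /slots; move: x0; case: (x).
  rewrite -map_comp; apply/eq_in_map => x /(allP pw) /= x0.
  by rewrite /shift; congr Some; lia.
transitivity (ev (fun o => ev psi (fill None X o)) (fill (Some 0%N) U W)); last first.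
  apply/esym; rewrite (ev_wcomp_relabel (f := h) (F' := fun o => ev psi (fill None X o))) //.
    have -> : map (h \o shift j) w = W; last by [].
    by apply/eq_in_map => x /(allP lw) /= x0; rewrite /h; case_ifs.
  move=> o po; rewrite /wcomp (ev_fill_relabel (psi := psi) _ _ _ slotNone_inj); last first.
    by move=> ?; rewrite /= /psi unopt_slotNone.
  congr (ev _ (fill _ _ _)); first by rewrite -map_comp.
  rewrite -map_comp; apply/eq_in_map => x /(allP po) /= x0.
  by rewrite /h /slotNone; case_ifs.
have XE z : z \in X -> z = None \/ exists2 y, z = Some y & (0 < y)%N && ((y < i) || (n + l - 1 + i - 1 < y))%N.
  case/mapP => x /(allP lv) /= x0 ->; rewrite /slotNone; case_ifs;
    by [left | right; eexists; [reflexivity | lia]].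
have UE z : z \in U -> z = Some 0%N \/ exists2 y, z = Some y & (i <= y <= n + l - 1 + i - 1)%N &&
     ((y < i + j - 1) || (i + j + l - 2 < y))%N.
  case/mapP => y /(allP lu) /= y0 ->; rewrite /h; case_ifs;
    by [left | right; eexists; [reflexivity | lia]].
have WE z : z \in W -> exists2 y, z = Some y & (i + j - 1 <= y <= i + j + l - 2)%N.
  by case/mapP => y /(allP lw) /= y0 ->; eexists; first by []; lia.
apply: fill_nested => //.
- by apply/mapP; exists i => //; rewrite /= /open_slot eqxx.
- by apply/negP => /XE [//|[y [<-]]].
- by apply/negP => /UE [//|[y]].
- by apply/negP => /WE [y].
- by apply/negP => /WE [y [<-]]; lia.
- move=> z /UE [->|[y ->] H]; apply/negP => /XE [//|[y' [<-]]]; lia.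
- move=> z /WE [y -> H]; apply/negP => /XE [//|[y' [<-]]]; lia.
- move=> z /WE [y -> H]; apply/negP => /UE [[y0]|[y' [<-]]]; lia.
Qed.

Lemma wcomp_parallel m n l i j v u w phi :
  (0 < j)%N -> (j < i <= m)%N -> (0 < n)%N -> (0 < l)%N -> i \in v -> j \in v ->
  letters m v -> letters n u -> letters l w ->
  ev (fun o => ev phi (wcomp l j o w)) (wcomp n i v u) =
  (-1) ^+ (deg u * deg w) *:
    ev (fun o => ev phi (wcomp n (i + l - 1) o u)) (wcomp l j v w).
Proof.
move=> j0 /andP[ji im] n0 l0 iv jv lv lu lw.
have pv := letters_positive lv; have pu := letters_positive lu.
have pw := letters_positive lw; have i0 : (0 < i)%N by apply: leq_trans ji.
pose psi (o : seq (option nat)) := phi (unopt o).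
pose f := slots l j.
pose h (x : nat) : option nat := if x == 0%N then Some 0%N else slotNone (open_slot 0 n (i + l - 1) x).
pose W := map (fun x => Some (x + j - 1)%N) w.
pose U := map (fun x => Some (x + i + l - 2)%N) u.
pose X := map (f \o open_slot 0 n i) v.
have f_inj : injective f by apply: slots_inj => //; lia.
have h_inj : injective h.
  have nz x : slotNone x != Some 0%N by case: x.
  move=> [|x] [|y] // xy.
  - by have := nz (open_slot 0 n (i + l - 1) y.+1); rewrite -[slotNone _]xy eqxx.
  - by have := nz (open_slot 0 n (i + l - 1) x.+1); rewrite [slotNone _]xy eqxx.
  have il : (0 < i + l - 1)%N by lia.
  by apply: (open_slot_inj n0 il _ _ (slotNone_inj xy)); rewrite ?inE.
transitivity (ev (fun o => ev psi (fill (Some 0%N) o W)) (fill None X U)).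
  rewrite (ev_wcomp_relabel (f := f) (F' := fun o => ev psi (fill (Some 0%N) o W))) //.
    have -> : map (f \o shift i) u = U; last by [].
    by apply/eq_in_map => x /(allP lu) /= x0; rewrite /f /slots; case_ifs.
  move=> o po; rewrite /wcomp (ev_fill_relabel (psi := psi) _ _ _ (@Some_inj _)); last first.
    by move=> ?; rewrite /= /psi unopt_Some.
  congr (ev _ (fill _ _ _)).
    rewrite -map_comp; apply/eq_in_map => x /(allP po) /= x0.
    by rewrite /f /slots; move: x0; case: (x).
  rewrite -map_comp; apply/eq_in_map => x /(allP pw) /= x0.
  by rewrite /shift; congr Some; lia.
transitivity ((-1) ^+ (deg u * deg w) *:
    ev (fun o => ev psi (fill None o U)) (fill (Some 0%N) X W)); last first.
  congr (_ *: _); apply/esym.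
  rewrite (ev_wcomp_relabel (f := h) (F' := fun o => ev psi (fill None o U))) //.
    have -> : map (h \o open_slot 0 l j) v = X.
      by apply/eq_in_map => x /(allP pv) /= x0; rewrite /h /f /slots /slotNone; case_ifs.
    have -> : map (h \o shift j) w = W; last by [].
    by apply/eq_in_map => x /(allP lw) /= x0; rewrite /h /slotNone; case_ifs.
  move=> o po; rewrite /wcomp (ev_fill_relabel (psi := psi) _ _ _ slotNone_inj); last first.
    by move=> ?; rewrite /= /psi unopt_slotNone.
  congr (ev _ (fill _ _ _)).
    rewrite -map_comp; apply/eq_in_map => x /(allP po) /= x0.
    by rewrite /h; move: x0; case: (x).
  rewrite -map_comp; apply/eq_in_map => x /(allP pu) /= x0.
  by rewrite /slotNone; case_ifs.
have XE z : z \in X -> z = None \/ z = Some 0%N \/ exists2 y, z = Some y &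
    (0 < y)%N && ~~ (j <= y < j + l)%N && ~~ (i + l - 1 <= y < i + l + n - 1)%N.
  case/mapP => x /(allP lv) /= x0 ->; rewrite /f /slots; case_ifs;
    by [left | right; left | right; right; eexists; [reflexivity | lia]].
have UE z : z \in U -> exists2 y, z = Some y & (i + l - 1 <= y < i + l + n - 1)%N.
  by case/mapP => y /(allP lu) /= y0 ->; eexists; first by []; lia.
have WE z : z \in W -> exists2 y, z = Some y & (j <= y < j + l)%N.
  by case/mapP => y /(allP lw) /= y0 ->; eexists; first by []; lia.
rewrite fill_parallel //.
- have -> : None \in X by apply/mapP; exists i => //; rewrite /f /slots /=; case_ifs.
  have -> : Some 0%N \in X by apply/mapP; exists j => //; rewrite /f /slots /=; case_ifs.
  rewrite !mul1n /U /W (deg_map (f := fun x => Some (x + i + l - 2)%N) (S := posn)) //.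
    by rewrite (deg_map (f := fun x => Some (x + j - 1)%N) (S := posn)) //;
       [move=> x y /= x0 y0 /Some_inj; rewrite !inE in x0 y0; lia | exact: allP].
    by move=> x y /= x0 y0 /Some_inj; rewrite !inE in x0 y0; lia.
  exact: allP.
- by apply/negP => /UE [y].
- by apply/negP => /WE [y].
- by apply/negP => /UE [y [<-]]; lia.
- by apply/negP => /WE [y [<-]]; lia.
- move=> z /UE [y -> H]; apply/negP => /XE [//|[[y0]|[y' [<-]]]]; lia.
- move=> z /WE [y -> H]; apply/negP => /XE [//|[[y0]|[y' [<-]]]]; lia.
- move=> z /WE [y -> H]; apply/negP => /UE [y' [<-]]; lia.
Qed.

End WordOperad.

(** * Cacti are closed under composition *)

Section FillClosure.
Variables (T : eqType).
Implicit Types (t x y : T) (u v w p : seq T).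

Definition neq_adj : rel T := fun x y => x != y.

(** Equal neighbours could only arise between two pieces of u, but these are
    separated by letters of v, as v has no two adjacent slots. *)
Lemma fill_sorted t v u w : t \in v -> t \notin u -> u != [::] ->
  {in u, forall z, z \notin v} -> sorted neq_adj v -> sorted neq_adj u ->
  w \in outs (fill t v u) ->
  sorted neq_adj w /\ ohead w = if ohead v == Some t then ohead u else ohead v.
Proof.
have sortC x s : sorted neq_adj s -> ohead s != Some x -> sorted neq_adj (x :: s).
  by case: s => //= y s ->; rewrite /neq_adj eq_sym andbT.
move: v u w; apply: (@fill_ind _ t) => //.
- by move=> v u /negPf->.
- move=> x v u xt tv IH w _ tu u0 uv sv su; rewrite fill_neq // outs_econs.
  case/mapP => w' w'o ->; rewrite /= (inj_eq (@Some_inj _)) (negbTE xt); split=> //.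
  have [] := IH w' tv tu u0 (dis_cons uv) (path_sorted sv) su w'o.
  move=> sw hw; apply: sortC => //; rewrite hw; case: ifP => vt.
    case: u {IH tu su w'o hw} u0 uv => //= y u _ uv.
    by have := uv y (mem_head _ _); rewrite inE negb_or => /andP[].
  case: v {IH tv uv w'o hw vt} sv => //= z v /andP[].
  by rewrite /neq_adj (inj_eq (@Some_inj _)) eq_sym.
move=> v y u IHv IHu w _ tu u0 uv sv su; rewrite fill_slot outs_cat mem_cat /= eqxx.
have uv' : {in y :: u, forall z, z \notin v} := dis_cons uv.
have yv : y \notin v by apply: uv'; rewrite mem_head.
have hv : ohead v != Some y.
  by case: (v) yv => //= z s; rewrite inE negb_or eq_sym => /andP[].
have vt : (ohead v == Some t) = false.
  by case: (v) sv => //= z s /andP[]; rewrite /neq_adj (inj_eq (@Some_inj _)) eq_sym => /negbTE.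
case/orP.
  case: ifP => // tv; rewrite outs_econs => /mapP[w' w'o ->]; split=> //.
  have [] := IHv tv w' tv tu u0 uv' (path_sorted sv) su w'o.
  by rewrite vt => sw hw; apply: sortC; rewrite ?hw.
rewrite outs_econs => /mapP[w' w'o ->]; split=> //.
case: u {IHv u0} IHu tu uv su w'o uv' => [|z u] IHu tu uv su w'o uv'.
  move: w'o; rewrite fill_slot_nil; case: ifP => // tv.
  by rewrite inE => /eqP->; apply: sortC => //; exact: path_sorted sv.
have tu' : t \notin z :: u by case/norP: tu.
have [] := IHu w' (mem_head _ _) tu' isT (dis_tail uv) sv (path_sorted su) w'o.
rewrite /= eqxx => sw hw; apply: sortC; rewrite ?hw //.
by move: su => /= /andP[]; rewrite /neq_adj (inj_eq (@Some_inj _)) eq_sym.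
Qed.

Lemma subseq_cons_neq p x w : ohead p != Some x -> subseq p (x :: w) = subseq p w.
Proof.
case: p => [|y p] /=; first by rewrite sub0seq.
by rewrite (inj_eq (@Some_inj _)) => /negbTE->.
Qed.

Lemma ohead_sorted x s : sorted neq_adj (x :: s) -> ohead s != Some x.
Proof. by case: s => //= z s /andP[]; rewrite /neq_adj (inj_eq (@Some_inj _)) eq_sym. Qed.

Lemma outside_tail (S : {pred T}) x v :
  {in x :: v, forall z, z \notin S} -> {in v, forall z, z \notin S}.
Proof. by move=> vS z zv; rewrite vS // inE zv orbT. Qed.

(** Renaming all letters of u to t gives v with each slot stuttered, and a stutter
    adds no subsequence with distinct neighbours. *)
Lemma fill_contract (S : {pred T}) t v u w p :
  {subset u <= S} -> {in v, forall z, z \notin S} -> w \in outs (fill t v u) ->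
  sorted neq_adj p ->
  subseq p [seq (if x \in S then t else x) | x <- w] -> subseq p v.
Proof.
have dis_id v' : {in v', forall z, z \notin S} -> [seq (if x \in S then t else x) | x <- v'] = v'.
  move=> vS; rewrite -[RHS]map_id; apply/eq_in_map => x /vS.
  by case: ifP.
move: v u w p; apply: (@fill_ind _ t).
- by move=> v u tv w p uS vS; rewrite fill_notin // inE => /eqP->; rewrite dis_id.
- move=> x v u xt tv IH w p uS vS; rewrite fill_neq // outs_econs.
  have vS' := outside_tail vS.
  have xS : (x \in S) = false by apply/negbTE/vS/mem_head.
  case/mapP => w' w'o ->; case: p => [|a p] //= sp; rewrite xS.
  by case: eqP => _; apply: IH => //; exact: path_sorted sp.
- move=> v w p _ vS; rewrite fill_slot_nil; case: ifP => // tv.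
  rewrite inE => /eqP -> _; rewrite dis_id; last exact: outside_tail vS.
  by move=> pv; apply: subseq_trans pv _; exact: subseq_cons.
move=> v y u IHv IHu w p uS vS; rewrite fill_slot outs_cat mem_cat.
have vS' := outside_tail vS.
have uS' : {subset u <= S} := subset_tail uS.
have yS : y \in S by apply/uS/mem_head.
case/orP; [case: ifP => // tv|]; rewrite outs_econs => /mapP[w' w'o ->];
  rewrite [map _ _]/= yS; case: p => // a p sp /=; case: eqP => [at'|/eqP at'].
- by apply: IHv => //; exact: path_sorted sp.
- by apply: IHv.
- move=> /(IHu _ _ uS' vS w'o (path_sorted sp)).
  by rewrite subseq_cons_neq // -at'; exact: ohead_sorted.
- move=> /(IHu _ _ uS' vS w'o sp).
  by rewrite subseq_cons_neq //= (inj_eq (@Some_inj _)).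
Qed.

(** Keeping only the letters of u gives u, stuttered at the cuts. *)
Lemma fill_extract (S : {pred T}) t v u w p :
  {subset u <= S} -> {in v, forall z, z \notin S} -> w \in outs (fill t v u) ->
  sorted neq_adj p -> subseq p [seq x <- w | x \in S] -> subseq p u.
Proof.
have dis_nil v' : {in v', forall z, z \notin S} -> [seq x <- v' | x \in S] = [::].
  by move=> vS; apply/eqP; rewrite -[_ == _]negbK -has_filter; apply/hasPn.
move: v u w p; apply: (@fill_ind _ t).
- move=> v u tv w p uS vS; rewrite fill_notin // inE => /eqP-> _.
  by rewrite dis_nil // subseq0 => /eqP->; exact: sub0seq.
- move=> x v u xt tv IH w p uS vS; rewrite fill_neq // outs_econs.
  have vS' := outside_tail vS.
  have xS : (x \in S) = false by apply/negbTE/vS/mem_head.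
  by case/mapP => w' w'o -> sp; rewrite /= xS; exact: IH.
- move=> v w p _ vS; rewrite fill_slot_nil; case: ifP => // tv.
  by rewrite inE => /eqP -> _; rewrite dis_nil //; exact: outside_tail vS.
move=> v y u IHv IHu w p uS vS; rewrite fill_slot outs_cat mem_cat.
have vS' := outside_tail vS.
have uS' : {subset u <= S} := subset_tail uS.
have yS : y \in S by apply/uS/mem_head.
case/orP; [case: ifP => // tv|]; rewrite outs_econs => /mapP[w' w'o ->];
  rewrite [filter _ _]/= yS; case: p => // a p sp /=; case: eqP => [at'|/eqP at'].
- move=> /(IHv tv _ _ uS vS' w'o (path_sorted sp)).
  by rewrite subseq_cons_neq // -at'; exact: ohead_sorted.
- move=> /(IHv tv _ _ uS vS' w'o sp).
  by rewrite subseq_cons_neq //= (inj_eq (@Some_inj _)).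
- by apply: IHu => //; exact: path_sorted sp.
- by apply: IHu.
Qed.

Definition crossing i j : seq T := [:: i; j; i; j].

Definition noncrossing w := forall i j, i != j -> ~~ subseq (crossing i j) w.

(** If both letters of a crossing come from u, then the crossing occurs in u.
    Otherwise renaming the letters of u to t gives a crossing in v. *)
Lemma fill_noncrossing (S : {pred T}) t v u w :
  {subset u <= S} -> {in v, forall z, z \notin S} -> w \in outs (fill t v u) ->
  noncrossing v -> noncrossing u -> noncrossing w.
Proof.
move=> uS vS wo nv nu i j ij; apply/negP => cw.
have sc a b : a != b -> sorted neq_adj (crossing a b).
  by move=> ab; rewrite /= /neq_adj ab eq_sym ab.
have [iS|iS] := boolP (i \in S); have [jS|jS] := boolP (j \in S).
- have /negP := nu i j ij; apply.
  apply: (fill_extract uS vS wo (sc _ _ ij)).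
  by rewrite subseq_filter /= iS jS.
all: pose f x := if x \in S then t else x.
all: suff fij : f i != f j by
  have /negP := nv _ _ fij; apply; apply: (fill_contract uS vS wo (sc _ _ fij));
  exact: (map_subseq f cw).
all: have tw : t \notin w.
1,3,5: have [tv|tv] := boolP (t \in v); last by
  move: wo; rewrite fill_notin // inE => /eqP->.
1,2,3: have tu : t \notin u by [apply: contra (vS t tv); exact: uS];
  by rewrite (fill_mem tv tu wo) !inE eqxx (negbTE tu).
all: have iw : i \in w by apply: (mem_subseq cw); rewrite inE eqxx.
all: have jw : j \in w by apply: (mem_subseq cw); rewrite !inE eqxx orbT.
all: rewrite /f ?(negbTE iS) ?(negbTE jS) ?iS ?jS //.
- by apply: contraNneq tw => ->.
- by apply: contraNneq tw => <-.
Qed.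

End FillClosure.

Section WordClosure.
Local Open Scope nat_scope.
Implicit Types (n m i k l : nat) (u v w o : seq nat).

Lemma noncrossingP w : reflect (noncrossing w) (is_cactus w).
Proof.
apply: (iffP allP) => [h i j ij | h i iw].
  apply/negP => s; have iw : i \in w by apply: (mem_subseq s); rewrite inE eqxx.
  have jw : j \in w by apply: (mem_subseq s); rewrite !inE eqxx orbT.
  by have := allP (h i iw) j jw; rewrite ij s.
by apply/allP => j jw; apply/implyP; exact: h.
Qed.

Lemma size_deg w : size w = deg w + size (undup w).
Proof. by elim: w => //= x w IH; case: ifP => _; rewrite /= {1}IH; lia. Qed.

(** The basis of the cacti operad in arity n and degree k. The degree is given as
    the number of caesuras instead of the length (size_cactus_word). *)
Definition cactus_word n k w :=
  [&& 0 < n, letters n w, all (fun x => x \in w) (iota 1 n),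
      sorted (@neq_adj nat) w, deg w == k & is_cactus w].

Lemma open_slot_inj_letters n i m v : 0 < n -> 0 < i -> letters m v ->
  {in v &, injective (open_slot 0 n i)}.
Proof.
move=> n0 i0 /letters_positive /allP pv a b /pv pa /pv pb.
exact: open_slot_inj.
Qed.

Lemma letters_surj_mem n w : letters n w -> all (fun x => x \in w) (iota 1 n) ->
  w =i iota 1 n.
Proof.
move=> /allP lw /allP sw x; apply/idP/idP => [/lw|/sw //].
by rewrite mem_iota; lia.
Qed.

Lemma size_undup_letters n w : letters n w -> all (fun x => x \in w) (iota 1 n) ->
  size (undup w) = n.
Proof.
move=> lw sw; rewrite -[RHS](size_iota 1 n).
apply/perm_size/uniq_perm; rewrite ?undup_uniq ?iota_uniq // => x.
by rewrite mem_undup; apply: letters_surj_mem.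
Qed.

Lemma size_cactus_word n k w : cactus_word n k w -> size w = n + k.
Proof.
case/and5P => _ lw sw _ /andP[/eqP dk _].
by rewrite size_deg dk (size_undup_letters lw sw) addnC.
Qed.

Lemma noncrossing_map (f : nat -> nat) w : {in w &, injective f} ->
  noncrossing w -> noncrossing (map f w).
Proof.
move=> inj_f nw i j ij; apply/negP => /subseqP[m sm] E.
pose s := mask m w; have ms : map f s = crossing i j by rewrite map_mask E.
have sw : subseq s w by exact: mask_subseq.
move: ms sw; case: s => [|a [|b [|a' [|b' [|]]]]] //= [fa fb fa' fb'] sw.
have sub z : z \in [:: a; b; a'; b'] -> z \in w by exact: (mem_subseq sw).
have aa : a' = a by apply: inj_f; rewrite ?sub ?inE ?eqxx ?orbT // fa fa'.
have bb : b' = b by apply: inj_f; rewrite ?sub ?inE ?eqxx ?orbT // fb fb'.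
move: sw; rewrite aa bb; apply/negP/nw.
by apply: contraNneq ij => ab; rewrite -fa -fb ab.
Qed.

Lemma sorted_map_inj (f : nat -> nat) w : {in w &, injective f} ->
  sorted (@neq_adj nat) w -> sorted (@neq_adj nat) (map f w).
Proof.
case: w => // x w; elim: w x => //= y w IH x inj_f /andP[xy sw].
have inj' : {in y :: w &, injective f}.
  by move=> a b aw bw; apply: inj_f; rewrite inE ?aw ?bw orbT.
rewrite IH // andbT; apply: contra xy => /eqP /inj_f -> //; rewrite !inE eqxx ?orbT //.
Qed.

Lemma wcomp_cactus m k n l i v u o : cactus_word m k v -> cactus_word n l u ->
  0 < i <= m -> o \in outs (wcomp n i v u) -> cactus_word (n + m - 1) (k + l) o.
Proof.
case/and5P => m0 lv mv sv /andP[/eqP dv cv].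
case/and5P => n0 lu mu su /andP[/eqP du cu] /andP[i0 im] oin.
pose S := [pred x | i <= x < i + n].
have mE : v =i iota 1 m := letters_surj_mem lv mv.
have nE : u =i iota 1 n := letters_surj_mem lu mu.
have inj_v := open_slot_inj_letters n0 i0 lv.
have inj_u : {in u &, injective (shift i)} by move=> a b _ _; apply: shift_inj.
have iv : i \in v by rewrite mE mem_iota i0 add1n ltnS.
have uS : {subset map (shift i) u <= S}.
  move=> _ /mapP[x /(allP lu) xu ->]; rewrite !inE.
  by clear -xu i0; rewrite /shift; lia.
have vS : {in map (open_slot 0 n i) v, forall z, z \notin S}.
  move=> _ /mapP[x /(allP lv) xv ->]; rewrite !inE.
  by clear -xv i0; case_ifs.
have tv : 0 \in map (open_slot 0 n i) v.
  by apply/mapP; exists i => //; rewrite /open_slot eqxx.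
have tu : 0 \notin map (shift i) u by apply/negP => /uS; rewrite inE leqNgt i0.
have uv : {in map (shift i) u, forall z, z \notin map (open_slot 0 n i) v}.
  by move=> z /uS zS; apply/negP => /vS; rewrite zS.
have memo := fill_mem tv tu oin.
have u0 : map (shift i) u != [::].
  have : 1 \in u by rewrite nE mem_iota; clear -n0; lia.
  by case: (u).
apply/and5P; split; first by clear -n0 m0; lia.
- apply/allP => x; rewrite memo !inE => /orP[/andP[x0 /mapP[y /(allP lv) yv xE]]|/uS].
    by move: x0; rewrite xE; clear -yv i0 im n0; case_ifs.
  by rewrite inE; clear -i0 im n0; lia.
- apply/allP => x; rewrite mem_iota => xn; rewrite memo !inE.
  have [xS|xS] := boolP (x \in S); rewrite inE in xS.
    apply/orP; right; apply/mapP; exists (x - i + 1); last by clear -xS; rewrite /shift; lia.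
    by rewrite nE mem_iota; clear -xS; lia.
  apply/orP; left; apply/andP; split; first by clear -xn; lia.
  apply/mapP; exists (if x < i then x else x - n + 1).
    by rewrite mE mem_iota; clear -xS xn i0 im n0; case_ifs.
  by clear -xS xn i0 im n0; case_ifs.
- have [] := fill_sorted tv tu u0 uv _ _ oin => //; exact: sorted_map_inj.
- apply/andP; split; last first.
    apply/noncrossingP; apply: (fill_noncrossing uS vS oin); apply: noncrossing_map => //; exact/noncrossingP.
  rewrite (deg_fill tv tu uv oin) -dv -du.
  by rewrite (@deg_map _ _ (shift i) (mem u)) // (@deg_map _ _ (open_slot 0 n i) (mem v)).
Qed.

End WordClosure.

Lemma map_shift1 u : map (shift 1) u = u.
Proof. by rewrite -[RHS]map_id; apply: eq_map => x; rewrite /shift addnK. Qed.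

Section WordLeibniz.
Variables (R : comNzRingType) (V : lmodType R).
Implicit Types (n m i : nat) (u v w : seq nat) (phi : seq nat -> V).

Lemma wcomp_leibniz m n i v u phi : (0 < i <= m)%N -> (0 < n)%N -> i \in v ->
  letters m v -> letters n u ->
  ev (fun o => del (fun=> 0) o phi) (wcomp n i v u) =
  del (fun=> 0) v (fun w => ev phi (wcomp n i w u))
  + (-1) ^+ deg v *: del (fun=> 0) u (fun w => ev phi (wcomp n i v w)).
Proof.
move=> /andP[i0 im] n0 iv lv lu.
have inj_v := open_slot_inj_letters n0 i0 lv.
have inj_u : {in u &, injective (shift i)} by move=> a b _ _; apply: shift_inj.
have uS z : z \in map (shift i) u -> (i <= z < i + n)%N.
  move=> /mapP[x /(allP lu) xu ->].
  by clear -xu i0; rewrite /shift; lia.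
have vS z : z \in map (open_slot 0 n i) v -> ~~ (i <= z < i + n)%N.
  move=> /mapP[x /(allP lv) xv ->].
  by clear -xv i0; case_ifs.
rewrite /wcomp del_fill.
- rewrite (deg_map (S := mem v)) //; congr (_ + _ *: _).
    rewrite del_map //; apply: eq_del => // z.
    by rewrite /= /upd; case: ifP.
  by rewrite del_map //; apply: eq_del => // z; rewrite /= mulr0.
- by apply/mapP; exists i => //; rewrite /open_slot eqxx.
- by apply/negP => /uS; clear -i0; lia.
- by move=> z /uS zS; apply/negP => /vS; rewrite zS.
Qed.

Lemma wcomp_unitr i v phi : (0 < i)%N -> positive v -> ev phi (wcomp 1 i v [:: 1%N]) = phi v.
Proof.
have fill1 t y w psi : ev psi (fill t w [:: y]) = psi [seq (if x == t then y else x) | x <- w] :> V.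
  elim: w psi => [|x w IH] psi; first by rewrite ev_fill_notin.
  have [->|xt] := eqVneq x t; last by rewrite ev_fill_neq // IH /= (negbTE xt).
  rewrite ev_fill_slot ev_fill_slot_nil IH /= mul0n scale1r eqxx.
  case: ifP => tw; rewrite ?addr0 // add0r; congr (psi (_ :: _)).
  rewrite -[LHS]map_id; apply/eq_in_map => x' xw.
  by case: eqP => // xt'; rewrite -xt' xw in tw.
move=> i0 pv; rewrite /wcomp fill1 -map_comp; congr phi.
rewrite -[RHS]map_id; apply/eq_in_map => x /(allP pv) /= x0.
by clear -x0 i0; case_ifs.
Qed.

Lemma wcomp_unitl n u phi : ev phi (wcomp n 1 [:: 1%N] u) = phi u.
Proof.
have fill_all t w psi : ev psi (fill t [:: t] w) = psi w :> V.
  elim: w psi => [|x w IH] psi; first by rewrite ev_fill_slot_nil.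
  by rewrite ev_fill_slot add0r muln0 scale1r IH.
by rewrite /wcomp fill_all map_shift1.
Qed.

End WordLeibniz.

Arguments del : simpl never.

(** * Insertion of a new top letter *)

Section Ins.
Variables (T : eqType).
Implicit Types (t x y z : T) (u v w : seq T).

(** The contracting operator: an occurrence of a letter x other than y becomes
    x z x. The sign counts the caesuras further left, and y like a caesura. *)
Fixpoint ins y z u : seq (nat * seq T) :=
  if u is x :: u' then
    (if x == y then [::] else [:: (0%N, [:: x, z, x & u'])])
    ++ econs ((x \in u') + (x == y)) x (ins y z u')
  else [::].

Definition sub_letter y s u : seq T := flatten [seq if x == y then s else [:: x] | x <- u].

Lemma sub_letter_notin y s u : y \notin u -> sub_letter y s u = u.
Proof.
elim: u => // x u IH; rewrite inE negb_or eq_sym => /andP[/negbTE xy yu].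
by rewrite /sub_letter /= xy -[in RHS](IH yu).
Qed.

Lemma ins_mem y z u w : w \in outs (ins y z u) ->
  forall x, x != z -> (x \in w) = (x \in u).
Proof.
elim: u w => // a u IH w; rewrite /= outs_cat mem_cat => /orP[|].
  case: ifP => // _; rewrite inE => /eqP-> x xz; rewrite !inE (negbTE xz) /=.
  by case: (x == a).
by rewrite outs_econs => /mapP[w' /IH w'o ->] x /w'o; rewrite !inE => ->.
Qed.

Lemma deg_ins y z u w : z \notin u -> w \in outs (ins y z u) -> deg w = (deg u).+1.
Proof.
elim: u w => // a u IH w; rewrite inE negb_or => /andP[za zu] /=.
rewrite outs_cat mem_cat => /orP[|].
  case: ifP => // _; rewrite inE => /eqP-> /=.
  by rewrite !inE eqxx orbT (negbTE za) (negbTE zu).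
rewrite outs_econs => /mapP[w' w'o ->] /=.
by rewrite (IH w') // (ins_mem w'o) 1?eq_sym // addnS.
Qed.

Section EvIns.
Variables (R : comNzRingType) (V : lmodType R).
Implicit Types (phi : seq T -> V) (c : T -> R).

Lemma ev_ins_cons y z x u phi :
  ev phi (ins y z (x :: u)) =
    (if x == y then 0 else phi [:: x, z, x & u])
    + (-1) ^+ ((x \in u) + (x == y)) *: ev (fun w => phi (x :: w)) (ins y z u).
Proof.
rewrite /= ev_cat ev_econs; congr (_ + _).
by case: ifP; rewrite ?ev_nil // ev_seq1 scale1r.
Qed.

(** In x z x either x can be deleted, which leaves z next to x on one side. These
    words telescope along u. What remains are the two ends, with z before and
    after u, and the two words with z beside y, where no insertion took place.
    The deletions of letters that are not next to z give the last summand. For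
    the deletion of z or y itself nothing remains, as c vanishes there. *)
Lemma del_ins y z u c phi : z \notin u -> z != y -> c z = 0 -> c y = 0 ->
  (count_mem y u <= 1)%N ->
  ev (fun o => del c o phi) (ins y z u) =
    phi (z :: u) - (-1) ^+ (y \in u) *: phi (rcons u z)
    - (if y \in u then phi (sub_letter y [:: z; y] u) + phi (sub_letter y [:: y; z] u)
       else 0)
    - del (fun x => - c x) u (fun w => ev phi (ins y z w)).
Proof.
move=> zu zy; elim: u zu c phi => [|x u IH] zu c phi cz cy yu.
  by rewrite ev_nil /= !subr0 scale1r subrr.
move: zu; rewrite inE negb_or => /andP[zx zu].
pose phi' w := phi (x :: w).
have memo o : o \in outs (ins y z u) -> (x \in o) = (x \in u).
  by move=> /ins_mem; apply; rewrite eq_sym.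
rewrite ev_ins_cons.
have [xy|xy] := eqVneq x y.
  subst x; have yu' : y \notin u.
    by move: yu; rewrite /= eqxx add1n ltnS leqn0 => /eqP /count_memPn.
  rewrite (negbTE yu') add0r /= expr1 scaleN1r.
  rewrite (eq_in_ev (psi := fun o => del c o phi')); last first.
    by move=> o /memo yo /=; rewrite del_cons_notin ?yo // cy scale0r add0r.
  rewrite IH //; last by move: yu; rewrite /= eqxx; lia.
  rewrite (negbTE yu') expr0 scale1r subr0.
  rewrite inE eqxx /= expr1 scaleN1r opprK.
  have subE s : sub_letter y s (y :: u) = s ++ u.
    by rewrite /sub_letter /= eqxx -/(sub_letter y s u) sub_letter_notin.
  rewrite !subE /= del_cons_notin // cy oppr0 scale0r add0r.
  have -> : del (fun x => - c x) u (fun w => ev phi (ins y z (y :: w))) =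
      del (fun x => - c x) u (fun w => -1 *: ev phi' (ins y z w)).
    apply: eq_in_del => // w wu; rewrite ev_ins_cons eqxx add0r (_ : y \in w = false) ?expr1 //.
    by apply/negP => /wu; rewrite (negbTE yu').
  rewrite delZ scaleN1r -/(phi' (z :: u)).
  rewrite -/(phi' (rcons u z)) !opprB !opprD opprK.
  set d := del _ _ _.
  rewrite addrACA subrr add0r; exact: addrC.
have yxu : (y \in x :: u) = (y \in u) by rewrite inE eq_sym (negbTE xy).
have subE s : phi (sub_letter y s (x :: u)) = phi' (sub_letter y s u).
  by rewrite /phi' /sub_letter /= (negbTE xy).
rewrite yxu !subE addn0 -[rcons _ _]/(x :: rcons u z) -/(phi' (rcons u z)).
have yu' : (count_mem y u <= 1)%N by move: yu; rewrite /= (negbTE xy).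
set s := (-1) ^+ (y \in u); set S := if y \in u then _ else _.
pose X d := del d u (fun w => phi [:: x, z, x & w]).
pose I d := del d u (fun w => ev phi' (ins y z w)).
have insE d : del d u (fun w => ev phi (ins y z (x :: w))) =
    X d + del d u (fun w => (-1) ^+ ((x \in w) * 1) *: ev phi' (ins y z w)).
  rewrite -delD; apply: eq_del => // w.
  by rewrite ev_ins_cons (negbTE xy) addn0 muln1.
have [xu|xu] := boolP (x \in u).
  have -> : del c [:: x, z, x & u] phi = phi [:: z, x & u] - phi [:: x, z & u] + X (upd c x 1).
    rewrite del_cons_in ?inE ?eqxx ?orbT // del_cons_notin; last first.
      by rewrite inE negb_or zx.
    rewrite updE (negbTE zx) cz oppr0 scale0r add0r del_cons_in //.
    rewrite opprB [_ - phi _]addrC addrA; congr (_ + _).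
    apply: eq_del => // a; rewrite !updE.
    by case: (a == x); rewrite ?opprK.
  rewrite expr1 scaleN1r (eq_in_ev (psi := fun o => phi o - del (upd (fun x => - c x) x 1) o phi')); last first.
    by move=> o /memo xo /=; rewrite del_cons_in ?xo.
  rewrite evD evN IH //; last first.
  - by rewrite updE eq_sym (negbTE xy) cy oppr0.
  - by rewrite updE (negbTE zx) cz oppr0.
  rewrite del_cons_in // -/phi' insE del_sign_mem // expr1 scaleN1r updE eqxx mulr1.
  rewrite -[del (upd _ x (-1)) u _]/(I _) -/(I _) -/(phi' (z :: u)) -/(X _).
  have -> : X (upd (fun z => - - c z) x 1) = X (upd c x 1).
    by apply: eq_del => // a; rewrite !updE opprK.
  have -> : I (upd (upd (fun z => - - c z) x 1) x (-1)) = I (fun a => - upd (fun x => - c x) x 1 a).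
    by apply: eq_del => // a; rewrite !updE; case: (a == x).
  rewrite -/s -/S.
  set i := I _; set xx := X _; set a := phi _; set b := phi' _; set e := s *: _.
  set f := ev _ _.
  by rewrite !opprB !addrA (ACl (1*5*6*3*7*8*(2*4))) /= addNr addr0.
pose c1 := fun a => - c a.
have c1E : {in u, upd c1 x 1 =1 c1}.
  by move=> a au; rewrite updE; case: eqP => // ax; rewrite -ax au in xu.
have -> : del c [:: x, z, x & u] phi = phi [:: z, x & u] - (phi [:: x, z & u] + X c1).
  rewrite del_cons_in ?inE ?eqxx ?orbT // del_cons_notin; last first.
    by rewrite inE negb_or zx.
  rewrite updE (negbTE zx) cz oppr0 scale0r add0r del_cons_notin // updE eqxx scale1r.
  by congr (_ - (_ + _)); apply: eq_in_del.
rewrite scale1r (eq_in_ev (psi := fun o => c x *: phi o + del c o phi')); last first.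
  by move=> o /memo xo /=; rewrite del_cons_notin ?xo.
rewrite evD evZ IH // del_cons_notin //.
have -> : del (fun a => - c a) u (fun w => ev phi (ins y z (x :: w))) = X c1 + I c1.
  rewrite insE; congr (_ + _); apply: eq_in_del => // w wu.
  by rewrite (_ : x \in w = false) ?mul0n ?scale1r //; apply/negP => /wu; rewrite (negbTE xu).
rewrite -/(I _) -/(phi' (z :: u)) -/s -/S scaleNr.
set i := I _; set xx := X _; set a := phi _; set b := phi' _; set e := s *: _.
set f := c x *: _.
by rewrite !opprD !opprK !addrA (ACl (1*6*7*4*3*8*(2*5))) /= addNr addr0.
Qed.

(** An insertion at a letter of u in a composite has the same result as doubling
    the slot in v to t z t and cutting u at that letter. *)
Lemma ins_fill t v u y z phi : y != t -> z != t -> z \notin v -> z \notin u ->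
  y \notin u -> t \notin u -> {in u, forall a, a \notin v} ->
  ev (fun o => ev phi (ins y z o)) (fill t v u) =
  ev (fun w => ev phi (fill t w u)) (ins y z v).
Proof.
move=> yt zt; move: v u phi; apply: (@fill_ind _ t).
- move=> v u tv phi *; rewrite ev_fill_notin //; apply: eq_in_ev => w wo.
  by rewrite ev_fill_notin // (ins_mem wo) // eq_sym.
- move=> x v u xt tv IH phi; rewrite inE negb_or => /andP[zx zv] zu yu tu uv.
  have xu : x \notin u by apply/negP => /uv; rewrite mem_head.
  rewrite ev_fill_neq // ev_ins_cons.
  rewrite (eq_in_ev (psi := fun o => (if x == y then 0 else phi [:: x, z, x & o]) +
    (-1) ^+ ((x \in v) + (x == y)) *: ev (fun w => phi (x :: w)) (ins y z o))); last first.
    move=> o oin; rewrite ev_ins_cons (fill_mem tv tu oin) !inE xt (negbTE xu) orbF //.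
  rewrite evD evZ IH //; last exact: dis_cons uv.
  congr (_ + _ *: _).
    case: ifP => xy; first exact: ev0.
    by rewrite !ev_fill_neq // eq_sym.
  by apply: eq_ev => w; rewrite ev_fill_neq.
- move=> v phi; rewrite inE negb_or => /andP[_ zv] _ _ _ _.
  rewrite ev_fill_slot_nil ev_ins_cons eq_sym (negbTE yt) ev_fill_slot_nil.
  rewrite !inE eqxx orbT add0r addn0.
  rewrite [in RHS](eq_in_ev (psi := fun w => if t \in v then 0 else phi w)); last first.
    by move=> w wo /=; rewrite ev_fill_slot_nil (ins_mem wo) // eq_sym.
  by rewrite ev_if ev0; case: ifP; rewrite ?scaler0 ?scale1r.
move=> v a u IHv IHu phi; rewrite inE negb_or => /andP[_ zv].
rewrite inE negb_or => /andP[za zu]; rewrite inE negb_or => /andP[ya yu] tau uv.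
have tu : t \notin u by case/norP: tau.
have uv' := dis_tail uv; have uvn : {in a :: u, forall b, b \notin v} := dis_cons uv.
have av : a \notin v by apply: uvn; rewrite mem_head.
have zau : z \notin a :: u by rewrite inE negb_or za.
have yau : y \notin a :: u by rewrite inE negb_or ya.
pose phi' w := phi (a :: w).
pose d := deg (t :: v).
have zt' : (t == z) = false by rewrite eq_sym (negbTE zt).
have insE w : ev phi (ins y z (a :: w)) = phi [:: a, z, a & w] +
     (-1) ^+ (a \in w) *: ev phi' (ins y z w).
  by rewrite ev_ins_cons eq_sym (negbTE ya) addn0.
pose B := ev (fun o => phi [:: a, z, a & o]) (fill t (t :: v) u).
pose I := ev (fun o => ev phi' (ins y z o)) (fill t (t :: v) u).
have L2 : (-1) ^+ ((a \in u) * d) *: ev (fun o => ev phi (ins y z (a :: o))) (fill t (t :: v) u) =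
    (-1) ^+ ((a \in u) * d) *: B + (-1) ^+ ((a \in u) * d.+1) *: I.
  rewrite (eq_in_ev (psi := fun o => phi [:: a, z, a & o] +
     (-1) ^+ (a \in u) *: ev phi' (ins y z o))); last first.
    move=> o oin; rewrite insE (fill_mem _ tu oin) ?mem_head // !inE (negbTE av).
    rewrite orbF; congr (_ + (-1) ^+ nat_of_bool _ *: _).
    by case: eqP => // at'; move: tau; rewrite at' mem_head.
  by rewrite evD evZ scalerDr scalerA -exprD mulnS addnC.
have [tzE dtz] : (t \in t :: v) /\ deg [:: t, z, t & v] = d.+1.
  by rewrite mem_head /= !inE eqxx orbT (negbTE zt) (negbTE zv).
rewrite ev_fill_slot -/d L2 [RHS]ev_ins_cons eq_sym (negbTE yt) addn0.
rewrite ev_fill_slot dtz !inE eqxx orbT ev_fill_neq // ev_fill_slot -/d.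
pose J := ev (fun w => ev phi' (fill t (t :: w) u)) (ins y z v).
pose K := ev (fun w => ev phi' (fill t w (a :: u))) (ins y z v).
have IE : I = ev phi' (fill t [:: t, z, t & v] u) + (-1) ^+ (t \in v) *: J.
  rewrite /I IHu //; last by rewrite inE negb_or zt.
  by rewrite ev_ins_cons eq_sym (negbTE yt) addn0.
have -> : ev (fun w => ev phi (fill t (t :: w) (a :: u))) (ins y z v) =
    (if t \in v then K else 0) + (-1) ^+ ((a \in u) * d.+1) *: J.
  rewrite (eq_in_ev (psi := fun w => (if t \in v then ev phi' (fill t w (a :: u)) else 0)
     + (-1) ^+ ((a \in u) * d.+1) *: ev phi' (fill t (t :: w) u))).
    by rewrite evD evZ ev_if ev0.
  move=> w wo; rewrite ev_fill_slot (ins_mem wo) 1?eq_sym //=.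
  by rewrite (ins_mem wo) 1?eq_sym // (deg_ins zv wo) addnS.
have -> : (if t \in v then ev (fun w => ev phi (ins y z (a :: w))) (fill t v (a :: u)) else 0) =
  (if t \in v then ev (fun w => phi [:: a, z, a & w]) (fill t v (a :: u)) else 0) +
  (-1) ^+ (t \in v) *: (if t \in v then K else 0).
  case: ifP => tv; last by rewrite scaler0 addr0.
  rewrite /K -IHv // -evZ -evD; apply: eq_in_ev => o oin.
  by rewrite insE (fill_mem tv tau oin) !inE eqxx orbT.
rewrite IE -/phi' -/B !scalerDr !addrA !scalerA [X in (X *: J)]mulrC.
by rewrite (ACl (1*3*4*2*5)) /=.
Qed.

Arguments ins : simpl never.

Lemma fill_slot_last t v u phi : t \notin v -> {in u, forall a, a \notin v} ->
  ev phi (fill t (t :: v) u) = (-1) ^+ (deg u * deg v) *: phi (u ++ v).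
Proof.
move=> tv; elim: u phi => [|a u IH] phi uv.
  by rewrite ev_fill_slot_nil (negbTE tv) scale1r.
rewrite ev_fill_slot (negbTE tv) add0r IH; last exact: dis_tail uv.
by rewrite scalerA -exprD /= (negbTE tv) -mulnDl.
Qed.

Lemma ins_notin y y' z v phi : y \notin v -> y' \notin v ->
  ev phi (ins y z v) = ev phi (ins y' z v).
Proof.
elim: v phi => // x v IH phi; rewrite !inE !negb_or => /andP[yx yv] /andP[yx' yv'].
by rewrite !ev_ins_cons ![x == _]eq_sym (negbTE yx) (negbTE yx') IH.
Qed.

Lemma ins_cat y z u v phi : y \notin v -> {in u, forall a, a \notin v} ->
  (count_mem y u <= 1)%N ->
  ev phi (ins y z (u ++ v)) = ev (fun w => phi (w ++ v)) (ins y z u) +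
   (-1) ^+ (deg u + (y \in u)) *: ev (fun w => phi (u ++ w)) (ins y z v).
Proof.
move=> yv; elim: u phi => [|x u IH] phi uv yu.
  by rewrite /= ev_nil add0r scale1r.
have xv : x \notin v by apply: uv; rewrite mem_head.
rewrite /= !ev_ins_cons mem_cat (negbTE xv) orbF IH; last 2 first.
- exact: dis_tail uv.
- by apply: leq_trans yu; rewrite /= leq_addl.
rewrite scalerDr addrA scalerA -exprD; congr (_ + _ *: _).
rewrite inE; have [xy|xy] := eqVneq x y.
  subst x; have -> : (y \in u) = false.
    by apply/negbTE/count_memPn; move: yu; rewrite /= eqxx; lia.
  by rewrite addn0 add0n addnC.
by rewrite addn0 addnA.
Qed.

Lemma sgn_eq a b : odd a = odd b -> (-1) ^+ a = (-1) ^+ b :> R.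
Proof. by move=> ab; rewrite -signr_odd ab signr_odd. Qed.

(** If t occurs only once in v, then u enters in one piece, and an insertion takes
    place in v outside of the slot or within u. The letter y, at which there is
    no insertion, belongs to u here, so that t takes its role in v. *)
Lemma ins_fill_top t v u y z phi : t \in v -> (count_mem t v <= 1)%N ->
  y \in u -> (count_mem y u <= 1)%N ->
  z \notin v -> z \notin u -> z != t -> t \notin u -> {in u, forall a, a \notin v} ->
  ev (fun o => ev phi (ins y z o)) (fill t v u) =
  ev (fun w => ev phi (fill t w u)) (ins t z v) +
  (-1) ^+ deg v *: ev (fun w => ev phi (fill t v w)) (ins y z u).
Proof.
move=> tv ct yu cy zv zu zt tu; elim: v phi tv ct zv => // x v IH phi tv ct.
rewrite inE negb_or => /andP[zx zv] uv.
have uv' : {in u, forall b, b \notin v} := dis_cons uv.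
have yv : y \notin v by exact: uv'.
have [xt|xt] := eqVneq x t.
  subst x; have tv' : t \notin v.
    by apply/count_memPn; move: ct; rewrite /= eqxx; lia.
  rewrite fill_slot_last // ins_cat // yu ev_ins_cons eqxx add0r (negbTE tv') expr1 /=.
  rewrite (negbTE tv') add0n.
  rewrite (eq_in_ev (s := ins t z v) (psi := fun w => (-1) ^+ (deg u * (deg v).+1) *: phi (u ++ w))); last first.
    move=> w wo; rewrite fill_slot_last ?(deg_ins zv wo) //.
      by rewrite (ins_mem wo) // eq_sym.
    move=> b bu; rewrite (ins_mem wo); first exact: uv'.
    by apply: contraNneq zu => <-.
  rewrite [in RHS](eq_in_ev (s := ins y z u) (psi := fun w => (-1) ^+ ((deg u).+1 * deg v) *: phi (w ++ v))); last first.
    move=> w wo; rewrite fill_slot_last ?(deg_ins zu wo) //.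
    move=> b bw; have [->//|bz] := eqVneq b z.
    by apply: uv'; rewrite -(ins_mem wo).
  rewrite (ins_notin _ _ yv tv') !evZ scalerDr !scalerA -exprS -!exprD [RHS]addrC.
  congr (_ *: _ + _ *: _); apply: sgn_eq;
  by rewrite !(oddD, oddM, oddS) /=; case: (odd (deg u)); case: (odd (deg v)).
have xu : x \notin u by apply/negP => /uv; rewrite mem_head.
have xy : (x == y) = false by apply: contraNF xu => /eqP ->.
have tv' : t \in v by move: tv; rewrite inE eq_sym (negbTE xt).
rewrite ev_fill_neq // ev_ins_cons (negbTE xt) addn0.
rewrite (eq_in_ev (psi := fun o => phi [:: x, z, x & o] +
    (-1) ^+ (x \in v) *: ev (fun w => phi (x :: w)) (ins y z o))); last first.
  by move=> o oin; rewrite ev_ins_cons xy addn0 (fill_mem tv' tu oin) !inE xt (negbTE xu) orbF.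
rewrite evD evZ IH //; last by move: ct; rewrite /= (negbTE xt).
rewrite !ev_fill_neq // 1?eq_sym // scalerDr addrA /= exprD scalerA; congr (_ + _ *: _ + _ *: _).
  by apply: eq_ev => w; rewrite ev_fill_neq.
by apply: eq_ev => w; rewrite ev_fill_neq.
Qed.

End EvIns.
End Ins.

(** * Linear extension to the free module on words *)

Section Lin.
Local Open Scope fset_scope.
Local Open Scope ring_scope.
Variables (R : comNzRingType) (K : choiceType) (V : lmodType R).
Implicit Types (a b : {malg R[K]}) (phi psi : K -> V).

Definition lin phi a : V := \sum_(k <- msupp a) a@_k *: phi k.

Lemma linE phi a (D : {fset K}) : msupp a `<=` D ->
  lin phi a = \sum_(k <- D) a@_k *: phi k.
Proof.
move=> aD; apply: big_fset_incl => // k kD ka.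
by rewrite mcoeff_outdom // scale0r.
Qed.

Lemma lin_is_linear phi : linear (lin phi).
Proof.
move=> c a b; pose D := (msupp a `|` msupp b)%fset.
have aD : msupp a `<=` D by exact: fsubsetUl.
have bD : msupp b `<=` D by exact: fsubsetUr.
have abD : msupp (c *: a + b) `<=` D.
  apply: fsubset_trans (msuppD_le _ _) _; rewrite fsubUset bD andbT.
  exact: fsubset_trans (msuppZ_le _ _) aD.
rewrite (linE _ aD) (linE _ bD) (linE _ abD) scaler_sumr -big_split.
by apply: eq_bigr => k _; rewrite mcoeffD mcoeffZ scalerDl scalerA.
Qed.

HB.instance Definition _ phi := GRing.isLinear.Build R {malg R[K]} V _ (lin phi) (lin_is_linear phi).

Lemma linU phi k : lin phi << k >> = phi k.
Proof.
rewrite (linE _ (msuppU_le (k := k) (x := 1))) big_seq_fset1.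
by rewrite mcoeffUU scale1r.
Qed.

Lemma eq_in_lin phi psi a : {in msupp a, phi =1 psi} -> lin phi a = lin psi a.
Proof. by move=> eq; apply: eq_big_seq => k ka; rewrite eq. Qed.

Lemma eq_lin phi psi a : phi =1 psi -> lin phi a = lin psi a.
Proof. by move=> eq; apply: eq_in_lin. Qed.

Lemma linDf phi psi a : lin (fun k => phi k + psi k) a = lin phi a + lin psi a.
Proof. by rewrite -big_split; apply: eq_bigr => k _; rewrite scalerDr. Qed.

Lemma linZf c phi a : lin (fun k => c *: phi k) a = c *: lin phi a.
Proof. by rewrite scaler_sumr; apply: eq_bigr => k _; rewrite !scalerA mulrC. Qed.

Lemma linBf phi psi a : lin (fun k => phi k - psi k) a = lin phi a - lin psi a.
Proof.
rewrite -scaleN1r -linZf -linDf; apply: eq_lin => k.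
by rewrite scaleN1r.
Qed.

End Lin.

Lemma lin_swap (R : comNzRingType) (K L : choiceType) (V : lmodType R)
    (f : K -> L -> V) (a : {malg R[K]}) (b : {malg R[L]}) :
  lin (fun v => lin (f v) b) a = lin (fun u => lin (fun v => f v u) a) b.
Proof.
rewrite /lin.
under eq_bigr do rewrite scaler_sumr.
under [in RHS]eq_bigr do rewrite scaler_sumr.
rewrite exchange_big; apply: eq_bigr => u _; apply: eq_bigr => v _.
by rewrite !scalerA mulrC.
Qed.

Section LinComp.
Variables (R : comNzRingType) (K : choiceType).
Implicit Types (a b : {malg R[K]}).

Definition mk (s : seq (nat * K)) : {malg R[K]} := ev (fun k => << k >>) s.

Lemma malg_basis a : a = lin (fun k => << k >>) a.
Proof.
rewrite {1}[a]monalgE; apply: eq_bigr => k _; apply/malgP => k'.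
by rewrite mcoeffZ !mcoeffU mulrnAr mulr1.
Qed.

Variables (V W : lmodType R).

Lemma linear_lin (F : {linear V -> W}) (phi : K -> V) a : F (lin phi a) = lin (F \o phi) a.
Proof. by rewrite linear_sum; apply: eq_bigr => k _; rewrite linearZ. Qed.

Lemma linear_ev (F : {linear V -> W}) (T : Type) (phi : T -> V) s : F (ev phi s) = ev (F \o phi) s.
Proof. by rewrite linear_sum; apply: eq_bigr => k _; rewrite linearZ. Qed.

End LinComp.

Section LinMk.
Variables (R : comNzRingType) (K : choiceType) (V : lmodType R).
Implicit Types (a b : {malg R[K]}).

Lemma lin_mk (phi : K -> V) s : lin phi (mk R s) = ev phi s.
Proof. by rewrite (linear_ev (lin phi)); apply: eq_ev => k /=; rewrite linU. Qed.

Definition supp (P : pred K) a := forall k, k \in msupp a -> P k.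

Lemma suppD P a b : supp P a -> supp P b -> supp P (a + b).
Proof.
move=> Pa Pb k /(fsubsetP (msuppD_le _ _)); rewrite inE => /orP[]; [exact: Pa|exact: Pb].
Qed.

Lemma suppZ P c a : supp P a -> supp P (c *: a).
Proof. by move=> Pa k /(fsubsetP (msuppZ_le _ _)) /Pa. Qed.

Lemma supp0 P : supp P 0.
Proof. by move=> k; rewrite msupp0. Qed.

Lemma suppU (P : pred K) k : P k -> supp P << k >>.
Proof. by move=> Pk k' /(fsubsetP msuppU_le); rewrite inE => /eqP->. Qed.

Lemma supp_sum_seq P (I : eqType) (r : seq I) (F : I -> {malg R[K]}) :
  {in r, forall i, supp P (F i)} -> supp P (\sum_(i <- r) F i).
Proof.
by move=> h; rewrite big_seq; elim/big_ind: _ => //; [exact: supp0 | exact: suppD].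
Qed.

Lemma supp_mk (P : pred K) s : {in [seq p.2 | p <- s], forall k, P k} -> supp P (mk R s).
Proof.
by move=> h; apply: supp_sum_seq => p ps; apply/suppZ/suppU/h/map_f.
Qed.

Lemma supp_lin (K' : choiceType) (P : pred K) (phi : K' -> {malg R[K]}) (a : {malg R[K']}) :
  (forall k, k \in msupp a -> supp P (phi k)) -> supp P (lin phi a).
Proof. by move=> h; apply: supp_sum_seq => k ka; exact/suppZ/h. Qed.

End LinMk.

Section WordModule.
Variables (R : comNzRingType).
Local Notation A := {malg R[seq nat]}.
Implicit Types (a b c : A).

Definition word (w : seq nat) : A := << w >>.

(** Elements of all arities live in one module, so that the arity n of b has to be
    given. *)
Definition circ n i a b : A := lin (fun v => lin (fun u => ev word (wcomp n i v u)) b) a.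

Definition dif a : A := lin (fun v => del (fun=> 0) v word) a.

Definition insert_top n a : A := lin (fun v => ev word (ins n n.+1 v)) a.

Section Tests.
Variables (V : lmodType R).
Implicit Types phi : seq nat -> V.

Lemma linear_del (U W : lmodType R) (F : {linear U -> W}) (c : nat -> R) (v : seq nat) (phi' : seq nat -> U) :
  F (del c v phi') = del c v (F \o phi').
Proof.
elim: v c phi' => [|x v IH] c phi'; first exact: linear0.
have [xv|xv] := boolP (x \in v); first by rewrite !del_cons_in // linearB IH.
by rewrite !del_cons_notin // linearD linearZ IH.
Qed.

Lemma lin_word phi w : lin phi (word w) = phi w.
Proof. exact: linU. Qed.

Lemma lin_ev phi s : lin phi (ev word s) = ev phi s.
Proof. exact: lin_mk. Qed.

Lemma lin_circ phi n i a b :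
  lin phi (circ n i a b) = lin (fun v => lin (fun u => ev phi (wcomp n i v u)) b) a.
Proof.
rewrite (linear_lin (lin phi)); apply: eq_lin => v /=.
by rewrite (linear_lin (lin phi)); apply: eq_lin => u; rewrite /= lin_ev.
Qed.

Lemma lin_dif phi a : lin phi (dif a) = lin (fun v => del (fun=> 0) v phi) a.
Proof.
rewrite (linear_lin (lin phi)); apply: eq_lin => v /=.
by rewrite (linear_del (lin phi)); apply: eq_del => // w /=; rewrite lin_word.
Qed.

Lemma lin_insert_top phi n a : lin phi (insert_top n a) = lin (fun v => ev phi (ins n n.+1 v)) a.
Proof. by rewrite (linear_lin (lin phi)); apply: eq_lin => v /=; rewrite lin_ev. Qed.

Lemma ev_lin (f : seq nat -> seq nat -> V) s b :
  ev (fun v => lin (f v) b) s = lin (fun u => ev (fun v => f v u) s) b.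
Proof.
rewrite /lin /ev.
under eq_bigr do rewrite scaler_sumr.
under [in RHS]eq_bigr do rewrite scaler_sumr.
rewrite exchange_big; apply: eq_bigr => u _; apply: eq_bigr => v _.
by rewrite !scalerA mulrC.
Qed.

Lemma del_lin (f : seq nat -> seq nat -> V) (c : nat -> R) v b :
  del c v (fun w => lin (f w) b) = lin (fun u => del c v (fun w => f w u)) b.
Proof.
elim: v c f => [|x v IH] c f.
  by rewrite /del /lin big1 // => k _; rewrite scaler0.
have [xv|xv] := boolP (x \in v).
  rewrite del_cons_in // IH -scaleN1r -linZf -linDf; apply: eq_lin => u.
  by rewrite del_cons_in // scaleN1r.
rewrite del_cons_notin // IH -linZf -linDf; apply: eq_lin => u.
by rewrite del_cons_notin.
Qed.

End Tests.

Lemma circ_linearl n i b : linear (fun a => circ n i a b).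
Proof. exact: lin_is_linear. Qed.

Lemma circ_linearr n i a : linear (circ n i a).
Proof.
move=> c b b'; rewrite /circ -linZf -linDf; apply: eq_lin => v.
exact: lin_is_linear.
Qed.

Lemma dif_linear : linear dif. Proof. exact: lin_is_linear. Qed.
Lemma insert_top_linear n : linear (insert_top n). Proof. exact: lin_is_linear. Qed.

HB.instance Definition _ n i a := GRing.isLinear.Build R A A _ (circ n i a) (@circ_linearr n i a).
HB.instance Definition _ := GRing.isLinear.Build R A A _ dif dif_linear.
HB.instance Definition _ n := GRing.isLinear.Build R A A _ (insert_top n) (@insert_top_linear n).

Definition circl n i b a := circ n i a b.
HB.instance Definition _ n i b := GRing.isLinear.Build R A A _ (circl n i b) (@circ_linearl n i b).

Lemma circDl n i a a' b : circ n i (a + a') b = circ n i a b + circ n i a' b.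
Proof. exact: (linearD (circl n i b)). Qed.
Lemma circZl n i (c : R) a b : circ n i (c *: a) b = c *: circ n i a b.
Proof. exact: (linearZ_LR (circl n i b)). Qed.

Definition cact n k a := supp (cactus_word n k) a.

Lemma cactus_letters n k w : cactus_word n k w -> letters n w.
Proof. by case/and5P. Qed.

Lemma cactus_pos n k w : cactus_word n k w -> (0 < n)%N.
Proof. by case/and5P. Qed.

Lemma cactus_mem n k w i : cactus_word n k w -> (0 < i <= n)%N -> i \in w.
Proof.
by case/and5P=> _ _ /allP h _ _ ni; apply: h; rewrite mem_iota add1n ltnS.
Qed.

Lemma cactus_deg n k w : cactus_word n k w -> deg w = k.
Proof. by case/and5P => _ _ _ _ /andP[/eqP]. Qed.

Lemma circ_nested m n l k1 k2 k3 i j a b c :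
  (0 < i <= m)%N -> (0 < j <= n)%N ->
  cact m k1 a -> cact n k2 b -> cact l k3 c ->
  circ l (i + j - 1) (circ n i a b) c = circ (n + l - 1) i a (circ l j b c).
Proof.
move=> im jn ca cb cc; rewrite [LHS]lin_circ.
apply: eq_in_lin => v /ca cv; rewrite lin_circ.
apply: eq_in_lin => u /cb cu; rewrite ev_lin.
apply: eq_in_lin => w /cc cw.
apply: (@wcomp_nested _ _ m) => //; [exact: cactus_pos cw|exact: cactus_mem cv im|..].
- exact: cactus_letters cv.
- exact: cactus_letters cu.
- exact: cactus_letters cw.
Qed.

Lemma circ_parallel m n l k1 k2 k3 i j a b c :
  (0 < j)%N -> (j < i <= m)%N ->
  cact m k1 a -> cact n k2 b -> cact l k3 c ->
  circ l j (circ n i a b) c = (-1) ^+ (k2 * k3) *: circ n (i + l - 1) (circ l j a c) b.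
Proof.
move=> j0 /andP[ji im] ca cb cc; rewrite [LHS]lin_circ [X in _ *: X]lin_circ -linZf.
apply: eq_in_lin => v /ca cv; rewrite -linZf [in RHS]/=.
under [RHS]eq_lin do rewrite ev_lin -linZf.
rewrite [RHS]lin_swap; apply: eq_in_lin => u /cb cu; rewrite ev_lin.
apply: eq_in_lin => w /cc cw.
have im' : (0 < i <= m)%N by rewrite im (leq_trans _ ji).
have jm' : (0 < j <= m)%N by rewrite j0 (leq_trans (ltnW ji)).
rewrite (@wcomp_parallel _ _ m) ?ji //.
- by rewrite (cactus_deg cu) (cactus_deg cw).
- exact: cactus_pos cu.
- exact: cactus_pos cw.
- exact: cactus_mem cv im'.
- exact: cactus_mem cv jm'.
- exact: cactus_letters cv.
- exact: cactus_letters cu.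
- exact: cactus_letters cw.
Qed.

Lemma circ_dif m n k l i a b : (0 < i <= m)%N -> cact m k a -> cact n l b ->
  dif (circ n i a b) = circ n i (dif a) b + (-1) ^+ k *: circ n i a (dif b).
Proof.
move=> im ca cb; rewrite [LHS]lin_circ [X in X + _]lin_dif -linZf -linDf.
apply: eq_in_lin => v /ca cv; rewrite del_lin lin_dif -linZf -linDf.
apply: eq_in_lin => u /cb cu.
rewrite (@wcomp_leibniz _ _ m) // ?(cactus_deg cv) //.
- exact: cactus_pos cu.
- exact: cactus_mem cv im.
- exact: cactus_letters cv.
- exact: cactus_letters cu.
Qed.

Lemma cact_circ m n k l i a b : (0 < i <= m)%N -> cact m k a -> cact n l b ->
  cact (n + m - 1) (k + l) (circ n i a b).
Proof.
move=> im ca cb; refine (supp_lin _) => v /ca cv; refine (supp_lin _) => u /cb cu.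
refine (supp_mk _) => w oin; exact: (wcomp_cactus cv cu im oin).
Qed.

Lemma circ_unitr n k i a : (0 < i)%N -> cact n k a -> circ 1 i a (word [:: 1%N]) = a.
Proof.
move=> i0 ca; rewrite [RHS]malg_basis; apply: eq_in_lin => v /ca cv.
by rewrite lin_word wcomp_unitr //; exact/letters_positive/cactus_letters/cv.
Qed.

Lemma circ_unitl n b : circ n 1 (word [:: 1%N]) b = b.
Proof.
rewrite /circ lin_word [RHS]malg_basis; apply: eq_lin => u.
by rewrite wcomp_unitl.
Qed.

End WordModule.

(** * The words in the image of the generators *)

Section Cprimes.
Local Open Scope nat_scope.
Implicit Types (n k i j x y z : nat) (u v w a b p q : seq nat).

Local Notation nsorted := (sorted (@neq_adj nat)).

Lemma ins_outsP (y z : nat) u w :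
  reflect (exists a x b, [/\ u = a ++ x :: b, x != y & w = a ++ [:: x, z, x & b]])
          (w \in outs (ins y z u)).
Proof.
apply: (iffP idP).
  elim: u w => // c u IH w; rewrite [ins _ _ _]/= outs_cat mem_cat => /orP[|].
    by case: ifP => // /negbT cy; rewrite inE => /eqP->; exists [::], c, u.
  rewrite outs_econs => /mapP[w' /IH [a [x [b [-> xy ->]]]] ->].
  by exists (c :: a), x, b.
move=> [a [x [b [-> xy ->]]]]; elim: a => [|c a IH].
  by rewrite [ins _ _ _]/= outs_cat mem_cat (negbTE xy) inE eqxx.
by rewrite /= -/(ins y z _) outs_cat outs_econs mem_cat map_f ?orbT.
Qed.

Definition avoids w := forall i j, (j == i.+1) || (j < i) -> ~~ subseq [:: i; j; i] w.

Lemma avoids_subseq w w' : subseq w' w -> avoids w -> avoids w'.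
Proof. by move=> ss av i j ij; apply: contra (av i j ij) => /subseq_trans; apply. Qed.

Lemma subseq_stutter p a x b : nsorted p ->
  subseq p (a ++ [:: x, x & b]) -> subseq p (a ++ x :: b).
Proof.
elim: a p => [|c a IH] [|h p] sp //.
  rewrite [subseq _ (_ :: [:: x & b])]/=; case: eqP => [hx|//]; subst h.
  by rewrite -/(subseq p (x :: b)) (subseq_cons_neq _ (ohead_sorted sp)) /= eqxx.
by rewrite /=; case: eqP => _; apply: IH => //; exact: path_sorted sp.
Qed.

(** Between two occurrences of the top letter n lies a letter d < n, and n d n is
    forbidden. *)
Lemma count_top n w : letters n w -> nsorted w -> avoids w -> count_mem n w <= 1.
Proof.
elim: w => // c w IH /= /andP[cn lw] sw av.
have IHw : count_mem n w <= 1.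
  apply: IH => //; first exact: path_sorted sw.
  exact: avoids_subseq (subseq_cons _ _) av.
have [cE|//] := eqVneq c n; subst c.
suff /count_memPn -> : n \notin w by [].
case: w lw sw av {IH IHw} => // d w /= /andP[dn _] /andP[nd _] av.
have nd' : n != d by [].
rewrite inE negb_or nd'; apply/negP => nw.
have dn' : d < n by clear -dn nd'; lia.
have := av n d; rewrite dn' orbT => /(_ isT) /negP; apply.
have -> : subseq [:: n; d; n] [:: n, d & w] = subseq [:: n] w by rewrite [LHS]/= !eqxx.
by rewrite sub1seq.
Qed.

(** Membership in C'_n in the form used by the inductions on n (cprimeP). *)
Definition cprime n w :=
  [/\ letters n w, all (fun x => x \in w) (iota 1 n), nsorted w,
      size w = 2 * n - 2 & avoids w].

Lemma path_insert (h : nat) a x z b : x != z -> path (@neq_adj nat) h (a ++ x :: b) ->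
  path (@neq_adj nat) h (a ++ [:: x, z, x & b]).
Proof.
move=> xz; rewrite !cat_path /= => /and3P[-> -> ->]; rewrite /neq_adj xz.
by rewrite eq_sym xz.
Qed.

Lemma sorted_insert a x z b : x != z -> nsorted (a ++ x :: b) ->
  nsorted (a ++ [:: x, z, x & b]).
Proof.
move=> xz; case: a => [|h a] /=; last exact: path_insert.
by move=> ->; rewrite /neq_adj xz eq_sym xz.
Qed.

Lemma cprime_ins n a x b : 2 <= n -> cprime n (a ++ x :: b) -> x != n ->
  cprime n.+1 (a ++ [:: x, n.+1, x & b]).
Proof.
set w := a ++ x :: b; set w' := a ++ _; move=> n2 [lw mw sw szw av] xn.
have lE c : letters n c -> letters n.+1 c.
  by apply: sub_all => y /andP[-> /leqW].
have memE y : (y \in w') = (y == n.+1) || (y \in w).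
  rewrite !mem_cat !inE; case: (y \in a); case: (y == x); case: (y == n.+1);
  by rewrite ?orbT.
have zw : n.+1 \notin w by apply/negP => /(allP lw); rewrite ltnn andbF.
have xz : x != n.+1.
  by apply: contraNneq zw => <-; rewrite mem_cat mem_head orbT.
have cz : count_mem n.+1 w' = 1.
  move: zw; rewrite -has_pred1 has_count -leqNgt leqn0 /w /w' !count_cat /= eqxx (negbTE xz).
  by clear; lia.
split.
- apply/allP => y; rewrite memE => /orP[/eqP->|/(allP lw)/andP[-> /leqW]//].
  exact: leqnn.
- rewrite -[n.+1]addn1 iotaD all_cat; apply/andP; split.
    by apply/allP => y /(allP mw); rewrite memE => ->; rewrite orbT.
  by rewrite /= memE add1n eqxx.
- exact: sorted_insert.
- by move: szw; rewrite !size_cat /=; clear -n2; lia.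
move=> i j ij; apply/negP => ss.
have iw : i \in w' by apply: (mem_subseq ss); rewrite mem_head.
have iz : i != n.+1.
  apply/negP => /eqP iE; have := leq_count_subseq (pred1 n.+1) ss.
  by rewrite /= iE eqxx cz; clear; lia.
have ilen : i <= n.
  by move: iw; rewrite memE (negbTE iz) => /(allP lw) /andP[].
have [jE|jz] := eqVneq j n.+1.
  have iE : i = n by move: ij; rewrite jE; clear -ilen; lia.
  have := leq_count_subseq (pred1 n) ss; rewrite jE iE /= eqxx.
  have := count_top lw sw av; rewrite !count_cat /= (negbTE xn).
  by case: eqP; clear; lia.
have /negP := av i j ij; apply; apply: (subseq_stutter (a := a)).
  by rewrite /= /neq_adj; move: ij; clear; lia.
have : subseq [:: i; j; i] [seq y <- w' | y != n.+1].
  by rewrite subseq_filter /= iz jz ss.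
have aw : all (fun y => y != n.+1) w.
  by apply/allP => y yw; apply: contraNneq zw => <-.
move: aw; rewrite all_cat /= => /and3P[aa ax ab].
by rewrite filter_cat /= eqxx ax (all_filterP aa) (all_filterP ab).
Qed.

Lemma sorted_contract a x z b : nsorted (a ++ [:: x, z, x & b]) -> nsorted (a ++ x :: b).
Proof.
case: a => [|h a] /=; first by case/and3P.
by rewrite !cat_path /= => /and5P[-> -> _ _ ->].
Qed.

Lemma avoids_contract a x z b : avoids (a ++ [:: x, z, x & b]) -> avoids (a ++ x :: b).
Proof.
apply: avoids_subseq; apply: cat_subseq => //.
exact: (suffix_subseq [:: x; z]).
Qed.

Lemma letters_contract n a x b : letters n (rcons a x ++ x :: b) -> letters n (a ++ x :: b).
Proof. by rewrite /letters cat_rcons !all_cat /= => /and4P[-> -> _ ->]. Qed.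

(** The top letter stands between two equal letters x, or else it can be removed
    on its own. In the first case x is not n, as n n+1 n is forbidden. *)
Lemma split_top n w : letters n.+1 w -> nsorted w -> avoids w -> n.+1 \in w ->
  (exists a x b, [/\ w = a ++ [:: x, n.+1, x & b], x != n & letters n (a ++ x :: b)]) \/
  (exists w', [/\ size w = (size w').+1, letters n w', nsorted w' & avoids w']).
Proof.
move=> lw sw av zw; have := count_top lw sw av.
case/splitPr: zw lw sw av => p q lw sw av; rewrite count_cat /= eqxx add1n => c1.
have lpq : letters n (p ++ q).
  apply/allP => y ypq; have yz : y != n.+1.
    apply: contraTneq c1 => <-; rewrite -ltnNge.
    by move: ypq; rewrite mem_cat -!has_pred1 !has_count addnS ltnS addn_gt0.
  have /(allP lw) : y \in p ++ n.+1 :: q.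
    by move: ypq; rewrite !mem_cat inE => /orP[->|->]; rewrite ?orbT.
  by move: yz; clear; lia.
have rest : nsorted (p ++ q) -> (exists w', [/\ size (p ++ n.+1 :: q) = (size w').+1,
    letters n w', nsorted w' & avoids w']).
  move=> spq; exists (p ++ q); split=> //; first by rewrite !size_cat addnS.
  by apply: avoids_subseq av; apply: cat_subseq => //; exact: subseq_cons.
case/lastP: p lw sw av c1 lpq rest => [|a x] lw sw av c1 lpq rest.
  by right; apply: rest; exact: path_sorted sw.
case: q lw sw av c1 lpq rest => [|y b] lw sw av c1 lpq rest.
  by right; apply: rest; rewrite cats0; have [] := cat_sorted2 sw.
have [yx|yx] := eqVneq y x.
  subst y; left; exists a, x, b; rewrite cat_rcons (letters_contract lpq); split=> //.
  apply/negP => /eqP xn; have := av n n.+1; rewrite eqxx => /(_ isT) /negP; apply.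
  rewrite cat_rcons xn; apply: subseq_trans (suffix_subseq a _).
  by rewrite /= !eqxx sub0seq.
right; apply: rest; move: sw; rewrite !cat_rcons.
case: (a) => [|h c] /=; first by case/and3P => _ _ ->; rewrite /neq_adj eq_sym yx.
by rewrite !cat_path /= => /and5P[-> -> _ _ ->]; rewrite /neq_adj eq_sym yx.
Qed.

(** The removal of the top letter, possibly together with one of two equal
    neighbours, costs at most two letters. *)
Lemma cprime_bound n w : 2 <= n -> letters n w -> nsorted w -> avoids w ->
  size w <= 2 * n - 2.
Proof.
elim: n w => // n IH w n2 lw sw av.
have [n1|n1] := eqVneq n 1.
  subst n; case: w lw sw av => [|x [|y [|z w]]] //=.
  case/and4P => x2 y2 z2 _ /and3P[xy yz _] av; exfalso.
  have zx : z = x.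
    by move: xy yz; rewrite /neq_adj; clear -x2 y2 z2; lia.
  apply: (negP (av x y _)).
    by move: xy; rewrite /neq_adj; clear -x2 y2; lia.
  by rewrite /= zx !eqxx sub0seq.
have n2' : 2 <= n by clear -n2 n1; lia.
have [zw|zw] := boolP (n.+1 \in w); last first.
  apply: leq_trans (IH w n2' _ sw av) _; last by clear; lia.
  apply/allP => y yw; have /(allP lw) := yw.
  have : y != n.+1 by apply: contraNneq zw => <-.
  by clear; lia.
have [[a [x [b [wE _ lab]]]]|[w' [-> lw' sw' aw']]] := split_top lw sw av zw; last first.
  by have := IH _ n2' lw' sw' aw'; clear -n2'; lia.
rewrite wE in sw av *.
have := IH _ n2' lab (sorted_contract sw) (avoids_contract av).
by rewrite !size_cat /=; clear -n2'; lia.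
Qed.

(** The length 2n is the largest one allowed by cprime_bound, so that the removal
    of the top letter has to cost two letters. *)
Lemma cprime_unins n w : 2 <= n -> cprime n.+1 w ->
  exists a x b, [/\ w = a ++ [:: x, n.+1, x & b], x != n & cprime n (a ++ x :: b)].
Proof.
move=> n2 [lw mw sw szw av].
have zw : n.+1 \in w by apply: (allP mw); rewrite mem_iota; clear; lia.
have [[a [x [b [wE xn lab]]]]|[w' [sz' lw' sw' aw']]] := split_top lw sw av zw; last first.
  have := cprime_bound n2 lw' sw' aw'.
  by move: szw; rewrite sz'; clear -n2; lia.
exists a, x, b; move: sw av szw mw; rewrite wE => sw av szw mw; split=> //.
split=> //; last 3 first.
- exact: sorted_contract sw.
- by move: szw; rewrite !size_cat /=; clear -n2; lia.
- exact: avoids_contract av.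
apply/allP => y yn; have : y \in a ++ [:: x, n.+1, x & b].
  by apply: (allP mw); move: yn; rewrite !mem_iota; clear; lia.
have : y != n.+1 by move: yn; rewrite mem_iota; clear; lia.
rewrite !mem_cat !inE => /negbTE ->; rewrite orFb.
by case: (y \in a); case: (y == x).
Qed.

Lemma avoids_noncrossing w : avoids w -> noncrossing w.
Proof.
have sub3 (i j : nat) : subseq [:: i; j; i] (crossing i j) by rewrite /= !eqxx.
have sub3' (i j : nat) : subseq [:: j; i; j] (crossing i j).
  by apply: (@subseq_trans _ [:: j; i; j]) => //; exact: subseq_cons.
move=> av i j ij; apply/negP => ss; have [lt|gt] : j < i \/ i < j by move: ij; clear; lia.
  by apply: (negP (av i j _)); rewrite ?lt ?orbT // (subseq_trans (sub3 i j)).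
by apply: (negP (av j i _)); rewrite ?gt ?orbT // (subseq_trans (sub3' i j)).
Qed.

Lemma cprime_count n w : 2 <= n -> cprime n w -> count_mem n w = 1.
Proof.
move=> n2 [lw mw sw _ av]; apply/eqP; rewrite eqn_leq count_top //=.
by rewrite -has_count has_pred1; apply: (allP mw); rewrite mem_iota; clear -n2; lia.
Qed.

Lemma cprime_cactus n w : 2 <= n -> cprime n w -> cactus_word n (n - 2) w.
Proof.
move=> n2 [lw mw sw szw av]; rewrite /cactus_word lw mw sw.
have -> : is_cactus w by exact/noncrossingP/avoids_noncrossing.
rewrite (leq_trans _ n2) //= andbT; have := size_deg w.
by rewrite (size_undup_letters lw mw) szw; clear -n2; lia.
Qed.

Lemma is_surjP n (k : nat) w : is_surj n k%:Z w =
  [&& 0 < n, size w == n + k, letters n w, all (fun x => x \in w) (iota 1 n) & nsorted w].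
Proof.
rewrite /is_surj; congr [&& _, _, _, _ & _].
apply/forallP/(sortedP 0) => [h i iw|h i]; last first.
  by apply: h; rewrite -ltn_predRL.
have iw' : i < (size w).-1 by rewrite ltn_predRL.
exact: (h (Ordinal iw')).
Qed.

Lemma cprimeP n w : 2 <= n -> reflect (cprime n w) (is_cactus' n w).
Proof.
move=> n2; rewrite /is_cactus'.
have -> : (n%:Z - 2 = (n - 2)%:Z)%R by clear -n2; lia.
rewrite is_surjP; have -> : n + (n - 2) = 2 * n - 2 by clear -n2; lia.
have aP : reflect (avoids w) (all (fun i => all (fun j => ((j == i.+1) || (j < i)) ==>
        ~~ subseq [:: i; j; i] w) w) w).
  apply: (iffP allP) => [h i j ij|av i iw]; last first.
    by apply/allP => j jw; apply/implyP; exact: av.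
  apply/negP => ss; have iw : i \in w by apply: (mem_subseq ss); rewrite mem_head.
  have jw : j \in w by apply: (mem_subseq ss); rewrite !inE eqxx orbT.
  by have := allP (h i iw) j jw; rewrite ij ss.
apply: (iffP and3P) => [[/and5P[_ /eqP szw lw mw sw] _ /aP av]|[lw mw sw szw av]] //.
split; last exact/aP; last exact/noncrossingP/avoids_noncrossing.
by rewrite szw eqxx lw mw sw (leq_trans _ n2).
Qed.

Lemma cprime2 w : cprime 2 w <-> w \in [:: [:: 2; 1]; [:: 1; 2]].
Proof.
split=> [[lw _ sw szw _]|].
  case: w lw sw szw => [|x [|y []]] //= /and3P[x2 y2 _]; rewrite /neq_adj andbT => xy _.
  have [[-> ->]|[-> ->]] : (x = 1 /\ y = 2) \/ (x = 2 /\ y = 1).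
    by clear -x2 y2 xy; lia.
  by []. by [].
by rewrite !inE => /orP[] /eqP ->; split=> // i j _; apply/negP => /size_subseq.
Qed.

(** The words of C'_n with their signs, for n = k + 2: from n to n + 1 by inserting
    the letter n + 1 everywhere except at n, with the global sign (-1)^n. *)
Fixpoint cprime_list k : seq (nat * seq nat) :=
  if k is k'.+1 then
    flatten [seq [seq (k'.+2 + e.1 + f.1, f.2) | f <- ins k'.+2 k'.+3 e.2] | e <- cprime_list k']
  else [:: (0, [:: 2; 1]); (0, [:: 1; 2])].

Lemma outs_cprime_listS k : outs (cprime_list k.+1) = flatten [seq outs (ins k.+2 k.+3 u) | u <- outs (cprime_list k)].
Proof.
rewrite /outs [cprime_list _]/= map_flatten -!map_comp; congr flatten; apply: eq_map => e /=.
by rewrite -map_comp.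
Qed.

Lemma outs_cprime_listP k w : w \in outs (cprime_list k) <-> cprime k.+2 w.
Proof.
elim: k w => [|k IH] w; first by rewrite cprime2.
rewrite outs_cprime_listS; split.
  case/flattenP => s /mapP[u /IH cu ->] /ins_outsP[a [x [b [uE xn ->]]]].
  by rewrite uE in cu; exact: cprime_ins.
case/cprime_unins => // a [x [b [wE xn cu]]].
apply/flattenP; exists (outs (ins k.+2 k.+3 (a ++ x :: b))).
  by apply: map_f; apply/IH.
by apply/ins_outsP; exists a, x, b.
Qed.

Lemma uniq_flatten_map (S T : eqType) (G : S -> seq T) (r : T -> S) (s : seq S) :
  uniq s -> {in s, forall c, uniq (G c)} ->
  (forall c t, c \in s -> t \in G c -> r t = c) -> uniq (flatten [seq G c | c <- s]).
Proof.
elim: s => //= c s IH /andP[cs us] uG rG; rewrite cat_uniq uG ?mem_head //=.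
have sub d : d \in s -> d \in c :: s by move=> ds; rewrite inE ds orbT.
rewrite IH // => [|d /sub/uG //|d t /sub /rG h /h //]; rewrite andbT.
apply/hasPn => t /flattenP[h /mapP[d ds ->] td].
apply/negP => /= tc; have := rG c t (mem_head _ _) tc.
by rewrite (rG d t (sub d ds) td) => dc; rewrite -dc ds in cs.
Qed.

Lemma ins_uniq (y z : nat) u : z \notin u -> uniq (outs (ins y z u)).
Proof.
elim: u => // c u IH; rewrite inE negb_or => /andP[zc zu].
rewrite [ins _ _ _]/= outs_cat outs_econs.
have un : uniq [seq c :: w | w <- outs (ins y z u)].
  by rewrite map_inj_uniq ?IH // => w w' [].
case: ifP => // _; rewrite /= un andbT; apply/mapP => -[w /ins_outsP[a [x [b [uE xy ->]]]] [E]].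
move: zu; rewrite uE; case: a uE E => [|h a] _ [-> _]; by rewrite mem_head.
Qed.

(** The word before the insertion of x z x is recovered by the removal of z and of
    the letter that follows it. *)
Lemma cprime_list_uniq k : uniq (outs (cprime_list k)).
Proof.
elim: k => // k IH; rewrite outs_cprime_listS.
pose r w := take (index k.+3 w) w ++ drop (index k.+3 w).+2 w.
have zu u : u \in outs (cprime_list k) -> k.+3 \notin u.
  by move=> /outs_cprime_listP [lu _ _ _ _]; apply/negP => /(allP lu); rewrite ltnn andbF.
apply: (uniq_flatten_map (r := r)) => // u => [uk|w uk /ins_outsP[a [x [b [uE xn ->]]]]].
  exact/ins_uniq/zu.
have := zu u uk; rewrite uE mem_cat inE !negb_or => /and3P[za zx zb].
rewrite /r index_cat (negbTE za) /= eq_sym (negbTE zx) eqxx addn1.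
have -> : take (size a).+1 (a ++ [:: x, k.+3, x & b]) = a ++ [:: x].
  by rewrite (catA a [:: x] [:: k.+3, x & b]) take_size_cat // size_cat addn1.
have -> : drop (size a).+3 (a ++ [:: x, k.+3, x & b]) = b.
  by rewrite (catA a [:: x; k.+3; x] b) drop_size_cat // size_cat addn3.
by rewrite -catA.
Qed.

Definition psign n w : bool :=
  odd (nth 0 [seq e.1 | e <- cprime_list (n - 2)] (index w (outs (cprime_list (n - 2))))).

Section SumCprime.
Local Open Scope ring_scope.
Variables (R : comNzRingType) (V : lmodType R).

Lemma word_of_inj L n : injective (@word_of L n).
Proof.
move=> u u' uu; apply/val_inj; move: uu; apply: inj_map => x x' [].
exact: val_inj.
Qed.

Lemma ev_cprime_list (F : seq nat -> V) n : (2 <= n)%N ->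
  ev F (cprime_list (n - 2)) =
  \sum_(u : (2 * n - 2).-tuple 'I_n | is_cactus' n (word_of u))
     (-1) ^+ psign n (word_of u) *: F (word_of u).
Proof.
move=> n2; set l := cprime_list (n - 2).
transitivity (\sum_(w <- outs l) (-1) ^+ psign n w *: F w).
  rewrite big_map; apply: eq_big_seq => e el; congr (_ *: _).
  rewrite signr_odd -/l; congr (_ ^+ _).
  have il : (index e l < size l)%N by rewrite index_mem.
  have -> : index e.2 (outs l) = index e l.
    rewrite -{1}(nth_index e el) -(nth_map e [::]) // index_uniq ?size_map //.
    exact: cprime_list_uniq.
  by rewrite (nth_map e) // nth_index.
pose e := [seq u <- index_enum ((2 * n - 2).-tuple 'I_n : finType) | is_cactus' n (word_of u)].
transitivity (\sum_(w <- map (@word_of (2 * n - 2) n) e) (-1) ^+ psign n w *: F w); last first.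
  by rewrite big_map big_filter.
apply: perm_big; apply: uniq_perm; first exact: cprime_list_uniq.
  by rewrite map_inj_uniq ?filter_uniq ?index_enum_uniq //; exact: word_of_inj.
have nE : n = (n - 2).+2 by clear -n2; lia.
move=> w; apply/idP/mapP => [/outs_cprime_listP|[u]].
  rewrite -nE => cw; have [lw _ _ szw _] := cw.
  have n0 : (0 < n)%N by exact: leq_trans n2.
  pose f x : 'I_n := insubd (Ordinal n0) x.-1.
  have szf : size (map f w) == (2 * n - 2)%N by rewrite size_map szw.
  have wE : word_of (Tuple szf) = w.
    rewrite /word_of /= -map_comp -[RHS]map_id; apply/eq_in_map => x /(allP lw) xn /=.
    rewrite val_insubd; move: xn; clear; case: x => //= x xn.
    by rewrite xn.
  exists (Tuple szf) => //; rewrite mem_filter mem_index_enum wE andbT; exact/cprimeP.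
rewrite mem_filter => /andP[/(cprimeP _ n2) cu _] ->; apply/outs_cprime_listP.
by rewrite -nE.
Qed.

End SumCprime.

End Cprimes.

(** * The A-infinity relation in the cacti *)

Section InsRelabel.
Variables (R : comNzRingType) (V : lmodType R).
Implicit Types (u v w : seq nat) (phi : seq nat -> V).

Lemma ev_ins_map (f : nat -> nat) (S : {pred nat}) y z v phi :
  {in S &, injective f} -> y \in S -> {subset v <= S} ->
  ev phi (ins (f y) (f z) (map f v)) = ev (phi \o map f) (ins y z v).
Proof.
move=> inj_f yS; elim: v phi => [|x v IH] phi vS; first by rewrite /ins !ev_nil.
have vS' : {subset v <= S} by move=> a av; apply: vS; rewrite inE av orbT.
have xS : x \in S by apply/vS/mem_head.
rewrite map_cons !ev_ins_cons (mem_map_in inj_f) // IH //.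
by rewrite (inj_in_eq inj_f).
Qed.

Lemma fill_single t v p phi : count_mem t v = 1%N -> deg p = 0%N ->
  {in p, forall a, a \notin v} ->
  ev phi (fill t v p) = phi (sub_letter t p v).
Proof.
elim: v phi => // x v IH phi; have [->|xt] := eqVneq x t => /= ct dp pv.
  have tv : t \notin v by apply/count_memPn; move: ct; rewrite eqxx add1n => -[].
  rewrite fill_slot_last //; last exact: dis_cons pv.
  by rewrite dp mul0n scale1r /sub_letter /= eqxx -/(sub_letter t p v) sub_letter_notin.
rewrite ev_fill_neq // IH //; last exact: dis_cons pv.
  by rewrite /sub_letter /= (negbTE xt).
by rewrite (negbTE xt) in ct.
Qed.

Lemma sub_letter_map (f : nat -> nat) t p v : {in v, forall x, (f x == f t) = (x == t)} ->
  {in v, forall x, x != t -> f x = x} -> sub_letter (f t) p (map f v) = sub_letter t p v.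
Proof.
elim: v => // x v IH ft fx; rewrite /sub_letter /= ft ?mem_head //.
rewrite -/(sub_letter _ _ _) -/(sub_letter _ _ v) IH; last 2 first.
- by move=> y yv; apply: ft; rewrite inE yv orbT.
- by move=> y yv; apply: fx; rewrite inE yv orbT.
by case: eqP => // /eqP xt; rewrite fx ?mem_head.
Qed.

Lemma wcomp_top2 n v p phi : (2 <= n)%N -> cprime n v ->
  deg p = 0%N -> letters 2 p ->
  ev phi (wcomp 2 n v p) = phi (sub_letter n (map (shift n) p) v).
Proof.
move=> n2 cv dp lp; have [lv _ _ _ _] := cv.
have n0 : (0 < n)%N by exact: leq_trans n2.
have vE x : x \in v -> (0 < x <= n)%N by move=> /(allP lv).
have E0 : open_slot 0 2 n n = 0%N by rewrite /open_slot eqxx.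
rewrite /wcomp fill_single.
- congr phi.
  transitivity (sub_letter (open_slot 0 2 n n) (map (shift n) p) (map (open_slot 0 2 n) v)).
    by rewrite E0.
  rewrite sub_letter_map // => x /vE xn.
    by rewrite E0 open_slot_eq0 //; case/andP: xn.
  by move: xn; clear; rewrite /open_slot /widen => xn /negbTE xE; rewrite xE; case: ifP; lia.
- rewrite count_map -(cprime_count n2 cv); apply: eq_in_count => x /vE xn /=.
  by rewrite open_slot_eq0 //; case/andP: xn.
- by rewrite (deg_map (S := predT)) // => x y _ _; exact: shift_inj.
move=> _ /mapP[x /(allP lp) xp ->]; apply/mapP => -[y /vE yn].
by move: xp yn n2; clear => /= xp yn n2; case_ifs.
Qed.

Lemma wcomp_21 n u phi : ev phi (wcomp n 1 [:: 2; 1]%N u) = phi (n.+1 :: u).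
Proof.
rewrite /wcomp map_shift1 /= ev_fill_neq; last by rewrite /open_slot /widen /=; lia.
rewrite /open_slot eqxx fill_slot_last // muln0 scale1r cats0.
by congr (phi (_ :: _)); rewrite /widen /=; lia.
Qed.

Lemma wcomp_12 n u phi : letters n u -> ev phi (wcomp n 1 [:: 1; 2]%N u) = phi (rcons u n.+1).
Proof.
move=> lu; rewrite /wcomp map_shift1 /= {1}/open_slot eqxx fill_slot_last.
- rewrite /= muln0 scale1r cats1; congr (phi (rcons _ _)).
  by rewrite /open_slot /widen /=; lia.
- by move=> x /(allP lu) /= xn; rewrite inE /open_slot /widen /=; clear -xn; lia.
Qed.

End InsRelabel.

(** The left-hand side has the shape in which the induction step of dif_M produces
    the terms of the A-infinity relation. *)
Lemma triangle_sum (U : zmodType) (F : nat -> nat -> U) n : (2 <= n)%N ->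
  F 2 1 + F n n + \sum_(2 <= p < n) (\sum_(1 <= i < p.+1) F p.+1 i + F p p) =
  \sum_(2 <= p < n.+1) \sum_(1 <= i < p.+1) F p i.
Proof.
move=> n2; rewrite big_split /=.
have -> : \sum_(2 <= p < n) \sum_(1 <= i < p.+1) F p.+1 i =
   \sum_(3 <= p < n.+1) \sum_(1 <= i < p) F p i.
  by rewrite [RHS]big_add1.
have -> : \sum_(2 <= p < n.+1) \sum_(1 <= i < p.+1) F p i =
   \sum_(2 <= p < n.+1) \sum_(1 <= i < p) F p i + \sum_(2 <= p < n.+1) F p p.
  rewrite -big_split; apply: eq_big_nat => p /andP[p2 _].
  by rewrite big_nat_recr ?(ltnW p2).
have -> : \sum_(2 <= p < n.+1) \sum_(1 <= i < p) F p i =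
    F 2 1 + \sum_(3 <= p < n.+1) \sum_(1 <= i < p) F p i.
  by rewrite big_ltn ?ltnS // big_nat1.
have -> : \sum_(2 <= p < n.+1) F p p = \sum_(2 <= p < n) F p p + F n n.
  by rewrite big_nat_recr.
by rewrite !addrA (ACl (1*3*4*2)).
Qed.

Section Minf.
Variables (R : comNzRingType).
Local Notation A := {malg R[seq nat]}.
Implicit Types (a b c : A).

Fact M_key : unit. Proof. by []. Qed.

(** The image of the generator m_n. It is locked to keep conversion from unfolding
    the sum. *)
Definition M n : A := locked_with M_key (ev (word R) (cprime_list (n - 2))).

Lemma M_def n : M n = ev (word R) (cprime_list (n - 2)).
Proof. exact: locked_withE. Qed.

Definition cprimes n a := supp (is_cactus' n) a.

Lemma cprimes_cact n a : (2 <= n)%N -> cprimes n a -> cact n (n - 2) a.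
Proof. by move=> n2 ca w /ca /(cprimeP _ n2); exact: cprime_cactus. Qed.

Lemma cprimes_M n : (2 <= n)%N -> cprimes n (M n).
Proof.
move=> n2; rewrite /cprimes M_def; refine (supp_mk _) => w /outs_cprime_listP; have -> : (n - 2).+2 = n by clear -n2; lia.
by move/(cprimeP _ n2).
Qed.

Lemma M2 : M 2 = word R [:: 2; 1]%N + word R [:: 1; 2]%N.
Proof. by rewrite M_def /ev big_cons big_seq1 !scale1r. Qed.

Lemma MS n : (2 <= n)%N -> M n.+1 = (-1) ^+ n *: insert_top n (M n).
Proof.
move=> n2; rewrite /insert_top !M_def lin_ev; have -> : (n.+1 - 2 = (n - 2).+1)%N by clear -n2; lia.
rewrite /= /ev big_flatten big_map scaler_sumr; apply: eq_bigr => e _.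
rewrite big_map scalerA scaler_sumr; have -> : (n - 2).+2 = n by clear -n2; lia.
by apply: eq_bigr => f _ /=; rewrite scalerA !exprD.
Qed.

(** The boundary terms of del_ins are compositions with M 2 = 21 + 12: the new
    letter stands before or after the word, or beside its top letter n. *)
Lemma dif_insert_top n a : (2 <= n)%N -> cprimes n a ->
  dif (insert_top n a) = circ n 1 (M 2) a - circ 2 n a (M 2) - insert_top n (dif a).
Proof.
move=> n2 ca; rewrite [LHS]lin_insert_top M2 circDl linearD /=.
have circl1 p b : circ n 1 (word R p) b = lin (fun v => ev (word R) (wcomp n 1 p v)) b.
  by rewrite /circ lin_word.
have circr p : circ 2 n a (word R p) = lin (fun v => ev (word R) (wcomp 2 n v p)) a.
  by apply: eq_lin => v; rewrite lin_word.
rewrite !circl1 !circr [insert_top _ _]lin_dif -!linDf -!linBf; apply: eq_in_lin => v /ca /(cprimeP _ n2) cv.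
have [lv _ _ _ _] := cv.
rewrite wcomp_21 wcomp_12 // !wcomp_top2 //= del_ins //.
- have nv : n \in v by rewrite -has_pred1 has_count (cprime_count n2 cv).
  rewrite nv expr1 scaleN1r opprK /shift.
  have -> : (2 + n - 1 = n.+1)%N by clear -n2; lia.
  have -> : (1 + n - 1 = n)%N by clear -n2; lia.
  by congr (_ - _); apply: eq_del => // x; rewrite oppr0.
- by apply/negP => /(allP lv); rewrite ltnn andbF.
- by rewrite eqn_leq ltnn.
- by rewrite (cprime_count n2 cv).
Qed.

(** The top letter of the composite comes from a letter of a other than the slot,
    so that insertion acts on a. *)
Lemma insert_top_circ p q k i a b : (2 <= p)%N -> (0 < i < p)%N -> cprimes p a -> cact q k b ->
  insert_top (p + q - 1)%N (circ q i a b) = circ q i (insert_top p a) b.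
Proof.
move=> p2 /andP[i0 ip] ca cb; rewrite [LHS]lin_circ [RHS]lin_insert_top.
apply: eq_in_lin => v /ca /(cprimeP _ p2) cv; rewrite ev_lin.
apply: eq_in_lin => u /cb cu.
have [lv _ _ _ _] := cv; have lu := cactus_letters cu; have q0 := cactus_pos cu.
have inj_f := open_slot_inj q0 i0.
have vE x : x \in v -> (0 < x <= p)%N by move=> /(allP lv).
have uE x : x \in u -> (0 < x <= q)%N by move=> /(allP lu).
have yE : open_slot 0 q i p = (p + q - 1)%N by clear -ip; case_ifs.
have zE : open_slot 0 q i p.+1 = (p + q - 1).+1 by clear -ip q0; case_ifs.
rewrite /wcomp ins_fill; last first.
2-4: by apply/mapP => -[x /uE xu]; clear -xu i0 ip; case_ifs.
- move=> _ /mapP[x /uE xu ->]; apply/mapP => -[x' /vE xv].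
  by clear -xu xv i0; case_ifs.
- by apply/mapP => -[x /vE xv]; clear -xv i0 ip q0; case_ifs.
- by [].
- by clear -q0 p2; lia.
rewrite -zE -yE (ev_ins_map (S := posn)) //; last first.
- by move=> x /vE /andP[].
- by rewrite inE; clear -p2; lia.
Qed.

(** The top letter of the composite comes from b, so that insertion takes place
    either in a outside of the slot or in b. *)
Lemma insert_top_circ_top p q a b : (2 <= p)%N -> (2 <= q)%N -> cprimes p a -> cprimes q b ->
  insert_top (p + q - 1)%N (circ q p a b) =
  circ q p (insert_top p a) b + (-1) ^+ p *: circ q.+1 p a (insert_top q b).
Proof.
move=> p2 q2 ca cb; rewrite [LHS]lin_circ.
rewrite [X in _ = X + _]lin_insert_top.
rewrite -linZf -linDf.
apply: eq_in_lin => v /ca /(cprimeP _ p2) cv; rewrite ev_lin lin_insert_top -linZf -linDf.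
apply: eq_in_lin => u /cb /(cprimeP _ q2) cu.
have [lv _ _ _ _] := cv; have [lu _ _ _ _] := cu.
have p0 : (0 < p)%N by exact: leq_trans p2.
have q0 : (0 < q)%N by exact: leq_trans q2.
have inj_f := open_slot_inj q0 p0.
have vE x : x \in v -> (0 < x <= p)%N by move=> /(allP lv).
have uE x : x \in u -> (0 < x <= q)%N by move=> /(allP lu).
have tE : open_slot 0 q p p = 0%N by rewrite /open_slot eqxx.
have zE : open_slot 0 q p p.+1 = (p + q - 1).+1 by clear -q0; case_ifs.
have yE : shift p q = (p + q - 1)%N by rewrite /shift addnC.
have zE' : shift p q.+1 = (p + q - 1).+1 by rewrite /shift; clear -q0; lia.
have pv : p \in v by rewrite -has_pred1 has_count (cprime_count p2 cv).
have qu : q \in u by rewrite -has_pred1 has_count (cprime_count q2 cu).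
rewrite /wcomp ins_fill_top; last first.
- move=> _ /mapP[x /uE xu ->]; apply/mapP => -[x' /vE xv].
  by clear -xu xv p0; case_ifs.
- by apply/mapP => -[x /uE xu]; clear -xu p0; case_ifs.
- by clear -q0 p2; lia.
- by apply/mapP => -[x /uE xu]; clear -xu p0; case_ifs.
- by apply/mapP => -[x /vE xv]; clear -xv p0 q0; case_ifs.
- rewrite -yE count_map -(cprime_count q2 cu) leq_eqVlt; apply/orP; left; apply/eqP.
  apply: eq_in_count => x /uE xu /=.
  by rewrite (inj_eq (shift_inj p0)).
- by rewrite -yE map_f.
- rewrite count_map -(cprime_count p2 cv) leq_eqVlt; apply/orP; left; apply/eqP.
  by apply: eq_in_count => x /vE /andP[x0 _] /=; rewrite open_slot_eq0.
- by rewrite -{1}tE map_f.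
apply: (congr2 +%R).
  have -> : ins 0%N (p + q - 1).+1 (map (open_slot 0 q p) v) =
     ins (open_slot 0 q p p) (open_slot 0 q p p.+1) (map (open_slot 0 q p) v).
    by rewrite tE zE.
  by rewrite (ev_ins_map (S := posn)) // => x /vE /andP[].
have -> : deg (map (open_slot 0 q p) v) = deg v.
  by rewrite (deg_map (S := posn)) // => x /vE /andP[].
rewrite (cactus_deg (cprime_cactus p2 cv)).
have -> : (-1) ^+ (p - 2) = (-1) ^+ p :> R.
  by apply: sgn_eq; rewrite oddB // addbF.
congr (_ *: _); rewrite -zE' -yE (ev_ins_map (S := predT)) //; last first.
  by move=> x y _ _; exact: shift_inj.
apply: eq_ev => w /=; congr (ev _ (fill _ _ _)); apply/eq_in_map => x /vE xv.
by clear -xv; case_ifs.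
Qed.

Lemma difZ (c : R) a : dif (c *: a) = c *: dif a.
Proof. exact: (linearZ_LR (@dif R)). Qed.

Lemma insert_topZ n (c : R) a : insert_top n (c *: a) = c *: insert_top n a.
Proof. exact: (linearZ_LR (@insert_top R n)). Qed.

Lemma circZr n i (c : R) a b : circ n i a (c *: b) = c *: circ n i a b.
Proof. exact: (linearZ_LR (circ n i a)). Qed.

Definition Mterm n p i : A :=
  (-1) ^+ ((i - 1) + (n + 1 - p) * (p - i)) *: circ (n + 1 - p) i (M p) (M (n + 1 - p)).

Lemma dif_M2 : dif (M 2) = 0.
Proof.
by rewrite M2 linearD /= /dif !lin_word !del_cons_notin // !scale0r /del !addr0.
Qed.

(** Induction on n through M (n+1) = (-1)^n I (M n), where I anticommutes with the
    differential up to compositions with M 2. The latter give the terms with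
    p = 2, i = 1 and with p = i = n. The operator I sends M p o_i M q to a
    multiple of M (p+1) o_i M q if i < p. If i = p, it gives multiples of
    M (p+1) o_p M q and of M p o_p M (q+1). *)
Lemma dif_M n : (2 <= n)%N ->
  dif (M n) = \sum_(2 <= p < n) \sum_(1 <= i < p.+1) Mterm n p i.
Proof.
elim: n => // n IH n1; have [n2|n2] := leqP 2 n; last first.
  have -> : n.+1 = 2%N by clear -n1 n2; lia.
  by rewrite big_geq // dif_M2.
rewrite MS // difZ dif_insert_top //; last exact: cprimes_M.
rewrite IH //.
have bulk p : (2 <= p < n)%N ->
    - ((-1) ^+ n *: insert_top n (\sum_(1 <= i < p.+1) Mterm n p i)) =
    \sum_(1 <= i < p.+1) Mterm n.+1 p.+1 i + Mterm n.+1 p p.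
  case/andP=> p2 pn; pose q := (n + 1 - p)%N.
  have q2 : (2 <= q)%N by rewrite /q; clear -pn; lia.
  have nE : n = (p + q - 1)%N by rewrite /q; clear -pn; lia.
  have cp := cprimes_M p2; have cq := cprimes_M q2.
  have qE : (n.+1 + 1 - p.+1 = q)%N by rewrite /q; clear; lia.
  have qE' : (n.+1 + 1 - p = q.+1)%N by rewrite /q; clear -pn; lia.
  rewrite (linear_sum (@insert_top R n)) scaler_sumr -sumrN !big_nat_recr ?(ltnW p2) //=.
  rewrite -[RHS]addrA; apply: (congr2 +%R).
    apply: eq_big_nat => i /andP[i1 ip].
    rewrite /Mterm -/q qE insert_topZ [in RHS]MS // circZl -(insert_top_circ (k := q - 2)) //.
    - rewrite -nE -scaleN1r !scalerA -exprS -!exprD; congr (_ *: _); congr (_ ^+ _).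
      rewrite subSn ?(ltnW ip) // mulnS; move: (q * (p - i))%N => x.
      by rewrite [in LHS]nE; clear -p2; lia.
    - by rewrite i1.
    - exact: cprimes_cact.
  rewrite /Mterm -/q qE qE' insert_topZ.
  have -> : insert_top n (circ q p (M p) (M q)) = insert_top (p + q - 1)%N (circ q p (M p) (M q)).
    by rewrite -nE.
  rewrite insert_top_circ_top // [M p.+1]MS // [M q.+1]MS // circZl circZr.
  rewrite -scaleN1r !scalerA -exprS -exprD scalerDr !scalerA -!exprD.
  move: (circ q p _ _) (circ q.+1 p _ _) => X Y.
  apply: (congr2 +%R).
    congr (_ *: _); apply: sgn_eq; congr odd.
    by rewrite subSn // subnn muln0 muln1 [in LHS]nE; clear -p2; lia.
  congr (_ *: _); apply: sgn_eq; rewrite subnn !muln0.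
  have -> : (n.+1 + (p - 1 + 0) + p = (p - 1 + 0 + q) + p.*2)%N.
    by rewrite [in LHS]nE; clear -p2; lia.
  by rewrite oddD odd_double addbF.
have last_term : - ((-1) ^+ n *: circ 2 n (M n) (M 2)) = Mterm n.+1 n n.
  rewrite /Mterm (_ : (n.+1 + 1 - n = 2)%N); last by clear; lia.
  rewrite subnn muln0 addn0 -scaleN1r scalerA -exprS; congr (_ *: _); apply: sgn_eq.
  by rewrite subn1 /=; case: (n) n2 => //= m _; rewrite negbK.
have first_term : (-1) ^+ n *: circ n 1 (M 2) (M n) = Mterm n.+1 2 1.
  rewrite /Mterm (_ : (n.+1 + 1 - 2 = n)%N); last by clear; lia.
  by congr (_ *: _); congr (_ ^+ _); clear; lia.
apply: etrans (triangle_sum (Mterm n.+1) n2).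
rewrite -(eq_big_nat _ _ bulk).
rewrite -last_term.
rewrite -first_term.
rewrite sumrN -scaler_sumr -(linear_sum (@insert_top R n)).
by rewrite -scalerBr -scalerBr.
Qed.

End Minf.

(** * Trees *)

Notation tree := (GenTree.tree unit).
Notation leaf := (GenTree.Leaf tt).
Notation Node := (@GenTree.Node unit).

Section TreeCombinatorics.
Local Open Scope nat_scope.
Implicit Types (t s c : tree) (f g l r : seq tree).

Lemma tree_nested_ind (P : tree -> Prop) : P leaf ->
  (forall n f, {in f, forall c, P c} -> P (Node n f)) -> forall t, P t.
Proof.
move=> Pl Pn; fix IH 1 => -[[]|n f]; first exact: Pl.
apply: Pn; elim: f => [|c f IHf] d; first by rewrite in_nil; discriminate.
by rewrite inE => /orP[/eqP->|]; [exact: IH | exact: IHf].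
Qed.

Definition leavess f := sumn (map leaves f).
Definition tdegs f := sumn (map tdeg f).

Section GraftForest.
Variable s : tree.
Fixpoint graft_forest f i : seq tree :=
  if f is c :: f' then
    if i <= leaves c then graft s c i :: f'
    else c :: graft_forest f' (i - leaves c)
  else [::].
End GraftForest.

Fixpoint after_forest f i : nat :=
  if f is c :: f' then
    if i <= leaves c then tdeg_after c i + tdegs f'
    else after_forest f' (i - leaves c)
  else 0.

(** The local fixpoint of tree_diff carries along the trees further left. Here
    their degrees are added on the way back. *)
Fixpoint forest_diff f : seq (nat * seq tree) :=
  if f is c :: f' then
    [seq (e.1, e.2 :: f') | e <- tree_diff c] ++
    [seq (tdeg c + e.1, c :: e.2) | e <- forest_diff f']
  else [::].

Lemma graft_node s n f i : graft s (Node n f) i = Node n (graft_forest s f i).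
Proof. by []. Qed.

Lemma tdeg_after_node n f i : tdeg_after (Node n f) i = after_forest f i.
Proof. by []. Qed.

Lemma tree_diff_node n f : tree_diff (Node n f) =
  root_diff n f ++ [seq (n - 2 + e.1, Node n e.2) | e <- forest_diff f].
Proof.
rewrite [LHS]/=; congr (_ ++ _).
have gen fd : (forall l, fd l [::] = [::]) ->
    (forall l c r, fd l (c :: r) =
       [seq (n - 2 + sumn (map tdeg l) + x.1, Node n (l ++ x.2 :: r)) | x <- tree_diff c]
       ++ fd (rcons l c) r) ->
    fd [::] f = [seq (n - 2 + e.1, Node n e.2) | e <- forest_diff f]; last by apply: gen.
move=> fd0 fdS.
suff H l r : fd l r = [seq (n - 2 + tdegs l + e.1, Node n (l ++ e.2)) | e <- forest_diff r].
  by rewrite H; apply: eq_map => e; rewrite addn0.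
elim: r l => [|c r IH] l; first by rewrite fd0.
rewrite fdS [forest_diff _]/= IH map_cat -!map_comp; congr (_ ++ _).
by apply: eq_map => e /=; rewrite /tdegs map_rcons sumn_rcons cat_rcons !addnA.
Qed.

Lemma wf_tree_node n f : wf_tree (Node n f) = [&& 1 < n, size f == n & all wf_tree f].
Proof. by []. Qed.

Lemma leaves_gt0 t : wf_tree t -> 0 < leaves t.
Proof.
elim/tree_nested_ind: t => // n f IH; rewrite wf_tree_node => /and3P[n1 /eqP sf wf].
case: f sf IH wf n1 => [<-//|c f] _ IH /= /andP[wc _] _.
by rewrite addn_gt0 IH ?mem_head.
Qed.

Lemma leavess_size f : all wf_tree f -> size f <= leavess f.
Proof.
rewrite /leavess; elim: f => //= c f IH /andP[/leaves_gt0 c0 /IH].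
by clear -c0; lia.
Qed.

Lemma leavess_cat f g : leavess (f ++ g) = leavess f + leavess g.
Proof. by rewrite /leavess map_cat sumn_cat. Qed.
Lemma tdegs_cat f g : tdegs (f ++ g) = tdegs f + tdegs g.
Proof. by rewrite /tdegs map_cat sumn_cat. Qed.

Lemma graft_forest_invs s f i : 0 < i <= leavess f ->
  {in f, forall c, forall j, wf_tree c -> 0 < j <= leaves c ->
     [/\ wf_tree (graft s c j), leaves (graft s c j) = leaves c + leaves s - 1 &
         tdeg (graft s c j) = tdeg c + tdeg s]} -> all wf_tree f -> 0 < leaves s ->
  [/\ all wf_tree (graft_forest s f i), size (graft_forest s f i) = size f,
      leavess (graft_forest s f i) = leavess f + leaves s - 1 &
      tdegs (graft_forest s f i) = tdegs f + tdeg s].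
Proof.
elim: f i => [|c f IH] i; first by rewrite /leavess /=; case: i.
rewrite /leavess /tdegs /= => /andP[i0 ic] inv /andP[wc wf] s0.
have c0 := leaves_gt0 wc.
case: ifP => ilc.
  have [|gw gl gd] := inv c (mem_head _ _) i wc; first by rewrite i0.
  rewrite /= gw gl gd wf; split=> //; last by clear; lia.
  by clear -c0 s0; lia.
have [|c' c'f|||gw gs gl gd] := IH (i - leaves c) => //.
- by rewrite /leavess; clear -ic ilc; lia.
- by apply: inv; rewrite inE c'f orbT.
rewrite /leavess /tdegs /= in gl gd *; rewrite wc gw gs gl gd; split=> //; last by clear; lia.
have := leavess_size wf; rewrite /leavess.
by move: (sumn _) => N; clear -s0 ic ilc; lia.
Qed.

Lemma graft_inv s t i : wf_tree s -> wf_tree t -> 0 < i <= leaves t ->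
  [/\ wf_tree (graft s t i), leaves (graft s t i) = leaves t + leaves s - 1 &
      tdeg (graft s t i) = tdeg t + tdeg s].
Proof.
move=> ws; elim/tree_nested_ind: t i => [|n f IH] i wt it.
  by rewrite /= add1n subn1.
move: wt; rewrite wf_tree_node => /and3P[n1 sf wf].
have [|gw gs gl gd] := @graft_forest_invs s f i it _ wf (leaves_gt0 ws).
  by move=> c cf j wc jc; exact: IH.
rewrite graft_node wf_tree_node n1 gs sf gw; split=> //.
by rewrite [LHS]/= -/(tdegs _) gd addnA.
Qed.

Definition drops t t' := [/\ wf_tree t', leaves t' = leaves t & (tdeg t').+1 = tdeg t].

Lemma forest_diff_invs f g : all wf_tree f ->
  {in f, forall c c', c' \in [seq e.2 | e <- tree_diff c] -> drops c c'} ->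
  g \in [seq e.2 | e <- forest_diff f] ->
  [/\ all wf_tree g, size g = size f, leavess g = leavess f & (tdegs g).+1 = tdegs f].
Proof.
elim: f g => // c f IH g /= /andP[wc wf] inv.
rewrite map_cat mem_cat -!map_comp => /orP[/mapP[e ec ->]|/mapP[e ef ->]] /=.
  have [|w' l' d'] := inv c (mem_head _ _) e.2; first exact: map_f.
  by rewrite /leavess /tdegs /= w' wf l' -d'.
have [c' c'f||w' s' l' d'] := IH e.2 wf.
- by move=> x; apply: inv; rewrite inE c'f orbT.
- exact: map_f.
rewrite /leavess /tdegs /= in l' d' *; rewrite wc w' s' l' -d'; split=> //.
by rewrite addnS.
Qed.

Definition root_term n f p i : nat * tree :=
  let q := n + 1 - p in
  ((i - 1) + q * (p - i) + (q - 2) * tdegs (take (i - 1) f),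
   Node p (take (i - 1) f ++ Node q (take q (drop (i - 1) f)) :: drop (i - 1 + q) f)).

Lemma root_diffE n f : root_diff n f =
  [seq root_term n f p i | p <- index_iota 2 n, i <- iota 1 p].
Proof. by []. Qed.

Lemma root_termP n f p i : size f = n -> 1 < p < n -> 0 < i <= p ->
  let q := n + 1 - p in exists l g r,
  [/\ f = l ++ g ++ r, size l = i - 1, size g = q, size r = p - i &
   root_term n f p i =
     ((i - 1) + q * (p - i) + (q - 2) * tdegs l, Node p (l ++ Node q g :: r))].
Proof.
move=> sf pn ip q; exists (take (i - 1) f), (take q (drop (i - 1) f)), (drop (i - 1 + q) f).
have qE : i - 1 + q <= size f by rewrite sf /q; clear -pn ip; lia.
split=> //.
- by rewrite -{1}(cat_take_drop (i - 1) f) -{1}(cat_take_drop q (drop (i - 1) f)) drop_drop (addnC q).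
- by rewrite size_takel //; clear -qE; lia.
- by rewrite size_takel // size_drop; clear -qE; lia.
- by rewrite size_drop sf /q; clear -pn ip; lia.
Qed.

Lemma root_term_drops n f p i : 1 < n -> size f = n -> all wf_tree f ->
  1 < p < n -> 0 < i <= p -> drops (Node n f) (root_term n f p i).2.
Proof.
move=> n1 sf wf pn ip; have [l [g [r [fE sl sg sr ->]]]] := root_termP sf pn ip.
set q := n + 1 - p in sg *.
have q2 : 1 < q by rewrite /q; clear -pn; lia.
have := wf; rewrite {1}fE !all_cat => /and3P[wl wg wr].
split.
- rewrite wf_tree_node all_cat [all wf_tree (_ :: _)]/= -/(wf_tree (Node q g)) wf_tree_node.
  rewrite wl wg wr sg eqxx q2 size_cat /= sl sr.
  have [-> _] := andP pn; rewrite /= !andbT; apply/eqP.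
  by clear -pn ip; lia.
- by rewrite -[LHS]/(leavess _) -[RHS]/(leavess _) fE !leavess_cat.
- rewrite -[tdeg (Node p _)]/(p - 2 + tdegs _) -[RHS]/(n - 2 + tdegs f) fE !tdegs_cat.
  have -> : tdegs (Node q g :: r) = q - 2 + tdegs g + tdegs r by [].
  by rewrite /q; clear -pn q2; lia.
Qed.

Lemma tree_diff_drops t t' : wf_tree t -> t' \in [seq e.2 | e <- tree_diff t] -> drops t t'.
Proof.
elim/tree_nested_ind: t t' => // n f IH t' wt; have := wt.
rewrite wf_tree_node => /and3P[n1 /eqP sf wf].
rewrite tree_diff_node map_cat mem_cat => /orP[/mapP[e]|].
  rewrite root_diffE => /allpairsPdep[p [i [pn ip ->]]] ->.
  by apply: root_term_drops => //; [move: pn; rewrite mem_index_iota | move: ip; rewrite mem_iota add1n ltnS].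
rewrite -map_comp => /mapP[e ef ->] /=.
have [||w' s' l' d'] := @forest_diff_invs f e.2 wf.
- by move=> c cf c' cc'; apply: IH => //; exact: (allP wf).
- exact: map_f.
split; first by rewrite wf_tree_node n1 s' sf eqxx.
- exact: l'.
- by rewrite -[LHS]/(n - 2 + tdegs _).+1 -addnS d'.
Qed.

End TreeCombinatorics.

(** * Evaluation of trees in an operad *)

Section TreeMap.
(** An operad is given by a single module A, in which cact n k holds of the
    elements of arity n and degree k. Only the axioms of an operad and the
    A-infinity relation for M are used, so that the results hold for any
    realization of the generators; they express that the operad of trees is
    free. *)
Variables (R : comNzRingType) (A : lmodType R) (one : A) (circ : nat -> nat -> A -> A -> A).
Variables (cact : nat -> nat -> A -> Prop) (M : nat -> A).
Hypothesis cactZ : forall n k (a : R) x, cact n k x -> cact n k (a *: x).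
Hypothesis circDl : forall n i x x' y, circ n i (x + x') y = circ n i x y + circ n i x' y.
Hypothesis circDr : forall n i x y y', circ n i x (y + y') = circ n i x y + circ n i x y'.
Hypothesis circZl : forall n i (a : R) x y, circ n i (a *: x) y = a *: circ n i x y.
Hypothesis circZr : forall n i (a : R) x y, circ n i x (a *: y) = a *: circ n i x y.
Hypothesis cact_one : cact 1 0 one.
Hypothesis cact_circ : forall m n k l i a b, (0 < i <= m)%N -> cact m k a -> cact n l b ->
  cact (n + m - 1) (k + l) (circ n i a b).
Hypothesis cact_M : forall n, (2 <= n)%N -> cact n (n - 2) (M n).
Hypothesis circ_nested : forall m n l k1 k2 k3 i j a b c,
  (0 < i <= m)%N -> (0 < j <= n)%N -> cact m k1 a -> cact n k2 b -> cact l k3 c ->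
  circ l (i + j - 1) (circ n i a b) c = circ (n + l - 1) i a (circ l j b c).
Hypothesis circ_parallel : forall m n l k1 k2 k3 i j a b c,
  (0 < j)%N -> (j < i <= m)%N -> cact m k1 a -> cact n k2 b -> cact l k3 c ->
  circ l j (circ n i a b) c = (-1) ^+ (k2 * k3) *: circ n (i + l - 1) (circ l j a c) b.
Hypothesis circ_unitr : forall n k i a, (0 < i)%N -> cact n k a -> circ 1 i a one = a.
Hypothesis circ_unitl : forall n b, circ n 1 one b = b.

Lemma sum_circl n i (I : Type) (s : seq I) (F : I -> A) y :
  circ n i (\sum_(j <- s) F j) y = \sum_(j <- s) circ n i (F j) y.
Proof.
apply: (big_morph (fun x => circ n i x y)) => [x x'|]; first exact: circDl.
by rewrite -[X in circ _ _ X _](scale0r 0) circZl scale0r.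
Qed.

Lemma circ_evr n i (T : Type) (F : T -> A) s x :
  circ n i x (ev F s) = ev (fun u => circ n i x (F u)) s.
Proof.
rewrite /ev (big_morph (circ n i x) (id1 := 0) (op1 := +%R)).
- by apply: eq_bigr => u _; rewrite circZr.
- exact: circDr.
- by rewrite -[X in circ _ _ _ X](scale0r 0) circZr scale0r.
Qed.

Implicit Types (x y : A) (t s c : tree) (f g l r : seq tree).

Section Forest.
Variable tm : tree -> A.

(** The trees are grafted from the last one to the first, so that the slots that
    are still free keep their numbers. The sign restores the order in which a
    tree lists its vertices. *)
Fixpoint graft_all i x f : A :=
  if f is c :: f' then
    (-1) ^+ (tdeg c * tdegs f') *: circ (leaves c) i (graft_all i.+1 x f') (tm c)
  else x.
End Forest.

Fixpoint tmap t : A :=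
  if t is GenTree.Node n f then graft_all tmap 1 (M n) f else one.

Local Notation cforest := (graft_all tmap).
Arguments tmap : simpl never.

Lemma tmap_node n f : tmap (Node n f) = cforest 1 (M n) f.
Proof. by []. Qed.

Lemma cforest_cons i x c f : cforest i x (c :: f) =
  (-1) ^+ (tdeg c * tdegs f) *: circ (leaves c) i (cforest i.+1 x f) (tmap c).
Proof. by []. Qed.

Lemma cact_cforest m k i x f : (0 < i)%N -> (i + size f <= m.+1)%N ->
  all wf_tree f -> {in f, forall c, wf_tree c -> cact (leaves c) (tdeg c) (tmap c)} ->
  cact m k x -> cact (m + leavess f - size f) (k + tdegs f) (cforest i x f).
Proof.
elim: f i => [|c f IH] i i0 im wf cc cx.
  by rewrite /leavess /tdegs /= !addn0 subn0.
case/andP: wf => wc wf; have c0 := leaves_gt0 wc; have lf := leavess_size wf.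
have cf : cact (m + leavess f - size f) (k + tdegs f) (cforest i.+1 x f).
  apply: IH => //; first by rewrite addSnnS.
  by move=> d df; apply: cc; rewrite inE df orbT.
rewrite cforest_cons; apply: cactZ.
have -> : (m + leavess (c :: f) - size (c :: f) = leaves c + (m + leavess f - size f) - 1)%N.
  by rewrite /leavess /=; rewrite /leavess in lf; move: lf im; rewrite /=; clear; lia.
have -> : (k + tdegs (c :: f) = (k + tdegs f) + tdeg c)%N.
  by rewrite /tdegs /=; clear; lia.
apply: cact_circ => //; last by apply: cc; rewrite ?mem_head.
by move: im lf; rewrite i0 /=; clear; lia.
Qed.

Lemma cact_tmap t : wf_tree t -> cact (leaves t) (tdeg t) (tmap t).
Proof.
elim/tree_nested_ind: t => [_|n f IH].
  by exact: cact_one.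
rewrite wf_tree_node => /and3P[n1 /eqP sf wf]; rewrite tmap_node.
have -> : leaves (Node n f) = (n + leavess f - size f)%N.
  by rewrite sf addKn.
apply: cact_cforest => //; [by rewrite add1n sf | exact: cact_M].
Qed.

Lemma cact_forest m k i x f : (0 < i)%N -> (i + size f <= m.+1)%N ->
  all wf_tree f -> cact m k x ->
  cact (m + leavess f - size f) (k + tdegs f) (cforest i x f).
Proof. by move=> i0 im wf cx; apply: cact_cforest => // c cf; exact: cact_tmap. Qed.

Lemma cforestZ i (a : R) x f : cforest i (a *: x) f = a *: cforest i x f.
Proof.
elim: f i => //= c f IH i; rewrite IH circZl !scalerA; congr (_ *: _).
by rewrite mulrC.
Qed.

Lemma cforest_sum i (I : Type) (s : seq I) (F : I -> A) f :
  cforest i (\sum_(j <- s) F j) f = \sum_(j <- s) cforest i (F j) f.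
Proof.
by elim: f i => //= c f IH i; rewrite IH sum_circl scaler_sumr.
Qed.

Lemma cforest_cat i x f g :
  cforest i x (f ++ g) = (-1) ^+ (tdegs f * tdegs g) *: cforest i (cforest (i + size f) x g) f.
Proof.
elim: f i => [|c f IH] i; first by rewrite /= addn0 scale1r.
rewrite cat_cons !cforest_cons IH circZl !scalerA -!exprD tdegs_cat -addSnnS; congr (_ *: _).
by apply: sgn_eq; congr odd; rewrite /tdegs /=; ring.
Qed.

Lemma circ_cforest m k1 q k2 i j x y f : (0 < i <= m)%N -> (0 < j)%N -> (j + size f <= q.+1)%N ->
  cact m k1 x -> cact q k2 y -> all wf_tree f ->
  circ (q + leavess f - size f) i x (cforest j y f) = cforest (i + j - 1) (circ q i x y) f.
Proof.
move=> im; elim: f j => [|c f IH] j j0 jq cx cy wf; first by rewrite /leavess /= addn0 subn0.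
case/andP: wf => wc wf; have c0 := leaves_gt0 wc; have lf := leavess_size wf.
rewrite !cforest_cons circZr; congr (_ *: _).
have jq' : (j.+1 + size f <= q.+1)%N by rewrite addSnnS.
have -> : (q + leavess (c :: f) - size (c :: f) = (q + leavess f - size f) + leaves c - 1)%N.
  by move: jq' lf c0; rewrite /leavess /=; clear; lia.
have cf := cact_forest (isT : (0 < j.+1)%N) jq' wf cy.
rewrite -(circ_nested im _ cx cf (cact_tmap wc)); last first.
  by move: jq' lf j0; clear; lia.
rewrite IH //; congr (circ _ _ (cforest _ _ _) _).
by move: im; clear; lia.
Qed.

(** By the parallel axiom for each tree; y moves past the whole forest. *)
Lemma circ_left_of_forest m k1 q k2 i j x y f : (0 < i < j)%N -> (j + size f <= m.+1)%N ->
  cact m k1 x -> cact q k2 y -> all wf_tree f ->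
  circ q i (cforest j x f) y =
  (-1) ^+ (k2 * tdegs f) *: cforest (j + q - 1) (circ q i x y) f.
Proof.
elim: f j => [|c f IH] j ij jm cx cy wf; first by rewrite muln0 scale1r.
case/andP: wf => wc wf; have c0 := leaves_gt0 wc; have lf := leavess_size wf.
have jm' : (j.+1 + size f <= m.+1)%N by rewrite addSnnS.
have cf := cact_forest (isT : (0 < j.+1)%N) jm' wf cx.
rewrite !cforest_cons circZl.
rewrite (circ_parallel _ _ cf (cact_tmap wc) cy); last 2 first.
- by case/andP: ij.
- by case/andP: ij => _ -> /=; move: jm' lf; clear; lia.
rewrite IH //; last by case/andP: ij => -> /= ; exact: ltnW.
rewrite circZl !scalerA -!exprD.
have -> : (j.+1 + q - 1 = (j + q - 1).+1)%N by move: ij; clear; lia.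
congr (_ *: _); apply: sgn_eq; congr odd; rewrite /tdegs /=; ring.
Qed.

(** The composite of M q with g is turned into one of x with M q, by the
    sequential axiom, and then M q moves to the left past the trees of l. This is the sign that
    the differential of a tree attaches to a split root. *)
Lemma cforest_node m k i x l q g r : (2 <= q)%N -> (0 < i)%N -> cact m k x ->
  all wf_tree (l ++ g ++ r) -> size g = q -> (i + size l + size r <= m)%N ->
  cforest i x (l ++ Node q g :: r) =
  (-1) ^+ ((q - 2) * tdegs l) *: cforest i (circ q (i + size l) x (M q)) (l ++ g ++ r).
Proof.
move=> q2; elim: l i => [|c l IH] i i0 cx wf sg im.
  move: wf; rewrite cat0s all_cat => /andP[wg wr]; rewrite muln0 scale1r addn0.
  rewrite [_ ++ _ :: _]/= cforest_cons tmap_node.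
  have im' : (i.+1 + size r <= m.+1)%N by move: im; rewrite addn0; clear; lia.
  have lr := leavess_size wr; have lg := leavess_size wg.
  have cr := cact_forest (isT : (0 < i.+1)%N) im' wr cx.
  have cM := cact_M q2.
  have -> : leaves (Node q g) = (q + leavess g - size g)%N by rewrite sg addKn.
  rewrite (circ_cforest _ _ _ cr cM wg) //; last 2 first.
  - by rewrite i0 /=; move: im' lr; clear; lia.
  - by rewrite add1n sg.
  rewrite (circ_left_of_forest _ im' cx cM wr); last by rewrite i0 ltnSn.
  rewrite cforest_cat sg cforestZ scalerA -exprD.
  have -> : (i.+1 + q - 1 = i + q)%N by clear; lia.
  rewrite addnK; congr (_ *: _); apply: sgn_eq.
  have -> : tdeg (Node q g) = (q - 2 + tdegs g)%N by [].
  rewrite mulnDl addnAC addnn oddD odd_double //.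
case/andP: wf => wc wf; rewrite !cat_cons !cforest_cons IH //; last first.
  by move: im => /=; clear; lia.
rewrite circZl !scalerA -!exprD -addSnnS; congr (_ *: _); apply: sgn_eq.
rewrite !tdegs_cat.
have -> : tdegs (Node q g :: r) = (q - 2 + tdegs g + tdegs r)%N by [].
have -> : tdegs (c :: l) = (tdeg c + tdegs l)%N by [].
rewrite !(oddD, oddM).
by case: (odd (tdeg c)); case: (odd (q - 2)); case: (odd (tdegs l)); case: (odd (tdegs g)); case: (odd (tdegs r)).
Qed.

(** At the tree that contains the leaf this is the sequential axiom. At a tree
    further left it is the parallel axiom, whose sign cancels with the change
    that s causes in the sign of graft_all. *)
Lemma cforest_graft m k i x f s j : (0 < i)%N -> (i + size f <= m.+1)%N -> cact m k x ->
  all wf_tree f -> wf_tree s -> (0 < j <= leavess f)%N ->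
  {in f, forall c j, wf_tree c -> (0 < j <= leaves c)%N ->
     tmap (graft s c j) = (-1) ^+ (tdeg s * tdeg_after c j) *: circ (leaves s) j (tmap c) (tmap s)} ->
  cforest i x (graft_forest s f j) =
  (-1) ^+ (tdeg s * after_forest f j) *: circ (leaves s) (i + j - 1) (cforest i x f) (tmap s).
Proof.
elim: f i j => [|c f IH] i j i0 im cx wf ws; first by rewrite /leavess /=; case: j.
case/andP: wf => wc wf; have c0 := leaves_gt0 wc; have lf := leavess_size wf.
have im' : (i.+1 + size f <= m.+1)%N by rewrite addSnnS.
have cf := cact_forest (isT : (0 < i.+1)%N) im' wf cx.
have ifm : (0 < i <= m + leavess f - size f)%N.
  by rewrite i0; move: im' lf; clear; lia.
have cc := cact_tmap wc; have cs := cact_tmap ws.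
rewrite {1}/leavess /= -/(leavess f) => /andP[j0 jc] IHs.
case: ifP => jlc.
  have jc' : (0 < j <= leaves c)%N by rewrite j0.
  have [gw gl gd] := graft_inv ws wc jc'.
  rewrite !cforest_cons gl gd IHs ?mem_head // circZr circZl (circ_nested ifm jc' cf cc cs).
  rewrite !scalerA -!exprD; congr (_ *: _); apply: sgn_eq; congr odd; ring.
rewrite !cforest_cons IH //; last 2 first.
- by move: jc jlc; clear; lia.
- by move=> d df; apply: IHs; rewrite inE df orbT.
have E := @circ_parallel _ _ _ _ _ _ (i.+1 + (j - leaves c) - 1) i _ _ _ i0 _ cf cs cc.
have jE : (i.+1 + (j - leaves c) - 1 + leaves c - 1 = i + j - 1)%N.
  by move: jlc c0 i0 j0; clear; lia.
rewrite circZl E ?jE; last first.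
  by move: jlc jc im' lf i0; clear; lia.
rewrite circZl !scalerA -!exprD; congr (_ *: _); apply: sgn_eq.
have [_ _ _ ->] : [/\ true, true, true & tdegs (graft_forest s f (j - leaves c)) = (tdegs f + tdeg s)%N].
  have [|d df k' wd kd|_ _ _ ->] := @graft_forest_invs s f (j - leaves c) _ _ wf (leaves_gt0 ws) => //.
  - by move: jc jlc; clear; lia.
  - exact: graft_inv.
rewrite !(oddD, oddM).
by case: (odd (tdeg c)); case: (odd (tdegs f)); case: (odd (tdeg s)); case: (odd (after_forest f _)).
Qed.

Lemma tmap_graft s t i : wf_tree s -> wf_tree t -> (0 < i <= leaves t)%N ->
  tmap (graft s t i) =
  (-1) ^+ (tdeg s * tdeg_after t i) *: circ (leaves s) i (tmap t) (tmap s).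
Proof.
move=> ws; elim/tree_nested_ind: t i => [|n f IH] i.
  by case: i => [|[|i]] // _ _; rewrite muln0 scale1r circ_unitl.
rewrite wf_tree_node => /and3P[n1 /eqP sf wf] il; rewrite graft_node tdeg_after_node !tmap_node.
rewrite (cforest_graft _ _ (cact_M n1)) ?add1n ?subn1 ?sf //.
Qed.

Variable dif : A -> A.
Hypothesis difZ : forall (a : R) x, dif (a *: x) = a *: dif x.
Hypothesis dif_one : dif one = 0.
Hypothesis circ_dif : forall (m n k l i : nat) (a b : A),
  (0 < i <= m)%N -> cact m k a -> cact n l b ->
  dif (circ n i a b) = circ n i (dif a) b + (-1) ^+ k *: circ n i a (dif b).
Hypothesis dif_M : forall n, (2 <= n)%N ->
  dif (M n) = \sum_(2 <= p < n) \sum_(1 <= i < p.+1)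
    (-1) ^+ ((i - 1) + (n + 1 - p) * (p - i)) *: circ (n + 1 - p) i (M p) (M (n + 1 - p)).

Lemma ev_shift (T U : Type) k (f : T -> U) (phi : U -> A) (s : seq (nat * T)) :
  ev phi [seq (k + e.1, f e.2)%N | e <- s] = (-1) ^+ k *: ev (phi \o f) s.
Proof.
rewrite /ev big_map scaler_sumr; apply: eq_bigr => e _.
by rewrite scalerA -exprD.
Qed.

Lemma cforest_dif m k i x f : (0 < i)%N -> (i + size f <= m.+1)%N -> cact m k x ->
  all wf_tree f ->
  {in f, forall c, wf_tree c -> ev tmap (tree_diff c) = dif (tmap c)} ->
  dif (cforest i x f) = cforest i (dif x) f + (-1) ^+ k *: ev (cforest i x) (forest_diff f).
Proof.
elim: f i => [|c f IH] i i0 im cx wf; first by rewrite /ev big_nil scaler0 addr0.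
case/andP: wf => wc wf IHd; have c0 := leaves_gt0 wc; have lf := leavess_size wf.
have im' : (i.+1 + size f <= m.+1)%N by rewrite addSnnS.
have cf := cact_forest (isT : (0 < i.+1)%N) im' wf cx.
have ifm : (0 < i <= m + leavess f - size f)%N.
  by rewrite i0; move: im' lf; clear; lia.
rewrite cforest_cons difZ (circ_dif ifm cf (cact_tmap wc)) IH //; last first.
  by move=> d df; apply: IHd; rewrite inE df orbT.
rewrite -(IHd c (mem_head _ _) wc) circDl circZl circ_evr !scalerDr -addrA; congr (_ + _).
rewrite [forest_diff _]/= ev_cat (ev_map (fun c' => c' :: f)) (ev_shift (tdeg c) (cons c)) scalerDr addrC; congr (_ + _).
  rewrite !scalerA -!exprD -!evZ; apply: eq_in_ev => c' cc'.
  have [_ l' d'] := tree_diff_drops wc cc'.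
  rewrite -[(_ \o _) c']/(cforest i x (c' :: f)) cforest_cons l' !scalerA -!exprD; congr (_ *: _); apply: sgn_eq.
  rewrite -d' !(oddD, oddM, oddS).
  by case: (odd (tdeg c')); case: (odd (tdegs f)); case: (odd k).
rewrite !scalerA -!exprD.
rewrite /ev scaler_sumr sum_circl scaler_sumr; apply: eq_big_seq => e ef.
have [|_ _ _ d'] := @forest_diff_invs f e.2 wf _ (map_f _ ef).
  by move=> d df d' dd'; apply: tree_diff_drops => //; exact: (allP wf).
rewrite -[(_ \o _) e.2]/(cforest i x (c :: e.2)) circZl cforest_cons !scalerA -!exprD; congr (_ *: _); apply: sgn_eq.
rewrite -d' !(oddD, oddM, oddS).
by case: (odd (tdeg c)); case: (odd (tdegs e.2)); case: (odd k); case: (odd e.1).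
Qed.

(** The differential of a tree at its root is that of M n, by cforest_node. *)
Lemma ev_root_diff n f : (1 < n)%N -> size f = n -> all wf_tree f ->
  ev tmap (root_diff n f) = cforest 1 (dif (M n)) f.
Proof.
move=> n1 sf wf; rewrite dif_M // cforest_sum root_diffE /ev big_allpairs_dep.
apply: eq_big_seq => p; rewrite mem_index_iota => pn.
rewrite cforest_sum /index_iota subn1; apply: eq_big_seq => i.
rewrite mem_iota add1n ltnS => ip; rewrite cforestZ.
have [l [g [r [fE sl sg sr ->]]]] := root_termP sf pn ip.
set q := (n + 1 - p)%N in sg *; have [p2 _] := andP pn.
have q2 : (1 < q)%N by rewrite /q; clear -pn; lia.
rewrite [fst _]/= [snd _]/= tmap_node (cforest_node q2 _ (cact_M p2) _ sg) -?fE //; last first.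
  by rewrite sl sr; clear -ip; lia.
have -> : (1 + size l = i)%N by rewrite sl; clear -ip; lia.
rewrite scalerA -exprD; congr (_ *: _); apply: sgn_eq.
by rewrite -addnA addnn oddD odd_double addbF.
Qed.

Lemma tmap_dif t : wf_tree t -> ev tmap (tree_diff t) = dif (tmap t).
Proof.
elim/tree_nested_ind: t => [_|n f IH]; first by rewrite /ev big_nil dif_one.
rewrite wf_tree_node => /and3P[n1 /eqP sf wf].
rewrite tree_diff_node ev_cat (ev_shift (n - 2) (Node n)) ev_root_diff // tmap_node.
by rewrite (cforest_dif _ _ (cact_M n1)) ?add1n ?sf.
Qed.

Lemma cforest_leaves n k i x m : (0 < i)%N -> cact m k x -> cforest i x (nseq n leaf) = x.
Proof.
elim: n i => // n IH i i0 cx; rewrite cforest_cons IH // mul0n scale1r.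
exact: circ_unitr cx.
Qed.

Lemma tmap_corolla n : (2 <= n)%N -> tmap (corolla n) = M n.
Proof. by move=> n2; apply: cforest_leaves (cact_M n2). Qed.

End TreeMap.

(** * The morphism *)

Section Proj.
Variables (R : comNzRingType) (T : choiceType).
Implicit Types (P Q : pred T) (V : lmodType R).

(** From all words to the free module on the words with P. Every element to which
    it is applied below is supported in P, so that nothing is lost. *)
Definition proj P (b : {malg R[T]}) : {malg R[{y : T | P y}]} := lin (gen R P) b.

Lemma genE P (x : {y : T | P y}) : gen R P (val x) = << x >>.
Proof. by rewrite /gen valK. Qed.

Lemma lin_gen P V (F : T -> V) x : P x ->
  lin (fun y : {y : T | P y} => F (val y)) (gen R P x) = F x.
Proof. by move=> Px; rewrite -[x]/(val (exist _ x Px)) genE linU. Qed.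

Lemma lin_proj P V (F : T -> V) b : supp P b ->
  lin (fun y : {y : T | P y} => F (val y)) (proj P b) = lin F b.
Proof.
move=> Pb; rewrite (linear_lin (lin _)); apply: eq_in_lin => x /Pb Px /=.
exact: lin_gen.
Qed.

Lemma proj_supp P Q b : supp Q b -> supp (fun y : {y : T | P y} => Q (val y)) (proj P b).
Proof.
move=> Qb; refine (supp_lin _) => x /Qb Qx; rewrite /gen.
case: insubP => [y _ yx|_]; last exact: supp0.
by refine (suppU _); rewrite yx.
Qed.

Lemma bilin_extE P1 P2 Q f (a : {malg R[{y : T | P1 y}]}) (b : {malg R[{y : T | P2 y}]}) :
  bilin_ext Q f a b = lin (fun x => lin (fun y => ev (gen R Q) (f (val x) (val y))) b) a.
Proof.
apply: eq_bigr => x _; rewrite scaler_sumr; apply: eq_bigr => y _.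
by rewrite scalerA.
Qed.

Lemma bilin_ext_proj P1 P2 Q f (a b : {malg R[T]}) : supp P1 a -> supp P2 b ->
  bilin_ext Q f (proj P1 a) (proj P2 b) = lin (fun x => lin (fun y => ev (gen R Q) (f x y)) b) a.
Proof.
move=> Pa Pb; rewrite bilin_extE.
rewrite (lin_proj (fun x => lin (fun y => ev (gen R Q) (f x (val y))) (proj P2 b)) Pa).
by apply: eq_lin => x; rewrite (lin_proj (fun y => ev (gen R Q) (f x y)) Pb).
Qed.

End Proj.

Section Psi.
Variable R : comNzRingType.

Lemma cactus_surj n k w : cactus_word n k w -> is_surj n k%:Z w.
Proof.
move=> cw; have sw := size_cactus_word cw; rewrite is_surjP sw eqxx.
by case/and5P: cw => -> -> -> -> _.
Qed.

Lemma cact_surj n k (a : {malg R[seq nat]}) : cact n k a -> supp (is_surj n k%:Z) a.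
Proof. by move=> ca w /ca /cactus_surj. Qed.

Local Notation A := {malg R[seq nat]}.

Lemma circDr n i (a b b' : A) : circ n i a (b + b') = circ n i a b + circ n i a b'.
Proof. exact: (linearD (circ n i a)). Qed.

Lemma cactZ n k (c : R) (a : A) : cact n k a -> cact n k (c *: a).
Proof. exact: suppZ. Qed.

Lemma cact_one : cact 1 0 (word R [:: 1%N]).
Proof. by refine (suppU _). Qed.

Lemma cact_M n : (2 <= n)%N -> cact n (n - 2) (M R n).
Proof. by move=> n2; apply/cprimes_cact/cprimes_M. Qed.

Lemma dif_one : dif (word R [:: 1%N]) = 0.
Proof. by rewrite /dif lin_word del_cons_notin // scale0r add0r. Qed.

Definition tree_image : GenTree.tree unit -> A := tmap (word R [:: 1%N]) (@circ R) (M R).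

Lemma cact_tree_image t : wf_tree t -> cact (leaves t) (tdeg t) (tree_image t).
Proof.
apply: cact_tmap; [exact: cactZ|exact: cact_one|exact: cact_circ|exact: cact_M].
Qed.

Lemma tree_image_graft s t i : wf_tree s -> wf_tree t -> (0 < i <= leaves t)%N ->
  tree_image (graft s t i) = (-1) ^+ (tdeg s * tdeg_after t i) *: circ (leaves s) i (tree_image t) (tree_image s).
Proof.
apply: tmap_graft; [exact: cactZ|exact: circZl|exact: circZr|exact: cact_one|
  exact: cact_circ|exact: cact_M|exact: circ_nested|exact: circ_parallel|exact: circ_unitl].
Qed.

Lemma tree_image_dif t : wf_tree t -> ev tree_image (tree_diff t) = dif (tree_image t).
Proof.
apply: tmap_dif; [exact: cactZ|exact: circDl|exact: circDr|exact: circZl|exact: circZr|exact: cact_one|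
  exact: cact_circ|exact: cact_M|exact: circ_nested|exact: circ_parallel|exact: difZ|exact: dif_one|
  exact: circ_dif|exact: dif_M].
Qed.

Lemma tree_image_corolla n : (2 <= n)%N -> tree_image (corolla n) = M R n.
Proof. apply: tmap_corolla; [exact: cact_M|exact: circ_unitr]. Qed.

Definition psi n (k : int) : {malg R[{t : tree | is_tree n k t}]} -> {malg R[{u : seq nat | is_surj n k u}]} :=
  lin (fun t : {t : tree | is_tree n k t} => proj (is_surj n k) (tree_image (val t))).
HB.instance Definition _ n k := GRing.Linear.on (@psi n k).

Lemma psi_gen n k t : is_tree n k t -> psi (gen R (is_tree n k) t) = proj (is_surj n k) (tree_image t).
Proof. exact: (@lin_gen _ _ _ _ (fun t => proj (is_surj n k) (tree_image t))). Qed.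

Lemma supp_tree_image n k t : is_tree n k t -> supp (is_surj n k) (tree_image t).
Proof.
by case/and3P => wt /eqP<- /eqP<-; exact/cact_surj/cact_tree_image.
Qed.

Lemma is_tree_graft m n p q i s t : (0 < i <= m)%N -> is_tree m p t -> is_tree n q s ->
  is_tree (n + m - 1) (p + q) (graft s t i).
Proof.
move=> im /and3P[wt /eqP lt /eqP dt] /and3P[ws /eqP ls /eqP ds]; rewrite -lt in im.
have [wg lg dg] := graft_inv ws wt im.
by rewrite /is_tree wg lg dg lt ls addnC eqxx -dt -ds PoszD eqxx.
Qed.

Lemma is_tree_diff n k t t' : is_tree n k t -> t' \in [seq e.2 | e <- tree_diff t] ->
  is_tree n (k - 1) t'.
Proof.
move=> /and3P[wt /eqP lt /eqP dt] /(tree_diff_drops wt)[w' l' d'].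
by rewrite /is_tree w' l' lt -dt -d' -addn1 PoszD addrK !eqxx.
Qed.

Lemma psi_unit : psi (gen R (is_tree 1 0) leaf) = gen R (is_surj 1 0) [:: 1%N].
Proof. by rewrite (psi_gen (isT : is_tree 1 0 leaf)) /proj lin_word. Qed.

Lemma psi_comp m n p q i (a : {malg R[{t : tree | is_tree m p t}]})
    (b : {malg R[{t : tree | is_tree n q t}]}) : (0 < i <= m)%N ->
  psi (bilin_ext (is_tree (n + m - 1) (p + q)) (tree_comp i) a b) =
  bilin_ext (is_surj (n + m - 1) (p + q)) (surj_comp n i) (psi a) (psi b).
Proof.
move=> im; rewrite !bilin_extE (linear_lin (@psi _ _)) /psi.
rewrite [RHS](linear_lin (lin _)); apply: eq_lin => -[t tt] /=.
rewrite (linear_lin (lin _)).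
under [RHS]eq_lin do rewrite (linear_lin (lin _)).
rewrite [RHS]lin_swap; apply: eq_lin => -[s ts] /=.
set Q := is_surj _ _.
transitivity (bilin_ext Q (surj_comp n i) (proj (is_surj m p) (tree_image t)) (proj (is_surj n q) (tree_image s))); last first.
  by rewrite bilin_extE.
rewrite (bilin_ext_proj _ _ (supp_tree_image tt) (supp_tree_image ts)).
rewrite ev_seq1 linearZ_LR [X in _ *: X = _](lin_gen (fun t' => proj Q (tree_image t')) (is_tree_graft im tt ts)).
have /and3P[wt /eqP lt _] := tt; have /and3P[ws /eqP ls _] := ts.
rewrite tree_image_graft ?lt // /proj linearZ_LR scalerA -expr2 sqrr_sign scale1r ls.
rewrite [LHS]lin_circ; apply: eq_in_lin => v vt; apply: eq_in_lin => u us /=.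
have cv := cact_tree_image wt vt; have cu := cact_tree_image ws us; rewrite lt in cv; rewrite ls in cu.
rewrite ev_surj_comp //.
- exact: cactus_pos cu.
- by case/andP: im.
- exact/letters_positive/cactus_letters/cv.
- exact: cactus_mem cv im.
- by rewrite (size_cactus_word cu) ltn_addr // (cactus_pos cu).
Qed.

Lemma psi_diff n k (a : {malg R[{t : tree | is_tree n k t}]}) :
  psi (lin_ext (is_tree n (k - 1)) tree_diff a) = lin_ext (is_surj n (k - 1)) surj_diff (psi a).
Proof.
rewrite [LHS](linear_lin (@psi _ _)) [RHS](linear_lin (lin _)); apply: eq_lin => -[t tt] /=.
have /and3P[wt _ _] := tt.
rewrite (lin_proj (fun u => ev (gen R (is_surj n (k - 1))) (surj_diff u)) (supp_tree_image tt)).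
rewrite -[signed_sum _ _ _]/(ev (gen R _) _) (linear_ev (@psi _ _)).
transitivity (proj (is_surj n (k - 1)) (dif (tree_image t))).
  rewrite -tree_image_dif // [RHS](linear_ev (lin _)); apply: eq_in_ev => t' tt' /=.
  by rewrite (psi_gen (is_tree_diff tt tt')).
by rewrite /proj lin_dif; apply: eq_lin => v; rewrite ev_surj_diff.
Qed.

Lemma psi_cacti n k (a : {malg R[{t : tree | is_tree n k t}]}) : @in_cacti R n k (psi a).
Proof.
move=> u; rewrite mcoeff_neq0; move: u.
apply: (@supp_lin _ _ _ (fun u => is_cactus (val u))) => -[t tt] _ /=.
apply: proj_supp => u /cact_tree_image.
by have /and3P[wt _ _] := tt => /(_ wt)/and5P[_ _ _ _ /andP[]].
Qed.

Lemma is_tree_corolla n : (2 <= n)%N -> is_tree n (n%:Z - 2) (corolla n).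
Proof.
move=> n2; rewrite /is_tree wf_tree_node n2 size_nseq eqxx.
have -> : all wf_tree (nseq n leaf) by rewrite all_nseq orbT.
have -> : leaves (corolla n) = n by rewrite /= map_nseq sumn_nseq mul1n.
have -> : tdeg (corolla n) = (n - 2)%N by rewrite /= map_nseq sumn_nseq mul0n addn0.
by rewrite eqxx /= -subzn.
Qed.

Lemma psi_corolla n : (2 <= n)%N ->
  psi (gen R (is_tree n (n%:Z - 2)) (corolla n)) = ev (gen R (is_surj n (n%:Z - 2))) (cprime_list (n - 2)).
Proof.
move=> n2; rewrite (psi_gen (is_tree_corolla n2)) tree_image_corolla // M_def.
exact: lin_ev.
Qed.

End Psi.

Theorem theorem4 (R : comNzRingType) :
  exists p : nat -> seq nat -> bool,
  exists psi : forall (n : nat) (k : int),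
      {linear Ainf R n k -> surjection_operad R n k},
    [/\ is_dgOperad_morphism psi,
        forall (n : nat) (k : int) (x : Ainf R n k), in_cacti (psi n k x),
        psi 2%N (2%:Z - 2) (Ainf_m R 2) =
          surj R 2 (2%:Z - 2) [:: 2; 1]%N + surj R 2 (2%:Z - 2) [:: 1; 2]%N
      & forall n : nat, (3 <= n)%N ->
        psi n (n%:Z - 2) (Ainf_m R n) =
          \sum_(u : (2 * n - 2).-tuple 'I_n |
                is_cactus' n (word_of u))
            (-1) ^+ p n (word_of u) *:
              surj R n (n%:Z - 2) (word_of u)].
Proof.
exists psign, (fun n k => @psi R n k); split.
- split; [exact: psi_unit | move=> *; exact: psi_comp | exact: psi_diff].
- exact: psi_cacti.
- rewrite [LHS]psi_corolla // /ev big_cons big_seq1 !scale1r.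
  by [].
- move=> n n3; rewrite [LHS](psi_corolla _ (ltnW n3)); exact: ev_cprime_list (ltnW n3).
Qed.
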